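(* Let $n\ge2$ be an integer, let $\mathbb{M}^n$ be an $n$-dimensional Cartan-Hadamard model manifold with pole $o$ and model function $\psi$, let $1<p<n$, $p^*:=\frac{np}{n-p}$ and $q\ge p^*-1$. Consider the equation $$-\Delta_p u=u^q,\quad u>0,\qquad\text{on }\mathbb{M}^n. \tag{E}$$ (i) Assume that $\Theta^{\frac1{p-1}}\notin L^1(\mathbb{R}^+)$, and suppose further that either there exists $\gamma\in[0,1)$ such that $$\lim_{r\to+\infty}\frac{r^\gamma\,\psi'(r)}{\psi(r)}=:\ell\in(0,+\infty),$$ or $$\lim_{r\to+\infty}\frac{\psi'(r)}{\psi(r)}=+\infty\qquad\text{and}\qquad\lim_{r\to+\infty}\frac{\psi(r)}{\psi'(r)}\left[\log\left(\frac{\psi'(r)}{\psi(r)}\right)\right]'=0.$$ If $u$ is a radial solution to (E), then $$\lim_{r\to+\infty}\left(\int_0^r\Theta^{\frac1{p-1}}\,ds\right)^{\frac{p-1}{q+1-p}}u(r)=\left(\frac{p-1}{q+1-p}\right)^{\frac{p-1}{q+1-p}}.$$ (ii) Assume that $\Theta^{\frac1{p-1}}\in L^1(\mathbb{R}^+)$. If $u$ is a radial solution to (E) with $\lambda:=\lim_{r\to+\infty}u(r)>0$, then $$\lim_{r\to+\infty}\left(\int_r^{+\infty}\Theta^{\frac1{p-1}}\,ds\right)^{-1}\bigl(u(r)-\lambda\bigr)=\lambda^{\frac{q}{p-1}}.$$ Moreover, the limit value $\lambda$ satisfies the universal bound $$\lambda\le\left(\frac{p-1}{q+1-p}\right)^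{\frac{p-1}{q+1-p}}\left(\int_0^{+\infty}\Theta^{\frac1{p-1}}\,ds\right)^{-\frac{p-1}{q+1-p}}.$$
   Context: A Cartan-Hadamard manifold is a complete, simply connected Riemannian manifold with nonpositive sectional curvature. A Cartan-Hadamard model manifold is one with a pole $o$ such that, in global polar coordinates $(r,\theta)\in\mathbb{R}^+\times\mathbb{S}^{n-1}$ about $o$, the metric is $g=dr^2+\psi^2(r)\,g_{\mathbb{S}^{n-1}}$, where $r$ is the Riemannian distance from $o$, $g_{\mathbb{S}^{n-1}}$ is the round metric and the model function $\psi:[0,+\infty)\to[0,+\infty)$ is smooth, with $\psi(0)=0$, $\psi'(0)=1$ and $\psi$ convex (convexity being equivalent to the Cartan-Hadamard property). Set $$\Theta(r):=\frac{\int_0^r\psi^{n-1}\,ds}{\psi^{n-1}(r)},\qquad r>0.$$ $\Delta_p u:=\mathrm{div}(|\nabla u|^{p-2}\nabla u)$. A ''radial solution'' is a positive function $u\in W^{1,p}_{\mathrm{loc}}(\mathbb{M}^n)\cap L^\infty_{\mathrm{loc}}(\mathbb{M}^n)$, depending only on $r=\mathrm{dist}(x,o)$, which solves the equation weakly; one writes $u=u(r)$. *)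

(* Defs.v *)
From HB Require Import structures.
From mathcomp Require Import all_boot all_order all_algebra.
From mathcomp Require Import all_classical all_reals all_analysis.

Set Implicit Arguments.
Unset Strict Implicit.
Unset Printing Implicit Defensive.

Import Order.TTheory GRing.Theory Num.Theory.
Import numFieldNormedType.Exports.

Local Open Scope classical_set_scope.
Local Open Scope ring_scope.

Definition rv_display : measure_display.
Proof. exact: default_measure_display. Qed.

(* R^n carries its Borel sigma-algebra, generated by the coordinates. *)
Section rv_measurable.
Context (R : realType) (n : nat).

Let coord : 'I_n -> 'rV[R]_n -> measurableTypeR R := fun i x => x 0 i.

Let rv_set0 : g_sigma_preimage coord set0.
Proof. exact: sigma_algebra0. Qed.

Let rv_setC A : g_sigma_preimage coord A -> g_sigma_preimage coord (~` A).
Proof. exact: sigma_algebraC. Qed.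

Let rv_bigcup (F : _^nat) : (forall i, g_sigma_preimage coord (F i)) ->
  g_sigma_preimage coord (\bigcup_i (F i)).
Proof. exact: sigma_algebra_bigcup. Qed.

HB.instance Definition _ := @isMeasurable.Build rv_display
  'rV[R]_n (g_sigma_preimage coord) rv_set0 rv_setC rv_bigcup.

End rv_measurable.

Section lebesgue_rv.
Context (R : realType).
Local Notation mR := (measurableTypeR R).

Definition tcons n (z : n.-tuple mR * mR) : n.+1.-tuple mR :=
  [the n.+1.-tuple mR of z.2 :: z.1].

Lemma measurable_tcons n : measurable_fun [set: n.-tuple mR * mR] (@tcons n).
Proof. exact: measurable_cons. Qed.

Definition rv_of_tuple n (t : n.-tuple mR) : 'rV[R]_n := \row_i tnth t i.

Lemma measurable_rv_of_tuple n :
  measurable_fun [set: n.-tuple mR] (@rv_of_tuple n).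
Proof.
move=> _ A mA; rewrite setTI.
have H := @g_sigma_preimage_comp _ mR n 'rV[R]_n
  (fun i (x : 'rV[R]_n) => x 0 i) _ (@rv_of_tuple n).
have E : (fun i => (fun x : 'rV[R]_n => x 0 i) \o @rv_of_tuple n) =
         (fun i (t : n.-tuple mR) => tnth t i).
  by apply/funext => i; apply/funext => t; rewrite /= mxE.
rewrite E in H.
suff : g_sigma_preimage (fun i (t : n.-tuple mR) => tnth t i)
         (@rv_of_tuple n @^-1` A) by [].
by rewrite H; exists A => //; rewrite setTI.
Qed.

(* [pushforward] together with its measure structure, which cannot be
   inferred because it depends on the proof of measurability. *)
Definition pushm d1 d2 (T1 : measurableType d1) (T2 : measurableType d2)
    (m : {measure set T1 -> \bar R}) (f : T1 -> T2)
    (mf : measurable_fun [set: T1] f) : {measure set T2 -> \bar R} :=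
  measure_function_pushforward__canonical__measure_function_Measure m mf.

Fixpoint lebesgue_tuple n : {measure set (n.-tuple mR) -> \bar R} :=
  match n with
  | 0 => \d_ ([tuple] : 0.-tuple mR)
  | m.+1 => pushm (lebesgue_tuple m \x lebesgue_measure)%E (@measurable_tcons m)
  end.

(* n-dimensional Lebesgue measure *)
Definition lebesgue_rv n : {measure set 'rV[R]_n -> \bar R} :=
  pushm (lebesgue_tuple n) (@measurable_rv_of_tuple n).

End lebesgue_rv.

Section calculus.
Context (R : realType) (n : nat).
Implicit Types (f phi : 'rV[R]_n -> R) (v w x : 'rV[R]_n) (i j : 'I_n).

Definition dot v w : R := \sum_i v 0 i * w 0 i.

(* Euclidean norm; the norm [`|x|] of the library is the sup norm. *)
Definition enorm x : R := Num.sqrt (dot x x).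

Definition basis i : 'rV[R]_n := delta_mx 0 i.

Definition partial i f : 'rV[R]_n -> R := 'D_(basis i) f.

Definition differential f x : 'rV[R]_n := \row_i partial i f x.

Fixpoint Ck (k : nat) f : Prop :=
  continuous f /\
  if k is k'.+1 then
    forall i, (forall x, derivable f x (basis i)) /\ Ck k' (partial i f)
  else True.

Definition test_function phi : Prop :=
  (forall k, Ck k phi) /\ compact (closure [set x | phi x != 0]).

End calculus.

(* C^oo up to the boundary on [0, +oo[; the values on ]-oo, 0[ are irrelevant. *)
Definition smooth_halfline (R : realType) (psi : R -> R) : Prop :=
  exists f : R -> R, (forall k x, derivable (derive1n k f) x 1) /\
                     (forall r, 0 <= r -> psi r = f r).

(* psi'(0) is a right derivative. *)
Record model_function (R : realType) (psi : R -> R) : Prop := ModelFunction {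
  model_smooth : smooth_halfline psi ;
  model_ge0 : forall r, 0 <= r -> 0 <= psi r ;
  model_0 : psi 0 = 0 ;
  model_deriv0 : h^-1 * (psi h - psi 0) @[h --> 0^'+] --> (1 : R) ;
  model_convex : convex_function (`[0, +oo[%classic : set R) psi }.

(* The model manifold is R^n, seen through the global chart x = r theta,
   r = |x|, in which the pole is 0 and r is the distance from the pole. *)
Section model_manifold.
Context (R : realType) (n : nat) (psi : R -> R).
Implicit Types (f u phi : 'rV[R]_n -> R) (v w x : 'rV[R]_n) (i j : 'I_n).

(* differentials at x of the polar coordinates r = |x| and theta = x / |x| *)
Definition d_r x v : R := dot x v / enorm x.
Definition d_theta x v : 'rV[R]_n :=
  (enorm x)^-1 *: (v - d_r x v *: ((enorm x)^-1 *: x)).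

(* g = dr^2 + psi(r)^2 g_S, where the round metric g_S is induced by [dot];
   since psi(0) = 0 and psi'(0) = 1, it extends by the Euclidean metric. *)
Definition metric x v w : R :=
  if x == 0 then dot v w
  else d_r x v * d_r x w + psi (enorm x) ^+ 2 * dot (d_theta x v) (d_theta x w).

Definition gram x : 'M[R]_n := \matrix_(i, j) metric x (basis R i) (basis R j).

(* density of the Riemannian measure with respect to dx *)
Definition vol x : R := Num.sqrt (\det (gram x)).

(* gradient at x of a function with differential w at x *)
Definition sharp x w : 'rV[R]_n := w *m invmx (gram x).

Definition gnorm x v : R := Num.sqrt (metric x v v).

Local Notation dx := (@lebesgue_rv R n).

(* du is the weak differential of u in the chart. *)
Definition weak_differential u (du : 'rV[R]_n -> 'rV[R]_n) : Prop :=
  forall phi i, test_function phi ->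
    (\int[dx]_x (u x * partial i phi x)%:E =
     - \int[dx]_x (du x 0 i * phi x)%:E)%E.

Definition Lploc (p : R) f : Prop :=
  measurable_fun [set: 'rV[R]_n] f /\
  forall K : set 'rV[R]_n, compact K ->
    (\int[dx]_(x in K) (`|f x| `^ p * vol x)%:E < +oo)%E.

Definition Linfloc f : Prop :=
  measurable_fun [set: 'rV[R]_n] f /\
  forall K : set 'rV[R]_n, compact K ->
    exists M : R, {ae dx, forall x, K x -> `|f x| <= M}.

(* u lies in W^{1,p}_loc, with weak differential du *)
Definition W1ploc (p : R) u (du : 'rV[R]_n -> 'rV[R]_n) : Prop :=
  [/\ weak_differential u du,
      measurable_fun [set: 'rV[R]_n] du,
      Lploc p u &
      Lploc p (fun x => gnorm x (sharp x (du x)))].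

(* weak form of - div (|grad u|^(p-2) grad u) = u^q; the integrand on the left
   is 0 where grad u = 0, also for p < 2 *)
Definition weak_equation (p q : R) u (du : 'rV[R]_n -> 'rV[R]_n) : Prop :=
  forall phi, test_function phi ->
    (\int[dx]_x (gnorm x (sharp x (du x)) `^ (p - 2) *
                 metric x (sharp x (du x)) (sharp x (differential phi x)) *
                 vol x)%:E =
     \int[dx]_x (u x `^ q * phi x * vol x)%:E)%E.

(* U is the profile: the solution is x |-> U (dist(x, o)). *)
Definition radial_solution (p q : R) (U : R -> R) : Prop :=
  let u := fun x => U (enorm x) in
  [/\ {ae dx, forall x, 0 < u x},
      Linfloc u &
      exists du, W1ploc p u du /\ weak_equation p q u du].

End model_manifold.

(* Elements of W^{1,p}_loc are classes modulo null sets, so their limits at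
   infinity are taken along r -> +oo modulo null sets. On functions that are
   continuous near +oo, such as the continuous representative of a radial
   solution, this is the limit at +oo. *)
Definition ess_pinfty (R : realType) : set_system R :=
  [set A | exists M : R,
     {ae (@lebesgue_measure R), forall r : R, M < r -> A r}].
Arguments ess_pinfty R : clear implicits.

Section Theta.
Context (R : realType) (n : nat) (psi : R -> R).
Local Notation mu := (@lebesgue_measure R).

Definition Theta (r : R) : R :=
  (\int[mu]_(s in `[0, r]) (psi s ^+ n.-1)) / psi r ^+ n.-1.

(* Theta^(1/(p-1)) *)
Definition Theta_pow (p r : R) : R := Theta r `^ (p - 1)^-1.

Definition Theta_pow_L1 (p : R) : Prop :=
  mu.-integrable `]0, +oo[ (EFin \o Theta_pow p).

End Theta.

(* Main.v *)
(** Write x = r theta with r = |x|. A solution U(|x|) has a radial weak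
    differential W(|x|) x/|x|, and testing the equation against functions of
    |x|^2 gives, by the du Bois-Reymond lemma,
      |W|^(p-2) W psi^(n-1) = - P,   P(r) = \int_0^r U^q psi^(n-1).
    Hence U has a C^1 representative v, with w = - v' = (P/psi^(n-1))^(1/(p-1)).

    Put Psi = \int_0^r psi^(n-1), Theta = Psi/psi^(n-1), kappa = (q+1-p)/(p-1)
    and T = \int_0^r Theta^(1/(p-1)). Then
      (v^-kappa)' = kappa (P/(v^q Psi))^(1/(p-1)) T',
    and P >= v^q Psi because v decreases, so that v^-kappa >= kappa T; this
    contains the bound in (ii). If T is bounded, P/Psi tends to lambda^q and the
    limit in (ii) follows from l'Hopital's rule applied to v - lambda.

    If T is unbounded, everything reduces to P/(v^q Psi) -> 1, and by l'Hopital's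
    rule to Theta w/v -> 0. Convexity gives psi^n <= n psi' Psi, which makes the
    Pohozaev functional nonincreasing, and this yields
      (p-1) Theta w/v <= p/(q+1) < 1.
    Either growth hypothesis implies (n-1) Theta psi'/psi -> 1, from which
    Theta^(p/(p-1))/T -> 0. So y = (Theta w/v)^(p-1) satisfies, for some d > 0 and
    every eps > 0, y' <= (eps - d y) Psi'/Psi near infinity, whence y -> 0. *)
From HB Require Import structures.
From mathcomp Require Import all_boot all_order all_algebra.
From mathcomp Require Import all_classical all_reals all_analysis.
From mathcomp Require Import measurable_realfun.
From mathcomp Require Import ring lra.
Import Order.TTheory GRing.Theory Num.Theory.
Import numFieldNormedType.Exports.
Require Import Defs.
Set Implicit Arguments.
Unset Strict Implicit.
Unset Printing Implicit Defensive.
Local Open Scope classical_set_scope.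
Local Open Scope ring_scope.

(** * Smooth functions *)

(** Three points stay implicit in the overview. A radial u has a radial weak differential only after
    an argument: integrals over spheres are Radon-Nikodym densities of push-forwards under x |->
    |x|, and du = W(|x|) x/|x| is obtained by testing with phi h(|x|^2), for arbitrary phi, and by
    comparing primitives instead of differentiating u. At the pole, functions of r are controlled on
    ]0, +oo[ only, so a comparison that starts at r = 0 uses a lower bound - K s near 0
    ([ge0_of_vanish]); tests in |x|^2 are smooth across the pole without vanishing there, which is
    why the flux equation has no constant of integration. Finally, the decay of y needs a negative
    linear coefficient, that is, (p-1) Theta w/v bounded away from 1 before its limit is known: this
    is what the Pohozaev inequality supplies, through q + 1 >= p^*, and the gap 1 - p/(q+1) is the
    origin of d. The forcing term of that equation contains v itself, and v^-kappa >= kappa T is the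
    decay of v available at that stage. *)

Section flat_exp.
Context {R : realType}.
Implicit Types (t : R) (k : nat).

(** The factor t^-k makes the family closed under derivation. At k = 0 it is the standard C^oo
    function that vanishes exactly for t <= 0. *)
Definition flat_exp k t : R := if 0 < t then t ^- k * expR (- t^-1) else 0.

Lemma flat_exp_ge0 k t : 0 <= flat_exp k t.
Proof.
rewrite /flat_exp; case: ifP => // t0.
by rewrite mulr_ge0 ?expR_ge0// invr_ge0 exprn_ge0// ltW.
Qed.

Lemma flat_exp_gt0 k t : (0 < flat_exp k t) = (0 < t).
Proof.
rewrite /flat_exp; case: ifP => t0; last by rewrite ltxx.
by rewrite mulr_gt0 ?expR_gt0// invr_gt0 exprn_gt0.
Qed.

Lemma flat_exp_le0 k t : t <= 0 -> flat_exp k t = 0.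
Proof. by rewrite /flat_exp leNgt => /negbTE ->. Qed.

Lemma flat_exp0_le1 t : flat_exp 0 t <= 1.
Proof.
rewrite /flat_exp; case: ifP => // t0.
by rewrite expr0 invr1 mul1r expR_le1 oppr_le0 invr_ge0 ltW.
Qed.

(** From e^(1/t) >= (1/t)^(k+1) / (k+1)!. A bound that is linear in t, for every k, is what
    differentiation at 0 asks for. *)
Lemma flat_exp_bound k t : `|flat_exp k t| <= (k.+1)`!%:R * `|t|.
Proof.
rewrite ger0_norm ?flat_exp_ge0// /flat_exp; case: ifPn => [t0|_]; last first.
  by rewrite mulr_ge0.
have /= := @expR_ge1Dxn R t^-1 k; rewrite invr_ge0 => /(_ (ltW t0)) h.
have {}h : (t ^+ k.+1)^-1 / k.+1`!%:R <= expR t^-1.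
  by rewrite -exprVn (le_trans _ h)// lerDr.
rewrite expRN gtr0_norm//.
have f0 : (0:R) < k.+1`!%:R by rewrite ltr0n fact_gt0.
rewrite ler_pdivrMr ?expR_gt0//.
have tk : (0:R) < t ^+ k by rewrite exprn_gt0.
apply: le_trans (ler_wpM2l _ h); last by rewrite mulr_ge0// ltW.
rewrite exprS invfM.
suff -> : k.+1`!%:R * t * (t^-1 * (t ^+ k)^-1 / k.+1`!%:R) = t ^- k by [].
by field; rewrite !gt_eqF.
Qed.

Lemma is_derive_flat_exp k t :
  is_derive t 1 (flat_exp k) (flat_exp k.+2 t - k%:R * flat_exp k.+1 t).
Proof.
have [t0|t0|->] := ltgtP t 0.
- rewrite !flat_exp_le0 ?ltW// mulr0 subrr.
  apply: (@near_eq_is_derive _ _ _ (cst 0)).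
  near=> z; rewrite flat_exp_le0// ltW//; near: z; exact: lt_nbhsl.
- apply: (@near_eq_is_derive _ R R (fun s : R => s ^- k * expR (- s^-1))).
    near=> z; rewrite /flat_exp ifT//; near: z; exact: lt_nbhsr.
  have tn0 : t != 0 by rewrite gt_eqF.
  have d1 : is_derive t 1 (fun s : R => s^-1) (- t ^- 2 *: 1).
    by apply: is_deriveV.
  have d2 : is_derive t 1 (fun s : R => - s^-1) (t ^- 2).
    by apply: is_derive_eq; rewrite scaler1 opprK.
  have d3 : is_derive t 1 (fun s : R => expR (- s^-1)) (expR (- t^-1) * t ^- 2).
    have := @is_derive1_comp _ expR (fun s : R => - s^-1) t _ _ _ d2.
    exact.
  have d4 : is_derive t 1 (fun s : R => s ^- k) (- (k%:R * t ^- k.+1)).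
    have := @is_deriveX _ _ _ k t 1 _ d1.
    have -> : GRing.inv ^+ k = (fun s : R => s ^- k).
      by apply/funext => s; rewrite -exprVn; elim: (k) => // j IH; rewrite !exprS -IH.
    move=> d4; apply: (is_derive_eq d4).
    rewrite scaler1 exprVn; case: (k) => [|j] /=; first by rewrite /GRing.scale/= !mul0r oppr0.
    rewrite /GRing.scale/= -mulr_natl !exprS.
    by field; rewrite tn0 expf_neq0.
  have d5 := is_deriveM d4 d3; apply: (is_derive_eq d5).
  rewrite /flat_exp t0 /GRing.scale/= !exprS; field.
  by rewrite tn0 expf_neq0.
- rewrite !flat_exp_le0// mulr0 subrr.
  suff H : (h^-1 *: (flat_exp k (h *: 1 + 0) - flat_exp k 0)) @[h --> (0:R)^'] --> (0:R).
    split; [by apply/cvg_ex; exists 0 | exact: cvg_lim H].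
  rewrite (flat_exp_le0 k (lexx 0)).
  (* At 0 the difference quotient is the next member of the family, which the linear bound sends to
     0. *)
  have E : forall h : R, h^-1 *: (flat_exp k (h *: 1 + 0) - 0) = flat_exp k.+1 h.
    move=> h; rewrite subr0 addr0 scaler1 /flat_exp; case: ifPn => h0.
      by rewrite /GRing.scale/= exprS invfM mulrA.
    by rewrite scaler0.
  under eq_cvg do rewrite E.
  apply/cvgr0Pnorm_lt => e e0.
  have f0 : (0:R) < k.+2`!%:R by rewrite ltr0n fact_gt0.
  near=> h; apply: le_lt_trans (flat_exp_bound _ _) _.
  rewrite mulrC -ltr_pdivlMr//; near: h.
  apply: dnbhs0_lt; by rewrite divr_gt0.
Unshelve. all: by end_near. Qed.

(** Smooth approximation of the indicator of t > 0, with values in [0, 1]: it turns identities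
    tested against smooth functions into identities for integrals over positivity sets. *)
Lemma flat_exp0_cvg t :
  flat_exp 0 (k.+1%:R * t) @[k --> \oo] --> ((0 < t)%R%:R : R).
Proof.
case: ltP => t0; last first.
  under eq_cvg do rewrite flat_exp_le0 ?mulr_ge0_le0//.
  exact: cvg_cst.
under eq_cvg do rewrite /flat_exp ifT ?mulr_gt0// expr0 invr1 mul1r invfM.
have -> : (true%:R : R) = expR (- (0 * t^-1)) by rewrite mul0r oppr0 expR0.
apply: continuous_cvg; first exact: continuous_expR.
by apply: cvgN; apply: cvgMl; exact: cvg_harmonic.
Qed.

End flat_exp.

Section smooth.
Context {R : realType}.

(* Closed under derivation by construction, so that the conditions [Ck k] on test
   functions follow by induction. *)
Inductive smooth1 : (R -> R) -> Prop :=
| smooth1_cst c : smooth1 (fun=> c)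
| smooth1_id : smooth1 (fun t => t)
| smooth1D f g : smooth1 f -> smooth1 g -> smooth1 (fun t => f t + g t)
| smooth1M f g : smooth1 f -> smooth1 g -> smooth1 (fun t => f t * g t)
| smooth1_flat k f : smooth1 f -> smooth1 (fun t => flat_exp k (f t))
| smooth1_prim F f : smooth1 f -> (forall t, is_derive t (1:R) F (f t)) -> smooth1 F.

Lemma smooth1_derive f : smooth1 f ->
  exists2 g, smooth1 g & forall t, is_derive t (1:R) f (g t).
Proof.
elim=> [c| |g h _ [g' sg' dg] _ [h' sh' dh]|g h sg [g' sg' dg] sh [h' sh' dh]
  |k g sg [g' sg' dg]|F g sg _ dF].
- by exists (fun=> 0); [exact: smooth1_cst|move=> t; exact: (@is_derive_cst R R R c)].
- by exists (fun=> 1); [exact: smooth1_cst|move=> t; exact: is_derive_id].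
- exists (fun t => g' t + h' t); [exact: smooth1D|].
  by move=> t; exact: is_deriveD.
- exists (fun t => g t * h' t + h t * g' t); first by apply: smooth1D; exact: smooth1M.
  by move=> t; have := is_deriveM (dg t) (dh t).
- exists (fun t => (flat_exp k.+2 (g t) + (- k%:R) * flat_exp k.+1 (g t)) * g' t).
    apply: smooth1M => //; apply: smooth1D; first exact: smooth1_flat.
    by apply: smooth1M; [exact: smooth1_cst|exact: smooth1_flat].
  move=> t; rewrite mulNr.
  exact: (@is_derive1_comp _ (flat_exp k) g t _ _ (is_derive_flat_exp k (g t)) (dg t)).
- by exists g.
Qed.

Lemma smooth1_continuous f : smooth1 f -> continuous f.
Proof.
move=> /smooth1_derive[g _ dg] x.
by apply/differentiable_continuous/derivable1_diffP; case: (dg x).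
Qed.

Lemma smooth1_measurable f : smooth1 f ->
  measurable_fun [set: measurableTypeR R] f.
Proof. by move=> /smooth1_continuous; exact: continuous_measurable_fun. Qed.

Lemma smooth1_comp f g : smooth1 f -> smooth1 g -> smooth1 (fun t => f (g t)).
Proof.
move=> + sg; have [g' sg' dg] := smooth1_derive sg.
elim=> [c| |f1 f2 _ s1 _ s2|f1 f2 _ s1 _ s2|k f1 _ s1|F f1 _ s1 dF].
- exact: smooth1_cst.
- exact: sg.
- exact: smooth1D.
- exact: smooth1M.
- exact: smooth1_flat.
- by apply: (@smooth1_prim _ (fun t => f1 (g t) * g' t)); exact: smooth1M.
Qed.

Context {n : nat}.

(** Closed under partial derivatives because [smooth1] is closed under derivation; it contains the
    coordinates, all h(|x|^2) and the cut-offs built from [flat_exp]. *)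
Inductive smoothn : ('rV[R]_n -> R) -> Prop :=
| smoothn_cst c : smoothn (fun=> c)
| smoothn_coord i : smoothn (fun x => x 0 i)
| smoothnD f g : smoothn f -> smoothn g -> smoothn (fun x => f x + g x)
| smoothnM f g : smoothn f -> smoothn g -> smoothn (fun x => f x * g x)
| smoothn_comp h f : smooth1 h -> smoothn f -> smoothn (fun x => h (f x)).

(** Directional derivatives only see the line t |-> t v + x, so the one-variable chain rule is
    enough. *)
Lemma is_derive_comp1 (h : R -> R) (f : 'rV[R]_n -> R) x v dh df :
  is_derive (f x) 1 h dh -> is_derive x v f df ->
  is_derive x v (fun y => h (f y)) (dh * df).
Proof.
move=> [dh1 dh2] [df1 df2].
have e (g : 'rV[R]_n -> R) a : is_derive (0:R) 1 (fun t : R => g (t *: v + x)) a <->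
    is_derive x v g a.
  split=> -[H1 H2].
    split; first exact: (derivable1P _ _ _).2 H1.
    rewrite -H2 /derive; apply: congr1; apply: congr2 => //.
    by apply/funext => t/=; rewrite addr0 scale0r add0r [_%:A]mulr1.
  split; first exact: (derivable1P _ _ _).1 H1.
  rewrite -H2 /derive; apply: congr1; apply: congr2 => //.
  by apply/funext => t/=; rewrite addr0 scale0r add0r [_%:A]mulr1.
apply/e.
apply: (@is_derive1_comp _ h (fun t : R => f (t *: v + x))); last by apply/e.
by rewrite scale0r add0r.
Qed.

Lemma is_derive_coord i (x v : 'rV[R]_n) :
  is_derive x v (fun y : 'rV[R]_n => y 0 i) (v 0 i).
Proof.
suff H : h^-1 *: ((h *: v + x) 0 i - x 0 i) @[h --> (0:R)^'] --> v 0 i.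
  split; [by apply/cvg_ex; exists (v 0 i) | exact: cvg_lim H].
apply: cvg_near_cst; near=> h.
rewrite !mxE addrK scalerA mulVf ?scale1r//.
near: h; exact: nbhs_dnbhs_neq.
Unshelve. all: by end_near. Qed.

Lemma smoothn_derive f i : smoothn f ->
  exists2 g, smoothn g & forall x, is_derive x (basis R i) f (g x).
Proof.
elim=> [c|j|g h _ [g' sg' dg] _ [h' sh' dh]|g h sg [g' sg' dg] sh [h' sh' dh]
  |h g /smooth1_derive[h' sh' dh] sg [g' sg' dg]].
- by exists (fun=> 0); [exact: smoothn_cst|move=> t; exact: is_derive_cst].
- exists (fun=> basis R i 0 j); first exact: smoothn_cst.
  by move=> x; exact: is_derive_coord.
- by exists (fun t => g' t + h' t); [exact: smoothnD|move=> t; exact: is_deriveD].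
- exists (fun t => g t * h' t + h t * g' t); first by apply: smoothnD; exact: smoothnM.
  by move=> t; have := is_deriveM (dg t) (dh t).
- exists (fun x => h' (g x) * g' x).
    by apply: smoothnM => //; exact: smoothn_comp.
  by move=> x; exact: is_derive_comp1.
Qed.

Lemma smoothn_partial f i : smoothn f -> smoothn (partial i f).
Proof.
move=> /(smoothn_derive i)[g sg dg].
suff -> : partial i f = g by [].
by apply/funext => x; case: (dg x).
Qed.

Lemma smoothn_derivable f i x : smoothn f -> derivable f x (basis R i).
Proof. by move=> /(smoothn_derive i)[g sg dg]; case: (dg x). Qed.

Lemma smoothn_continuous f : smoothn f -> continuous f.
Proof.
elim=> [c|j|g h _ cg _ ch|g h _ cg _ ch|h g sh _ cg] x.
- exact: cst_continuous.
- exact: coord_continuous.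
- exact: (@continuousD _ _ _ g h x (cg x) (ch x)).
- exact: (@continuousM _ _ g h x (cg x) (ch x)).
- apply: (@continuous_comp _ _ _ g h); first exact: cg.
  exact: smooth1_continuous.
Qed.

Lemma measurable_coord i :
  measurable_fun [set: 'rV[R]_n] (fun x : 'rV[R]_n => x 0 i : measurableTypeR R).
Proof.
move=> _ A mA; rewrite setTI; apply: sub_sigma_algebra.
rewrite (bigD1 i)//=; left.
by exists A => //; rewrite setTI.
Qed.

Lemma smoothn_measurable f : smoothn f -> measurable_fun [set: 'rV[R]_n] f.
Proof.
elim=> [c|j|g h _ cg _ ch|g h _ cg _ ch|h g sh _ cg].
- exact: measurable_cst.
- exact: measurable_coord.
- exact: measurable_funD.
- exact: measurable_funM.
- apply: (@measurableT_comp _ _ _ _ _ _ h) => //.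
  exact: smooth1_measurable.
Qed.

Lemma smoothn_Ck k f : smoothn f -> Ck k f.
Proof.
elim: k f => [|k IH] f sf /=; split => //; try exact: smoothn_continuous.
move=> i; split; first by move=> x; exact: smoothn_derivable.
by apply: IH; exact: smoothn_partial.
Qed.

End smooth.

(** * Lebesgue measure on R^n *)

Section transfer_density.
Local Open Scope ereal_scope.
Context d1 d2 (X : measurableType d1) (Y : measurableType d2) (R : realType).
Variables (m : {measure set X -> \bar R}) (nu : {measure set Y -> \bar R}).
Variables (phi : X -> Y) (w : X -> R).
Hypotheses (mphi : measurable_fun [set: X] phi) (mw : measurable_fun [set: X] w)
  (w0 : forall x, (0 <= w x)%R)
  (nuE : forall A, measurable A -> nu A = \int[m]_(x in phi @^-1` A) (w x)%:E).

Import HBNNSimple.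

(** Monotone convergence along simple functions. The same formula serves for weighted push-forwards
    (phi = |x|) and for measures with a density on the line (phi = id). *)
Lemma ge0_integral_density (g : Y -> \bar R) : (forall y, 0 <= g y) ->
  measurable_fun [set: Y] g ->
  \int[nu]_y g y = \int[m]_x (g (phi x) * (w x)%:E).
Proof.
move=> g0 mg.
pose h := nnsfun_approx measurableT mg.
have mw' : measurable_fun [set: X] (EFin \o w) by exact/measurable_EFinP.
have mhphi n : measurable_fun [set: X] (fun x => (h n (phi x))%:E).
  apply/measurable_EFinP; apply: (@measurableT_comp _ _ _ _ _ _ (h n)) => //.
have -> : \int[nu]_y g y = limn (fun n => \int[nu]_y (h n y)%:E).
  rewrite -monotone_convergence//.
  - apply: eq_integral => y _; apply/esym/cvg_lim => //.
    exact: cvg_nnsfun_approx.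
  - by move=> n; exact/measurable_EFinP.
  - by move=> n y _; rewrite lee_fin.
  - by move=> y _ a b ab; rewrite lee_fin; exact/lefP/nd_nnsfun_approx.
have -> : \int[m]_x (g (phi x) * (w x)%:E) =
    limn (fun n => \int[m]_x ((h n (phi x))%:E * (w x)%:E)).
  rewrite -monotone_convergence//.
  - apply: eq_integral => x _; apply/esym/cvg_lim => //.
    by apply: cvgeZr => //; exact: cvg_nnsfun_approx.
  - by move=> n; exact: emeasurable_funM.
  - by move=> n x _; rewrite mule_ge0// lee_fin.
  - move=> x _ a b ab; rewrite lee_wpmul2r ?lee_fin//.
    exact/lefP/nd_nnsfun_approx.
congr (limn _); apply/funext => n.
rewrite integralT_nnsfun sintegralE.
transitivity (\int[m]_x (\sum_(r \in range (h n))
    (r%:E * (((\1_(phi @^-1` (h n @^-1` [set r])) x)%:E * (w x)%:E)))))%E.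
  rewrite ge0_integral_fsum//.
  - apply: eq_fsbigr => r; rewrite inE => -[t _ <-].
    rewrite ge0_integralZl//; last 2 first.
    + by move=> x _; rewrite mule_ge0// lee_fin.
    + by rewrite lee_fin.
    rewrite nuE//; congr (_ * _).
    under [RHS]eq_integral do rewrite muleC.
    rewrite integral_mkcond; apply: eq_integral => x _.
    by rewrite epatch_indic.
  - apply: emeasurable_funM => //; apply/measurable_EFinP.
    apply: measurable_indic; rewrite -[X in measurable X]setTI; exact: mphi.
  - move=> r; apply: emeasurable_funM => //; apply: emeasurable_funM => //.
    apply/measurable_EFinP.
    apply: measurable_indic; rewrite -[X in measurable X]setTI; exact: mphi.
  - move=> r x _.
    have [->|/set0P[x' E]] := eqVneq (phi @^-1` (h n @^-1` [set r])) set0.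
      by rewrite indic0 mul0e mule0.
    rewrite mule_ge0 ?mule_ge0 ?lee_fin//.
    by rewrite -E.
apply: eq_integral => x _.
under eq_fsbigr do rewrite muleA.
rewrite -ge0_mule_fsuml; last first.
  move=> r; rewrite -EFinM; exact: nnfun_muleindic_ge0.
congr (_ * _); rewrite [in RHS]fimfunE -fsumEFin//.
Qed.

End transfer_density.

Section lebesgue_affine.
Context (R : realType).
Local Notation mR := (measurableTypeR R).
Local Notation mu := (@lebesgue_measure R).

(** The image of Lebesgue measure under t |-> a t + b, rescaled by a, has the right value on
    half-open intervals; uniqueness of Lebesgue measure does the rest. *)
Lemma lebesgue_measure_affine (a b : R) (A : set mR) : 0 < a -> measurable A ->
  (mu ((fun t => a * t + b)%R @^-1` A) = (a^-1)%:E * mu A)%E.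
Proof.
move=> a0 mA.
have mf : measurable_fun [set: mR] (fun t : mR => (a * t + b)%R : mR).
  apply: measurable_funD => //; exact: mulrl_measurable.
pose na : {nonneg R} := NngNum (ltW a0).
suff -> : mu A = mscale na (pushm mu mf) A.
  by rewrite /mscale/= /mscale/= muleA -EFinM mulVf ?gt_eqF// mul1e.
apply: lebesgue_measure_unique => // _ [[x y] _ <-].
rewrite /= /mscale/= /pushforward.
have -> : (fun t => a * t + b)%R @^-1` `]x, y] = `](x - b) / a, (y - b) / a]%classic.
  apply/seteqP; split=> t /=; rewrite !in_itv/= ltr_pdivrMr// ler_pdivlMr//
    ltrBlDr lerBrDr mulrC //.
rewrite !lebesgue_measure_itv/= !lte_fin ltr_pM2r ?invr_gt0// ltrD2r.
case: ifPn => _; last by rewrite mule0.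
rewrite !EFinN -!EFinD -EFinM; congr EFin; field.
by rewrite gt_eqF.
Qed.

Definition affine_tuple n (a : R) (b : 'I_n -> R) (t : n.-tuple mR) :
  n.-tuple mR := [tuple a * tnth t i + b i | i < n].

Lemma measurable_affine_tuple n a (b : 'I_n -> R) :
  measurable_fun [set: n.-tuple mR] (affine_tuple a b).
Proof.
apply/measurable_fun_tnthP => i.
rewrite (_ : _ \o _ = fun t : n.-tuple mR => (a * tnth t i + b i)%R : mR); last first.
  by apply/funext => t; rewrite /= tnth_mktuple.
apply: measurable_funD => //; apply: measurable_funM => //.
exact: measurable_tnth.
Qed.

Lemma affine_tcons n a (b : 'I_n.+1 -> R) z :
  affine_tuple a b (tcons z) =
  tcons (affine_tuple a (fun i => b (lift ord0 i)) z.1, a * z.2 + b ord0).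
Proof.
apply: eq_from_tnth => i; rewrite tnth_mktuple.
case: (unliftP ord0 i) => [j ->|->].
  by rewrite !tnthS /= tnth_mktuple.
by rewrite !tnth0.
Qed.

(** Fubini in the added coordinate and induction on n. Translations (a = 1) lead to integration by
    parts, dilations (b = 0) to the volume of balls up to a constant. *)
Lemma lebesgue_tuple_affine n (a : R) (b : 'I_n -> R) A : 0 < a ->
  measurable A ->
  (lebesgue_tuple R n (affine_tuple a b @^-1` A) =
   (a ^- n)%:E * lebesgue_tuple R n A)%E.
Proof.
move=> a0; elim: n b A => [|n IH] b A mA.
  rewrite expr0 invr1 mul1e /=; congr (\d_ _ _)%E.
  by apply/seteqP; split => t /=; rewrite (tuple0 (affine_tuple a b t)) (tuple0 t).
have mC : measurable (@tcons R n @^-1` A).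
  by rewrite -[X in measurable X]setTI; exact: measurable_tcons.
have an0 : 0 <= a ^- n by rewrite invr_ge0 exprn_ge0// ltW.
rewrite /= /pushforward /product_measure1.
transitivity (\int[lebesgue_tuple R n]_x ((a^-1)%:E *
    (mu \o xsection (@tcons R n @^-1` A)) (affine_tuple a (fun i => b (lift ord0 i)) x)))%E.
  apply: eq_integral => x _ /=.
  rewrite -(@lebesgue_measure_affine _ (b ord0))//; last exact: measurable_xsection.
  congr (mu _); apply/seteqP; split => y; rewrite /xsection/= !inE/= affine_tcons//.
have mx : measurable_fun [set: n.-tuple mR] (mu \o xsection (@tcons R n @^-1` A)).
  exact: measurable_fun_xsection.
have ma := measurable_affine_tuple a (fun i => b (lift ord0 i)).
rewrite ge0_integralZl//; last 2 first.
- exact: (measurableT_comp mx ma).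
- by rewrite lee_fin invr_ge0 ltW.
have /= := @ge0_integral_pushforward _ _ _ _ _ _ ma (lebesgue_tuple R n) setT _
  measurableT mx (fun _ _ => measure_ge0 _ _).
rewrite preimage_setT => <-.
rewrite (eq_measure_integral (mscale (NngNum an0) (lebesgue_tuple R n))); last first.
  by move=> B mB _; rewrite /= /mscale/= /pushforward; exact: IH.
rewrite ge0_integral_mscale//=.
by rewrite muleA -EFinM exprS invfM.
Qed.

Definition cube n (c : R) : set (n.-tuple mR) :=
  [set t | forall i, `|tnth t i| <= c].

Lemma measurable_cube n c : measurable (@cube n c).
Proof.
have -> : @cube n c = \bigcap_(i in [set: 'I_n]) (tnth (T:=mR) ^~ i @^-1` `[- c, c]).
  apply/seteqP; split => t /=.
    by move=> ct i _ /=; rewrite in_itv/= -ler_norml.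
  by move=> ct i; rewrite ler_norml; have := ct i Logic.I; rewrite /= in_itv.
apply: fin_bigcap_measurable; first by apply: (@finite_finset 'I_n).
move=> i _; rewrite -[X in measurable X]setTI.
by apply: measurable_tnth => //.
Qed.

Lemma lebesgue_tuple_cube n (c : R) : 0 <= c ->
  lebesgue_tuple R n (@cube n c) = ((2 * c) ^+ n)%:E.
Proof.
move=> c0; elim: n => [|n IH].
  rewrite /= diracE expr0 mem_set//; by case.
rewrite /= /pushforward.
have -> : @tcons R n @^-1` @cube n.+1 c = @cube n c `*` `[- c, c]%classic.
  apply/seteqP; split => -[x y] /=.
    move=> H; split.
      by move=> i; have := H (lift ord0 i); rewrite tnthS.
    by have := H ord0; rewrite tnth0 in_itv/= ler_norml.
  move=> [H1 H2] i; case: (unliftP ord0 i) => [j ->|->].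
    by rewrite tnthS.
  by rewrite tnth0; rewrite in_itv/= -ler_norml in H2.
rewrite product_measure1E//; last exact: measurable_cube.
have E := @lebesgue_measure_itv R `[- c, c].
rewrite [X in (X * _)%E]IH [X in (_ * X)%E]E/= lte_fin.
case: ifPn => h; last first.
  have -> : c = 0 by apply/eqP; rewrite eq_le c0 andbT; lra.
  by rewrite mulr0 exprS mul0r mule0.
by rewrite !EFinN -!EFinD -EFinM exprSr opprK (_ : c + c = 2 * c)//; ring.
Qed.

End lebesgue_affine.

Section euclidean.
Context {R : realType} {n : nat}.
Local Notation mR := (measurableTypeR R).
Implicit Types x v : 'rV[R]_n.

(** Radial functions are written through |x|^2, a polynomial, since |x| is not smooth at the
    pole. *)
Definition sqnorm x : R := dot x x.

Lemma smoothn_sum (I : Type) (r : seq I) (f : I -> 'rV[R]_n -> R) :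
  (forall i, smoothn (f i)) -> smoothn (fun x => \sum_(i <- r) f i x).
Proof.
move=> sf; elim: r => [|i r IH].
  by under eq_fun do rewrite big_nil; exact: smoothn_cst.
by under eq_fun do rewrite big_cons; exact: smoothnD.
Qed.

Lemma smoothn_sqnorm : smoothn sqnorm.
Proof. by apply: smoothn_sum => i; apply: smoothnM; exact: smoothn_coord. Qed.

Lemma sqnorm_ge0 x : 0 <= sqnorm x.
Proof. by rewrite /sqnorm /dot sumr_ge0// => i _; rewrite -expr2 sqr_ge0. Qed.

Lemma enorm_ge0 x : 0 <= enorm x. Proof. exact: sqrtr_ge0. Qed.

Lemma sqr_enorm x : enorm x ^+ 2 = sqnorm x.
Proof. by rewrite sqr_sqrtr// sqnorm_ge0. Qed.

Lemma sqnorm_eq0 x : (sqnorm x == 0) = (x == 0).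
Proof.
apply/idP/eqP => [|->]; last first.
  by rewrite /sqnorm /dot big1// => i _; rewrite mxE mul0r.
rewrite /sqnorm /dot psumr_eq0; last by move=> i _; rewrite -expr2 sqr_ge0.
move=> /allP H; apply/rowP => i; rewrite mxE.
have := H i; rewrite mem_index_enum => /(_ isT)/=.
by rewrite mulf_eq0 orbb => /eqP.
Qed.

Lemma enorm_eq0 x : (enorm x == 0) = (x == 0).
Proof. by rewrite -sqnorm_eq0 -sqr_enorm sqrf_eq0. Qed.

Lemma enorm_gt0 x : (0 < enorm x) = (x != 0).
Proof. by rewrite lt_def enorm_ge0 andbT enorm_eq0. Qed.

Lemma enormZ (a : R) x : 0 <= a -> enorm (a *: x) = a * enorm x.
Proof.
move=> a0; rewrite /enorm /dot.
under eq_bigr do rewrite !mxE mulrACA.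
by rewrite -mulr_sumr -expr2 sqrtrM ?sqr_ge0// sqrtr_sqr ger0_norm.
Qed.

Lemma coord_le_enorm x i : `|x 0 i| <= enorm x.
Proof.
rewrite -sqrtr_sqr; apply: ler_wsqrtr; rewrite /dot (bigD1 i)//= -expr2 lerDl.
by rewrite sumr_ge0// => j _; rewrite -expr2 sqr_ge0.
Qed.

Lemma sqnorm_le_cube x c : (forall i, `|x 0 i| <= c) -> sqnorm x <= n%:R * c ^+ 2.
Proof.
move=> H; rewrite /sqnorm /dot (le_trans (ler_sum _ (G := fun=> c ^+ 2) _))//.
  move=> i _; rewrite -expr2 -real_normK ?num_real//.
  by rewrite lerXn2r// ?nnegrE// (le_trans _ (H i)).
by rewrite sumr_const card_ord mulr_natl.
Qed.

Lemma measurable_sqnorm : measurable_fun [set: 'rV[R]_n] (sqnorm : _ -> mR).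
Proof. exact: smoothn_measurable smoothn_sqnorm. Qed.

Lemma measurable_enorm : measurable_fun [set: 'rV[R]_n] (@enorm R n : _ -> mR).
Proof.
apply: (@measurableT_comp _ _ _ _ _ _ (@Num.sqrt R : mR -> mR)).
  by apply: continuous_measurable_fun; exact: sqrt_continuous.
exact: measurable_sqnorm.
Qed.

Definition rcube (c : R) : set 'rV[R]_n := [set x | forall i, `|x 0 i| <= c].

Lemma rv_of_tuple_cube c : @rv_of_tuple R n @^-1` rcube c = @cube R n c.
Proof.
by apply/seteqP; split => t /= H i; have := H i; rewrite /= mxE.
Qed.

Lemma rcube_bigcap c :
  rcube c = \bigcap_(i in [set: 'I_n]) (fun x => x 0 i : mR) @^-1` `[- c, c].
Proof.
apply/seteqP; split => t /=.
  by move=> ct i _ /=; rewrite in_itv/= -ler_norml.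
by move=> ct i; rewrite ler_norml; have := ct i Logic.I; rewrite /= in_itv.
Qed.

Lemma measurable_rcube c : measurable (rcube c).
Proof.
rewrite rcube_bigcap.
apply: fin_bigcap_measurable; first by apply: (@finite_finset 'I_n).
move=> i _; rewrite -[X in measurable X]setTI.
exact: measurable_coord.
Qed.

Lemma rcube_compact c : compact (rcube c).
Proof.
apply: bounded_closed_compact.
  exists `|c|; split; first exact: num_real.
  move=> M cM x xc /=; have -> : `|x| = mx_norm x by [].
  rewrite mx_normrE; apply/bigmax_leP; split.
    by rewrite (le_trans _ (ltW cM)).
  move=> [i j] _ /=; rewrite ord1 (le_trans (xc j))//.
  by rewrite (le_trans (ler_norm _))// ltW.
have -> : rcube c = \bigcap_(i in [set: 'I_n]) (fun x : 'rV[R]_n => x 0 i) @^-1` `[- c, c].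
  exact: rcube_bigcap.
apply: closed_bigI => i _; apply: closed_comp; last exact: interval_closed.
by move=> x _; exact: coord_continuous.
Qed.

Lemma smoothn_test_function (phi : 'rV[R]_n -> R) (M : R) : smoothn phi ->
  (forall x, M < sqnorm x -> phi x = 0) -> test_function phi.
Proof.
move=> sphi supp; split; first by move=> k; exact: smoothn_Ck.
apply: (@subclosed_compact _ _ (rcube (Num.sqrt M))).
- exact: closed_closure.
- exact: rcube_compact.
have cl : closed (rcube (Num.sqrt M)).
  by apply: compact_closed; [exact: norm_hausdorff|exact: rcube_compact].
rewrite [X in _ `<=` X](proj1 (closure_id _) cl).
apply: closureS => x /= phix i.
have : sqnorm x <= M by rewrite leNgt; apply/negP => /supp/eqP; apply/negP.
by move=> h; rewrite (le_trans (coord_le_enorm _ _))// ler_wsqrtr.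
Qed.

Lemma partial_supp (phi : 'rV[R]_n -> R) (M : R) i :
  (forall x, M < sqnorm x -> phi x = 0) -> forall x, M < sqnorm x -> partial i phi x = 0.
Proof.
move=> supp x Mx; rewrite /partial (@near_eq_derive _ _ _ _ (cst 0)).
  exact: derive_cst.
have : open [set y : 'rV[R]_n | M < sqnorm y].
  apply: (@open_comp _ _ sqnorm [set t | M < t]); last exact: open_gt.
  by move=> y _; exact: (smoothn_continuous smoothn_sqnorm).
move=> /(_ x Mx); apply: filterS => y; exact: supp.
Qed.

End euclidean.

Section lebesgue_rv.
Context (R : realType) (n : nat).
Local Notation mR := (measurableTypeR R).
Local Notation dx := (@lebesgue_rv R n).
Implicit Types x v : 'rV[R]_n.

Lemma measurable_rvP d (T : measurableType d) (f : T -> 'rV[R]_n) :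
  (forall i, measurable_fun [set: T] (fun t => f t 0 i : mR)) ->
  measurable_fun [set: T] f.
Proof.
move=> mf.
apply: (@measurability _ _ _ _ _ _ (\big[setU/set0]_(i < n)
  preimage_set_system [set: 'rV[R]_n] (fun x : 'rV[R]_n => x 0 i : mR) measurable)) => //.
move=> _ [A + <-]; apply: (big_ind (fun B : set (set 'rV[R]_n) => B A -> measurable ([set: T] `&` f @^-1` A))) => //.
- by move=> B C hB hC [/hB|/hC].
- move=> i _ [B mB <-]; have := mf i measurableT _ mB.
  by rewrite !setTI.
Qed.

Lemma measurable_rv_affine (a : R) (b : 'rV[R]_n) :
  measurable_fun [set: 'rV[R]_n] (fun x => a *: x + b).
Proof.
apply: measurable_rvP => i.
rewrite (_ : (fun _ => _) = fun x : 'rV[R]_n => a * x 0 i + b 0 i : mR).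
  apply: measurable_funD => //; apply: measurable_funM => //.
  exact: measurable_coord.
by apply/funext => x; rewrite !mxE.
Qed.

Lemma lebesgue_rv_affine (a : R) (b : 'rV[R]_n) A : 0 < a -> measurable A ->
  (dx ((fun x => a *: x + b)%R @^-1` A) = (a ^- n)%:E * dx A)%E.
Proof.
move=> a0 mA; rewrite /= /pushforward.
rewrite -(@lebesgue_tuple_affine _ _ _ (fun i => b 0 i))//; last first.
  by rewrite -[X in measurable X]setTI; exact: measurable_rv_of_tuple.
congr (lebesgue_tuple _ _ _).
have E t : @rv_of_tuple R n (affine_tuple a (fun i => b 0 i) t) = a *: rv_of_tuple t + b.
  by apply/rowP => i; rewrite !mxE tnth_mktuple.
by apply/seteqP; split => t; rewrite /= E.
Qed.

Lemma lebesgue_rv_cube (c : R) : 0 <= c -> dx (rcube c) = ((2 * c) ^+ n)%:E.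
Proof. by move=> c0; rewrite /= /pushforward rv_of_tuple_cube lebesgue_tuple_cube. Qed.

Definition eball (r : R) : set 'rV[R]_n := [set x | enorm x <= r].

Lemma measurable_eball r : measurable (eball r).
Proof.
have -> : eball r = @enorm R n @^-1` `]-oo, r].
  by apply/seteqP; split => x; rewrite /= in_itv.
by rewrite -[X in measurable X]setTI; exact: measurable_enorm.
Qed.

Lemma eball_sub_cube r : eball r `<=` rcube r.
Proof. by move=> x xr i; exact: le_trans (coord_le_enorm x i) xr. Qed.

Lemma eball_fin r : (dx (eball r) < +oo)%E.
Proof.
have [r0|r0] := leP 0 r.
  apply: (@le_lt_trans _ _ (dx (rcube r))).
    by apply: le_measure; rewrite ?inE; [exact: measurable_eball|exact: measurable_rcube|exact: eball_sub_cube].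
  by rewrite lebesgue_rv_cube// ltry.
rewrite (_ : eball r = set0) ?measure0//; apply/seteqP; split => // x /=.
by rewrite /eball/= leNgt (lt_le_trans r0 (enorm_ge0 _)).
Qed.

Lemma eball_scale a r : 0 < a -> (dx (eball (a * r)) = (a ^+ n)%:E * dx (eball r))%E.
Proof.
move=> a0; have an0 : a ^+ n != 0 by rewrite expf_neq0// gt_eqF.
have <- : (fun x => a^-1 *: x + 0)%R @^-1` eball r = eball (a * r).
  have e x : enorm (a^-1 *: x + 0) = enorm x / a.
    by rewrite addr0 enormZ ?invr_ge0 ?ltW// mulrC.
  by apply/seteqP; split => x; rewrite /eball /mkset /preimage/= e ler_pdivrMr// [r * a]mulrC.
rewrite lebesgue_rv_affine ?invr_gt0//; last exact: measurable_eball.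
by rewrite exprVn invrK.
Qed.

Let V1 : R := fine (dx (eball 1)).

Let V1_fin : dx (eball 1) = V1%:E.
Proof. by rewrite fineK// ge0_fin_numE// eball_fin. Qed.

(** V, the volume of the unit ball, is kept abstract; the power r^n comes from dilations. *)
Lemma eball_volume : exists2 V : R, 0 < V &
  forall r, 0 < r -> dx (eball r) = (V * r ^+ n)%:E.
Proof.
exists V1; last first.
  by move=> r r0; rewrite -[X in eball X]mulr1 eball_scale// V1_fin mulrC.
(* The cube of half-side 1/(n+1) lies in the unit ball, because n/(n+1)^2 <= 1, and bounds its
   volume from below. *)
pose c : R := (n.+1%:R)^-1.
have c0 : 0 < c by rewrite invr_gt0.
suff : (0 < dx (eball 1))%E by rewrite V1_fin lte_fin.
apply: (@lt_le_trans _ _ (dx (rcube c))).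
  by rewrite lebesgue_rv_cube ?ltW// lte_fin exprn_gt0// mulr_gt0.
apply: le_measure; rewrite ?inE; [exact: measurable_rcube|exact: measurable_eball|].
move=> x xc; rewrite /eball/= -sqrtr1; apply: ler_wsqrtr.
apply: le_trans (sqnorm_le_cube xc) _.
rewrite /c exprVn ler_pdivrMr ?exprn_gt0// mul1r expr2.
by rewrite -natrM ler_nat mulnS (leq_trans (leqnSn n))// leq_addr.
Qed.

(** {0} is the ball of radius 0, which dilation by 2 preserves, so its finite measure m satisfies m
    = 2^n m. *)
Lemma lebesgue_rv_set1 : (0 < n)%N -> dx [set 0] = 0%E.
Proof.
move=> n0; have [V V0 VE] := eball_volume.
have E : [set (0 : 'rV[R]_n)] = eball 0.
  apply/seteqP; split => x; rewrite /eball/=.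
    by move=> ->; rewrite (eqP (_ : enorm 0 == 0)) ?enorm_eq0.
  by move=> h; apply/eqP; rewrite -enorm_eq0 eq_le h enorm_ge0.
have f : dx [set 0] \is a fin_num.
  by rewrite ge0_fin_numE// E eball_fin.
have := eball_scale 0 (ltr0n R 2); rewrite mulr0 -E -(fineK f) -EFinM => -[] /eqP.
rewrite -subr_eq0 -[X in X - _]mul1r -mulrBl mulf_eq0 => /orP[|/eqP -> //].
rewrite subr_eq0 eq_sym -natrX pnatr_eq1 => /eqP h.
by move: n0; rewrite -[n]/(n) ; case: (n) h => // k; rewrite expnS => /eqP; rewrite muln_eq1.
Qed.

End lebesgue_rv.

Lemma integrable_bounded_support d (T : measurableType d) (R : realType)
    (mu : {measure set T -> \bar R}) (f : T -> R) (B : set T) (C : R) :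
  measurable_fun [set: T] f -> measurable B -> (mu B < +oo)%E ->
  (forall x, `|f x| <= C * \1_B x) -> mu.-integrable [set: T] (EFin \o f).
Proof.
move=> mf mB B0 fC.
apply: (@le_integrable _ _ _ _ _ _ _ (EFin \o (fun x => C * \1_B x))) => //.
- exact/measurable_EFinP.
- move=> x _ /=; rewrite lee_fin (le_trans (fC x))// ler_norm//.
- have -> : EFin \o (fun x => C * \1_B x) = (fun x => C%:E * (EFin \o \1_B) x)%E by [].
  apply: integrableZl => //; apply/integrableP; split.
    by apply/measurable_EFinP; exact: measurable_indic.
  under eq_integral do rewrite /= ger0_norm//.
  by rewrite integral_indic// setIT.
Qed.

Lemma integral_invariant d (T : measurableType d) (R : realType)
    (mu : {measure set T -> \bar R}) (f : T -> T) (phi : T -> \bar R) :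
  measurable_fun [set: T] f ->
  (forall A, measurable A -> mu (f @^-1` A) = mu A) ->
  measurable_fun [set: T] phi -> mu.-integrable [set: T] phi ->
  mu.-integrable [set: T] (phi \o f) /\
  (\int[mu]_x (phi \o f) x = \int[mu]_x phi x)%E.
Proof.
move=> mf inv mphi iphi.
have iE : mu.-integrable [set: T] (phi \o f).
  apply/integrableP; split; first exact: measurableT_comp.
  have /integrableP[_] := iphi; apply: le_lt_trans.
  have mab : measurable_fun [set: T] (fun x => `|phi x|)%E by exact: measurableT_comp.
  have /= := @ge0_integral_pushforward _ _ _ _ _ _ mf mu setT _
     measurableT mab (fun _ _ => abse_ge0 _).
  rewrite preimage_setT => <-.
  have -> : (\int[pushforward mu f]_y `|phi y| = \int[mu]_y `|phi y|)%E.
    by apply: eq_measure_integral => A mA _; exact: inv.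
  exact: lexx.
split => //.
have := @integral_pushforward _ _ _ _ _ _ mf mu setT _ mphi.
rewrite preimage_setT => /(_ iE measurableT) <-.
by apply: eq_measure_integral => A mA _; exact: inv.
Qed.

Section mean_value_line.
Context {R : realType} {n : nat}.

Lemma mean_value_line (f df : 'rV[R]_n -> R) (x v : 'rV[R]_n) (t : R) : 0 < t ->
  (forall y, is_derive y v f (df y)) ->
  exists2 c, 0 < c < t & f (t *: v + x) - f x = df (c *: v + x) * t.
Proof.
move=> t0 dF.
pose g s := f (s *: v + x).
have dg (s : R) : is_derive s (1:R) g (df (s *: v + x)).
  have [H1 H2] := dF (s *: v + x).
  have E : (fun h : R => h^-1 *: (g (h *: 1 + s) - g s)) =
     (fun h : R => h^-1 *: (f (h *: v + (s *: v + x)) - f (s *: v + x))).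
    by apply/funext => h; rewrite /g scaler1 scalerDl addrA.
  by split; [rewrite /derivable E|rewrite /derive E].
have cg : {within `[0, t], continuous g}.
  by apply: derivable_within_continuous => s _; case: (dg s).
have [c] := MVT t0 (fun s _ => dg s) cg.
rewrite in_itv/= => c0t; rewrite /g scale0r add0r subr0 => E.
by exists c.
Qed.

End mean_value_line.

Lemma cvg_comp_dnbhs (R : realType) (h : nat -> R) (f : R -> R) (l : R) :
  (forall k, h k != 0) -> h k @[k --> \oo] --> (0:R) ->
  f t @[t --> (0:R)^'] --> l -> f (h k) @[k --> \oo] --> l.
Proof.
move=> h0 hc fl; exact: (cvgr_dnbhsP f 0 l).1 fl h (conj h0 hc).
Qed.

Section integral_partial.
Context (R : realType) (n : nat).
Local Notation mR := (measurableTypeR R).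
Local Notation dx := (@lebesgue_rv R n).
Implicit Types (x v : 'rV[R]_n) (phi : 'rV[R]_n -> R).

Lemma smoothn_bounded phi c : smoothn phi ->
  exists2 C, 0 <= C & forall x, rcube c x -> `|phi x| <= C.
Proof.
move=> /smoothn_continuous cphi.
have : compact (phi @` rcube c).
  apply: continuous_compact; last exact: rcube_compact.
  exact: continuous_subspaceT.
move=> /compact_bounded[M [_ HM]].
exists (`|M| + 1); first by rewrite addr_ge0.
move=> x xc; apply: (HM (`|M| + 1)).
  by rewrite (le_lt_trans (ler_norm _))// ltrDl.
by exists x.
Qed.

Lemma supp_cube phi (M : R) x : (forall x, M < sqnorm x -> phi x = 0) ->
  phi x != 0 -> rcube (Num.sqrt M) x.
Proof.
move=> supp phix i; have : sqnorm x <= M by rewrite leNgt; apply/negP => /supp/eqP; apply/negP.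
by move=> h; rewrite (le_trans (coord_le_enorm _ _))// ler_wsqrtr.
Qed.

Lemma smoothn_supp_bound phi (M : R) : smoothn phi ->
  (forall x, M < sqnorm x -> phi x = 0) ->
  exists2 C, 0 <= C & forall x, `|phi x| <= C * \1_(rcube (Num.sqrt M)) x.
Proof.
move=> sphi supp; have [C C0 HC] := smoothn_bounded (Num.sqrt M) sphi.
exists C => // x; rewrite indicE; case: (boolP (x \in _)) => h.
  by rewrite mulr1 HC// -inE.
rewrite mulr0 normr_le0; apply/negPn/negP => /(supp_cube supp).
by move/mem_set; rewrite (negbTE h).
Qed.

Lemma cube_fin c : (dx (rcube c) < +oo)%E.
Proof.
apply: (@le_lt_trans _ _ (dx (rcube `|c|))); last by rewrite lebesgue_rv_cube// ltry.
apply: le_measure; rewrite ?inE; try exact: measurable_rcube.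
by move=> x xc i; rewrite (le_trans (xc i))// ler_norm.
Qed.

Lemma smoothn_supp_integrable phi (M : R) : smoothn phi ->
  (forall x, M < sqnorm x -> phi x = 0) -> dx.-integrable [set: 'rV[R]_n] (EFin \o phi).
Proof.
move=> sphi supp; have [C C0 HC] := smoothn_supp_bound sphi supp.
apply: (integrable_bounded_support (smoothn_measurable sphi)
  (measurable_rcube _) (cube_fin _) HC).
Qed.

Lemma integral_translate phi v : measurable_fun [set: 'rV[R]_n] phi ->
  dx.-integrable [set: 'rV[R]_n] (EFin \o phi) ->
  dx.-integrable [set: 'rV[R]_n] (fun x => (phi (x + v))%:E) /\
  (\int[dx]_x (phi (x + v))%:E = \int[dx]_x (phi x)%:E)%E.
Proof.
move=> mphi iphi.
have -> : (fun x : 'rV[R]_n => (phi (x + v))%:E) = (EFin \o phi) \o (fun x => 1 *: x + v).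
  by apply/funext => x /=; rewrite scale1r.
apply: integral_invariant => //; first exact: measurable_rv_affine.
- by move=> A mA; rewrite lebesgue_rv_affine// expr1n invr1 mul1e.
- exact/measurable_EFinP.
Qed.

(** Difference quotients have integral 0 by translation invariance, and they converge to the partial
    derivative under a common majorant. *)
Lemma integral_partial phi (M : R) i : smoothn phi ->
  (forall x, M < sqnorm x -> phi x = 0) -> (\int[dx]_x (partial i phi x)%:E = 0)%E.
Proof.
move=> sphi supp.
have [psi spsi dphi] := smoothn_derive i sphi.
have -> : partial i phi = psi by apply/funext => x; case: (dphi x).
pose e := basis R i : 'rV[R]_n.
(* The supports of phi and of its translates by h k <= 1 lie in the cube of half-side c; the mean
   value points need one more unit, hence the bound on the cube of half-side c + 1. *)
pose c := Num.sqrt M + 1.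
have [C C0 HC] := smoothn_bounded (c + 1) spsi.
pose h (k : nat) : R := k.+1%:R^-1.
have h0 k : 0 < h k by rewrite invr_gt0.
have h1 k : h k <= 1 by rewrite invf_le1// ler1n.
have ei j : `|e 0 j| <= 1.
  by rewrite /e /basis mxE eqxx/=; case: eqP => _ /=; rewrite ?normr1 ?normr0.
have eT t y j : (t *: e + y) 0 j = t * e 0 j + y 0 j by rewrite !mxE.
have ei' t j : 0 <= t -> t <= 1 -> `|t * e 0 j| <= 1.
  by move=> t0 t1; rewrite normrM mulr_ile1// ger0_norm.
pose D k x := (h k)^-1 * (phi (x + h k *: e) - phi x).
have mphi := smoothn_measurable sphi.
have iphi := smoothn_supp_integrable sphi supp.
have iD k : (\int[dx]_x (D k x)%:E = 0)%E.
  have [i1 i2] := integral_translate (h k *: e) mphi iphi.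
  rewrite /D; under eq_integral do rewrite EFinM.
  rewrite integralZl//; last first.
    by under eq_fun do rewrite EFinB; exact: integrableB.
  under eq_integral do rewrite EFinB.
  rewrite integralB//= i2 subee ?mule0//.
  exact: (integrable_fin_num measurableT iphi).
have mD k : measurable_fun [set: 'rV[R]_n] (EFin \o D k).
  apply/measurable_EFinP; apply: measurable_funM => //.
  apply: measurable_funB => //.
  have -> : (fun x => phi (x + h k *: e)) = phi \o (fun x => 1 *: x + h k *: e).
    by apply/funext => x /=; rewrite scale1r.
  exact: (measurableT_comp mphi (@measurable_rv_affine R n 1 _)).
have bD k x : `|D k x| <= C * \1_(rcube c) x.
  have [c1 /andP[c10 c1h] E] := mean_value_line x (h0 k) dphi.
  rewrite indicE; case: (boolP (x \in _)) => xc.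
    rewrite /D [x + _]addrC E mulrCA mulVf ?gt_eqF// !mulr1; apply: HC => j.
    rewrite eT (le_trans (ler_normD _ _))// addrC lerD//.
      by move: xc; rewrite inE.
    by apply: ei'; [exact: ltW|rewrite (le_trans (ltW c1h))].
  have sq : 0 <= Num.sqrt M by exact: sqrtr_ge0.
  have z1 : phi x = 0.
    apply/eqP/negPn/negP => /(supp_cube supp) H; move/negP: xc; apply.
    by rewrite inE => j; rewrite (le_trans (H j))// lerDl.
  have z2 : phi (x + h k *: e) = 0.
    apply/eqP/negPn/negP => /(supp_cube supp) H; move/negP: xc; apply.
    rewrite inE => j; have := H j; rewrite addrC eT addrC => Hj.
    rewrite -[x 0 j](addrK (h k * e 0 j)) (le_trans (ler_normB _ _))// lerD//.
    by apply: ei' => //; exact: ltW.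
  by rewrite /D z1 z2 subr0 !mulr0 normr0.
have cD x : D k x @[k --> \oo] --> psi x.
  have [d1 d2] := dphi x.
  have lx : t^-1 *: (phi (t *: e + x) - phi x) @[t --> (0:R)^'] --> psi x.
    by rewrite -d2; exact: d1.
  have hn0 k : h k != 0 by rewrite gt_eqF.
  have := cvg_comp_dnbhs hn0 (@cvg_harmonic R) lx.
  have <- : (fun k => D k x) = (fun k => (h k)^-1 *: (phi (h k *: e + x) - phi x)).
    by apply/funext => k; rewrite /D [x + _]addrC.
  exact.
have mpsi : measurable_fun [set: 'rV[R]_n] (EFin \o psi).
  by apply/measurable_EFinP; exact: smoothn_measurable.
have H1 : {ae dx, forall x, [set: 'rV[R]_n] x -> (EFin \o D k) x @[k --> \oo] --> (EFin \o psi) x}.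
  by apply: aeW => x _; apply: cvg_EFin; [exact: nearW|exact: cD].
have H2 : dx.-integrable [set: 'rV[R]_n] (EFin \o (fun x => C * \1_(rcube c) x)).
  apply: (@integrable_bounded_support _ _ _ _ _ (rcube c) C) => //.
  + apply: measurable_funM => //; apply: measurable_indic; exact: measurable_rcube.
  + exact: measurable_rcube.
  + exact: cube_fin.
  + by move=> x; rewrite ger0_norm// mulr_ge0// indicE.
have H3 : {ae dx, forall x k, [set: 'rV[R]_n] x -> (`|(EFin \o D k) x| <= (EFin \o (fun x => C * \1_(rcube c) x)%R) x)%E}.
  by apply: aeW => x k _; rewrite /= lee_fin.
have [_ _] := dominated_convergence measurableT mD mpsi H1 H2 H3.
under eq_fun do rewrite iD.
by move=> H; apply: (cvg_unique _ H) => //; exact: cvg_cst.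
Qed.

End integral_partial.

(** * Functions that vanish almost everywhere, and the fundamental lemma of the calculus of
    variations *)

Section almost_everywhere.
Context d (T : measurableType d) (R : realType) (mu : {measure set T -> \bar R}).

Lemma ae_mono (P Q : T -> Prop) : (forall x, P x -> Q x) ->
  {ae mu, forall x, P x} -> {ae mu, forall x, Q x}.
Proof. by move=> PQ; apply: filterS. Qed.

Lemma ae_mono2 (P Q S : T -> Prop) : (forall x, P x -> Q x -> S x) ->
  {ae mu, forall x, P x} -> {ae mu, forall x, Q x} -> {ae mu, forall x, S x}.
Proof. by move=> PQS; apply: filterS2. Qed.

End almost_everywhere.

Section density_measure.
Local Open Scope ereal_scope.
Context d (T : measurableType d) (R : realType) (mu : {measure set T -> \bar R}).
Variable f : T -> \bar R.
Hypotheses (mf : measurable_fun [set: T] f) (f0 : forall x, 0 <= f x).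

(** The two proofs are arguments of the definition so that the measure structure attached to it can
    depend on them. *)
Definition density_measure of measurable_fun [set: T] f & (forall x, 0 <= f x) :=
  fun A => \int[mu]_(x in A) f x.

Local Notation nu := (density_measure mf f0).

Let nu0 : nu set0 = 0. Proof. exact: integral_set0. Qed.

Let nu_ge0 A : 0 <= nu A. Proof. exact: integral_ge0. Qed.

Let nu_sigma_additive : semi_sigma_additive nu.
Proof. exact: semi_sigma_additive_nng_induced. Qed.

HB.instance Definition _ := isMeasure.Build _ _ _ nu nu0 nu_ge0 nu_sigma_additive.

End density_measure.

Section vanishing.
Context d (T : measurableType d) (R : realType) (mu : {measure set T -> \bar R}).

(** The measures with densities f^+ and f^- agree on a generating pi-system, hence on all measurable
    sets, so f has integral 0 over each of them. *)
Lemma ae_eq0_pisystem (G : set (set T)) (g : (set T)^nat) (f : T -> R) :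
  measurable = <<s G >> -> setI_closed G ->
  (forall k, G (g k)) -> \bigcup_k g k = setT ->
  mu.-integrable [set: T] (EFin \o f) ->
  (forall A, G A -> \int[mu]_(x in A) (f x)%:E = 0)%E ->
  {ae mu, forall x, f x = 0}.
Proof.
move=> mG GI Gg gT fint fG.
have mf : measurable_fun [set: T] (EFin \o f) := measurable_int _ fint.
have mp := measurable_funepos mf; have mn := measurable_funeneg mf.
have sG A : G A -> measurable A by rewrite mG; exact: sub_sigma_algebra.
have eqm A : measurable A ->
    density_measure mu mp (@funepos_ge0 _ _ _) A =
    density_measure mu mn (@funeneg_ge0 _ _ _) A.
  apply: (@measure_unique _ _ _ G g) => //.
  - move=> B GB; have mB := sG _ GB.
    have := fG _ GB; rewrite integralE.
    have fp : (\int[mu]_(x in B) (EFin \o f)^\+ x)%E \is a fin_num.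
      apply: integrable_fin_num => //; apply: integrable_funepos => //.
      exact: integrableS fint.
    have fn : (\int[mu]_(x in B) (EFin \o f)^\- x)%E \is a fin_num.
      apply: integrable_fin_num => //; apply: integrable_funeneg => //.
      exact: integrableS fint.
    move=> E; have {E} : (\int[mu]_(x in B) (EFin \o f)^\+ x -
        \int[mu]_(x in B) (EFin \o f)^\- x = 0)%E by [].
    rewrite /= /density_measure -(fineK fp) -(fineK fn) -EFinB => -[] /eqP.
    by rewrite subr_eq0 => /eqP ->.
  - move=> k; rewrite /= /density_measure; have mgk := sG _ (Gg k).
    apply: integrable_lty => //; apply: integrable_funepos => //.
    exact: integrableS fint.
have : ae_eq mu setT (EFin \o f) (cst 0%E).
  apply: integral_ae_eq => //.
  move=> E _ mE; rewrite integral0 integralE.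
  have := eqm E mE; rewrite /density_measure => ->.
  rewrite subee//; apply: integrable_fin_num => //; apply: integrable_funeneg => //.
  exact: integrableS fint.
by apply: filterS => x /(_ Logic.I)/= [].
Qed.

(** [flat_exp0_cvg] under dominated convergence, with majorant |f|. *)
Lemma integral_pos_set (f w : T -> R) : mu.-integrable [set: T] (EFin \o f) ->
  measurable_fun [set: T] w ->
  (forall k, \int[mu]_x (f x * flat_exp 0 (k.+1%:R * w x))%:E = 0)%E ->
  (\int[mu]_(x in [set x | (0 < w x)%R]) (f x)%:E = 0)%E.
Proof.
move=> fint mw H.
have mf : measurable_fun [set: T] f.
  by apply/measurable_EFinP; exact: measurable_int fint.
have mfe : measurable_fun [set: R] (@flat_exp R 0).
  apply: (@smooth1_measurable _ (fun t => flat_exp 0 t)).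
  by apply: smooth1_flat; exact: smooth1_id.
have mpos : measurable_fun [set: T] (fun x => (0 < w x)%R%:R : R).
  rewrite (_ : (fun _ => _) = fun x => if 0 < w x then 1 else 0); last first.
    by apply/funext => x; case: ifP.
  apply: measurable_fun_ifT => //; exact: measurable_fun_ltr.
rewrite integral_mkcond.
transitivity (\int[mu]_x (f x * (0 < w x)%R%:R)%:E)%E.
  apply: eq_integral => x _; rewrite patchE; case: ifPn => /=.
    by rewrite inE /= => ->; rewrite mulr1.
  by rewrite notin_setE/= => /negP/negbTE ->; rewrite mulr0.
have M1 k : measurable_fun [set: T] (fun x => (f x * flat_exp 0 (k.+1%:R * w x))%:E).
  apply/measurable_EFinP; apply: measurable_funM => //.
  apply: (@measurableT_comp _ _ _ _ _ _ (@flat_exp R 0)) => //.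
  exact: measurable_funM.
have M2 : measurable_fun [set: T] (fun x => (f x * (0 < w x)%R%:R)%:E).
  by apply/measurable_EFinP; exact: measurable_funM.
have H1 : {ae mu, forall x, [set: T] x ->
    (f x * flat_exp 0 (k.+1%:R * w x))%:E @[k --> \oo] --> (f x * (0 < w x)%R%:R)%:E}.
  apply: aeW => x _; apply: cvg_EFin; first exact: nearW.
  by apply: cvgMr; exact: flat_exp0_cvg.
have H2 : mu.-integrable [set: T] (fun x => `|(f x)%:E|%E).
  exact: integrable_abse fint.
have H3 : {ae mu, forall x k, [set: T] x ->
    (`|(f x * flat_exp 0 (k.+1%:R * w x))%:E| <= `|(f x)%:E|)%E}.
  apply: aeW => x k _; rewrite /= lee_fin normrM ler_piMr// ger0_norm ?flat_exp_ge0//.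
  exact: flat_exp0_le1.
have [_ _] := dominated_convergence measurableT M1 M2 H1 H2 H3.
under eq_fun do rewrite H.
by move=> C; apply/esym; apply: (cvg_unique _ _ C) => //; exact: cvg_cst.
Qed.

End vanishing.

Section fundamental_lemma.
Context (R : realType) (n : nat).
Local Notation mR := (measurableTypeR R).
Local Notation dx := (@lebesgue_rv R n).

(** The half-spaces x_i > a are of this form, so these sets generate the Borel sets, and smooth
    functions are enough to detect a null function. *)
Definition possets : set (set 'rV[R]_n) :=
  [set A | exists2 w, smoothn w & A = [set x | 0 < w x]].

Lemma possets_gen : @measurable _ 'rV[R]_n = <<s possets >>.
Proof.
apply/seteqP; split; last first.
  apply: smallest_sub; first exact: sigma_algebra_measurable.
  move=> _ [w sw ->].
  have := smoothn_measurable sw measurableT (measurable_itv `]0, +oo[).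
  rewrite setTI; congr (measurable _); apply/seteqP; split => x /=;
    by rewrite in_itv/= andbT.
apply: smallest_sub; first exact: smallest_sigma_algebra.
apply: (big_ind (fun B : set (set 'rV[R]_n) => B `<=` <<s possets >>)) => //.
  by move=> B C hB hC A [/hB|/hC].
move=> i _.
have mi : measurable_fun [set: g_sigma_algebraType possets]
    ((fun x : 'rV[R]_n => x 0 i) : g_sigma_algebraType possets -> mR).
  apply: (measurability _ (RGenOInfty.measurableE R)).
  move=> _ [_ [a ->] <-]; rewrite setTI; apply: sub_sigma_algebra.
  exists (fun x => x 0 i + (- a)).
    by apply: smoothnD; [exact: smoothn_coord|exact: smoothn_cst].
  by apply/seteqP; split => x /=; rewrite in_itv/= andbT subr_gt0.
by move=> _ [B mB <-]; exact: mi.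
Qed.

Lemma possetsI : setI_closed possets.
Proof.
move=> _ _ [w sw ->] [v sv ->].
(* The product w v would also be positive where both factors are negative; [flat_exp] removes the
   negative parts. *)
exists (fun x => flat_exp 0 (w x) * flat_exp 0 (v x)).
  by apply: smoothnM; (apply: (@smoothn_comp _ _ (fun t => flat_exp 0 t));
    [apply: smooth1_flat; exact: smooth1_id|]).
apply/seteqP; split => x /=.
  by move=> [wx vx]; rewrite mulr_gt0// flat_exp_gt0.
move=> H; split; rewrite -(flat_exp_gt0 0); rewrite lt_neqAle flat_exp_ge0 andbT;
  by apply/eqP => E; move: H; rewrite -E ?mul0r ?mulr0 ltxx.
Qed.

(** The tests w are merely bounded: localisation is contained in the integrable f, which
    [radial_gradient] has already multiplied by a cut-off. *)
Lemma fundamental_lemma (f : 'rV[R]_n -> R) :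
  dx.-integrable [set: 'rV[R]_n] (EFin \o f) ->
  (forall w, smoothn w -> (forall x, 0 <= w x <= 1) ->
     (\int[dx]_x (f x * w x)%:E = 0)%E) ->
  {ae dx, forall x, f x = 0}.
Proof.
move=> fint H; apply: (@ae_eq0_pisystem _ _ _ dx possets (fun=> setT)) => //.
- exact: possets_gen.
- exact: possetsI.
- move=> _; exists (fun=> 1); first exact: smoothn_cst.
  by apply/seteqP; split => x //= _; exact: ltr01.
- by rewrite bigcup_const//; exists 0%N.
- move=> _ [w sw ->]; apply: integral_pos_set => //; first exact: smoothn_measurable.
  move=> k; apply: (H (fun x => flat_exp 0 (k.+1%:R * w x))).
    apply: (@smoothn_comp _ _ (fun t => flat_exp 0 t) (fun x => k.+1%:R * w x)).
      by apply: smooth1_flat; exact: smooth1_id.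
    by apply: smoothnM => //; exact: smoothn_cst.
  by move=> x; rewrite flat_exp_ge0 flat_exp0_le1.
Qed.

End fundamental_lemma.

(** * Polar coordinates *)

Section polar.
Context (R : realType) (n : nat).
Local Notation mR := (measurableTypeR R).
Local Notation mu := (@lebesgue_measure R).
Local Notation dx := (@lebesgue_rv R n).
Hypothesis n0 : (0 < n)%N.

(** The constant c will be the area of the unit sphere. It is never evaluated and cancels from the
    profile equation. The value 0 for r <= 0 makes this a density on the whole line. *)
Definition radial_density (c r : R) : R := if 0 < r then c * r ^+ n.-1 else 0.

Lemma radial_density_ge0 c r : 0 <= c -> 0 <= radial_density c r.
Proof.
by move=> c0; rewrite /radial_density; case: ifPn => // r0; rewrite mulr_ge0// exprn_ge0// ltW.
Qed.

Lemma measurable_radial_density c : measurable_fun [set: mR] (radial_density c).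
Proof.
apply: measurable_fun_ifT => //; first exact: measurable_fun_ltr.
by apply: measurable_funM => //; apply: measurable_funX.
Qed.

Lemma integral_pow (V r : R) : 0 <= V -> 0 < r ->
  (\int[mu]_(s in `]-oo, r]) (radial_density (n%:R * V) s)%:E = (V * r ^+ n)%:E)%E.
Proof.
move=> V0 r0.
transitivity (\int[mu]_(s in `]0%R, r]) (n%:R * V * s ^+ n.-1)%:E)%E.
  rewrite integral_mkcond [RHS]integral_mkcond; apply: eq_integral => s _.
  rewrite !patchE; case: ifPn; rewrite ?inE ?notin_setE/= in_itv/= => sr.
    case: ifPn; rewrite ?inE ?notin_setE/= in_itv/= ?sr ?andbT => s0.
      by rewrite /radial_density s0.
    by rewrite /radial_density (negbTE (introN idP s0)).
  by rewrite ifF//; apply/negbTE; rewrite notin_setE/= in_itv/= => /andP[_].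
rewrite integral_itv_obnd_cbnd; last first.
  by apply/measurable_EFinP; apply: measurable_funM => //; apply: measurable_funX.
have dF (s : R) : is_derive s 1 (fun s => V * s ^+ n) (n%:R * V * s ^+ n.-1).
  have d1 := @is_deriveX _ _ _ n s 1 _ (is_derive_id s 1).
  have d2 := is_deriveM (is_derive_cst V s 1) d1.
  have -> : (fun s : R => V * s ^+ n) = (cst V * id ^+ n).
    by apply/funext => t; rewrite /GRing.mul/=; congr (_ * _); elim: (n) => // j IH; rewrite !exprS IH.
  apply: (is_derive_eq d2).
  by rewrite /GRing.scale/= mulr0 addr0 mulr1 mulrA [V * _]mulrC.
have sX (j : nat) : smooth1 (fun s : R => s ^+ j).
  elim: j => [|j IH]; first by under eq_fun do rewrite expr0; exact: smooth1_cst.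
  by under eq_fun do rewrite exprS; apply: smooth1M => //; exact: smooth1_id.
rewrite (@continuous_FTC2 _ _ (fun s => V * s ^+ n))//.
- by rewrite expr0n gtn_eqF// mulr0 sube0.
- apply: continuous_subspaceT.
  apply: (@smooth1_continuous R (fun s => n%:R * V * s ^+ n.-1)).
  by apply: (@smooth1M R (fun=> n%:R * V) (fun s => s ^+ n.-1)); [exact: smooth1_cst|].
- have cF : continuous (fun s : R => V * s ^+ n).
    apply: (@smooth1_continuous R (fun s => V * s ^+ n)).
    by apply: (@smooth1M R (fun=> V) (fun s => s ^+ n)); [exact: smooth1_cst|].
  split => //.
  + by apply: cvg_at_right_filter; exact: cF.
  + by apply: cvg_at_left_filter; exact: cF.
- by move=> s _; rewrite derive1E; case: (dF s).
Qed.

(** The image of dx under |x| and the measure of density c r^(n-1) agree on the half-lines ]-oo, r],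
    by the volume of balls, and these half-lines form a generating pi-system. *)
Lemma polar_measure : exists2 c : R, 0 < c & forall A : set mR, measurable A ->
  (dx (@enorm R n @^-1` A) = \int[mu]_(r in A) (radial_density c r)%:E)%E.
Proof.
have [V V0 VE] := eball_volume R n.
have c0 : 0 < n%:R * V by rewrite mulr_gt0// ltr0n.
exists (n%:R * V) => // A mA.
have mw : measurable_fun [set: mR] (EFin \o radial_density (n%:R * V)).
  by apply/measurable_EFinP; exact: measurable_radial_density.
have w0 r : (0 <= (EFin \o radial_density (n%:R * V)) r)%E.
  by rewrite lee_fin radial_density_ge0// ltW.
have preE (r : R) : @enorm R n @^-1` `]-oo, r] = eball r.
  by apply/seteqP; split => x; rewrite /eball/= in_itv.
have E0 (r : R) : dx (eball r) = (\int[mu]_(s in `]-oo, r]) (radial_density (n%:R * V) s)%:E)%E.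
  have [r0|r0] := ltP 0 r; first by rewrite integral_pow ?ltW// -VE.
  rewrite integral0_eq; last first.
    move=> s /=; rewrite in_itv/= => sr.
    by rewrite /radial_density ltNge (le_trans sr r0).
  have z0 : [set (0 : 'rV[R]_n)] = eball 0.
    apply/seteqP; split => x; rewrite /eball/=.
      by move=> ->; rewrite (eqP (_ : enorm 0 == 0)) ?enorm_eq0.
    by move=> h; apply/eqP; rewrite -enorm_eq0 eq_le h enorm_ge0.
  apply: (@subset_measure0 _ _ _ dx _ (eball 0)).
  - exact: measurable_eball.
  - exact: measurable_eball.
  - by move=> x /= xr; exact: le_trans xr r0.
  - by rewrite -z0; exact: lebesgue_rv_set1.
have := @measure_unique _ _ mR [set `]-oo, r]%classic | r in [set: R]] (fun k => `]-oo, k%:R]%classic)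
  _ _ _ _ (pushm dx (@measurable_enorm R n)) (density_measure mu mw w0) _ _ A mA.
apply.
- apply/seteqP; split.
    rewrite [X in X `<=` _](RGenOInfty.measurableE R); apply: smallest_sub.
      exact: smallest_sigma_algebra.
    move=> _ [r ->]; rewrite -setCitvl; apply: sigma_algebraC.
    by apply: sub_sigma_algebra; exists r.
  apply: smallest_sub; first exact: sigma_algebra_measurable.
  by move=> _ [r _ <-]; exact: measurable_itv.
- move=> _ _ [a _ <-] [b _ <-]; exists (Num.min a b) => //.
  by apply/seteqP; split => x /=; rewrite !in_itv/= le_min => /andP.
- by move=> k; exists k%:R.
- apply/seteqP; split => // x _; exists (Num.truncn `|x|).+1 => //=.
  rewrite in_itv/= (le_trans (ler_norm _))// ltW// truncnS_gt//.
- by move=> _ [r _ <-]; rewrite -[RHS]E0 -preE.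
- move=> k; suff : (dx (eball k%:R) < +oo)%E by rewrite -preE.
  exact: eball_fin.
Qed.

End polar.

Section radial_projection.
Context (R : realType) (n : nat).
Local Notation mR := (measurableTypeR R).
Local Notation mu := (@lebesgue_measure R).
Local Notation dx := (@lebesgue_rv R n).

Lemma ge0_integral_polar (c : R) : 0 < c -> (forall A : set mR, measurable A ->
    (dx (@enorm R n @^-1` A) = \int[mu]_(r in A) (radial_density n c r)%:E)%E) ->
  forall g : mR -> \bar R, (forall r, 0 <= g r)%E -> measurable_fun [set: mR] g ->
  (\int[dx]_x g (enorm x) = \int[mu]_r (g r * (radial_density n c r)%:E))%E.
Proof.
move=> c0 H g g0 mg.
rewrite -(@ge0_integral_density _ _ _ _ _ mu (pushm dx (@measurable_enorm R n)) idfun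
   (radial_density n c))//.
- have := @ge0_integral_pushforward _ _ _ _ _ _ (@measurable_enorm R n) dx setT g measurableT mg (fun r _ => g0 r).
  by rewrite preimage_setT => ->.
- exact: measurable_id.
- exact: measurable_radial_density.
- by move=> r; rewrite radial_density_ge0// ltW.
Qed.

Section measure.
Local Open Scope ereal_scope.
Variable F : 'rV[R]_n -> R.
Hypotheses (iF : dx.-integrable [set: 'rV[R]_n] (EFin \o F)) (F0 : forall x, (0 <= F x)%R).

(** Image of F dx under x |-> |x|. It is finite, since F is integrable, which makes the
    Radon-Nikodym theorem available. *)
Definition radial_measure of dx.-integrable [set: 'rV[R]_n] (EFin \o F)
  & (forall x, 0 <= F x)%R :=
  fun A : set mR => \int[dx]_(x in @enorm R n @^-1` A) (F x)%:E.

Local Notation nu := (radial_measure iF F0).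

Let mF : measurable_fun [set: 'rV[R]_n] (EFin \o F). Proof. exact: measurable_int iF. Qed.
Let F0' x : 0 <= (EFin \o F) x. Proof. by rewrite lee_fin. Qed.
Let M := pushm (density_measure dx mF F0') (@measurable_enorm R n).

Let nu0 : nu set0 = 0. Proof. exact: (measure0 M). Qed.
Let nu_ge0 A : 0 <= nu A. Proof. exact: (measure_ge0 M). Qed.
Let nu_sigma_additive : semi_sigma_additive nu.
Proof. exact: (@measure_semi_sigma_additive _ _ _ M). Qed.

HB.instance Definition _ := isMeasure.Build _ _ _ nu nu0 nu_ge0 nu_sigma_additive.

Let nu_fin : fin_num_fun nu.
Proof.
move=> A mA; rewrite /radial_measure.
have mA' : measurable (@enorm R n @^-1` A).
  by rewrite -[X in measurable X]setTI; exact: measurable_enorm.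
by apply: integrable_fin_num => //; exact: integrableS iF.
Qed.

HB.instance Definition _ := Measure_isFinite.Build _ _ _ nu nu_fin.

End measure.

Lemma radial_projection_ge0 (F : 'rV[R]_n -> R) : (0 < n)%N ->
  dx.-integrable [set: 'rV[R]_n] (EFin \o F) -> (forall x, 0 <= F x) ->
  exists f : R -> R, [/\ forall r, 0 <= f r, mu.-integrable [set: mR] (EFin \o f) &
    forall k : R -> \bar R, (forall r, 0 <= k r)%E -> measurable_fun [set: mR] k ->
    (\int[dx]_x (k (enorm x) * (F x)%:E) = \int[mu]_r (k r * (f r)%:E))%E].
Proof.
move=> n0 iF F0; pose nu := radial_measure iF F0.
have mF : measurable_fun [set: 'rV[R]_n] F.
  by apply/measurable_EFinP; exact: measurable_int iF.
have [c c0 cE] := polar_measure R n0.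
(* A null set of radii has a null preimage by [polar_measure], so the image measure is absolutely
   continuous. *)
have dom : nu `<< mu.
  apply/null_content_dominatesP => A mA A0.
  rewrite /nu /radial_measure; apply: null_set_integral => //.
  - by rewrite -[X in measurable X]setTI; exact: measurable_enorm.
  - by apply: measurable_funTS; exact: measurable_int iF.
  - rewrite [LHS](cE _ mA); apply: null_set_integral => //.
    by apply: measurable_funTS; apply/measurable_EFinP; exact: measurable_radial_density.
have [f [f0 ffin fint fE]] := radon_nikodym_sigma_finite dom.
exists (fine \o f); split.
- by move=> r; rewrite /= fine_ge0.
- by move: fint; congr (mu.-integrable _ _); apply/funext => r /=; rewrite fineK.
- move=> k k0 mk.
  have mf : measurable_fun [set: mR] (fine \o f).
    by apply: measurableT_comp => //; exact: measurable_int fint.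
  rewrite -(@ge0_integral_density _ _ _ _ _ dx nu (@enorm R n) F)//; last exact: measurable_enorm.
  rewrite (@ge0_integral_density _ _ _ _ _ mu nu idfun (fine \o f))//.
  + exact: measurable_id.
  + by move=> r; rewrite /= fine_ge0.
  + move=> A mA; apply: (etrans (fE A mA)); apply: eq_integral => r _ /=; rewrite fineK//.
Qed.

End radial_projection.

(** * Primitives of integrable functions and integration by parts *)

Section primitive.
Context (R : realType).
Local Notation mR := (measurableTypeR R).
Local Notation mu := (@lebesgue_measure R).
Implicit Types f g : R -> R.

(** The lower bound -oo suits integrable functions on the whole line; functions on ]0, N[ are
    extended by 0. *)
Definition prim f (r : R) : R := \int[mu]_(s in `]-oo, r]) f s.

Local Notation L1 f := (mu.-integrable [set: mR] (EFin \o (f : R -> R))).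

Lemma L1_measurable f : L1 f -> measurable_fun [set: mR] f.
Proof. by move=> fi; apply/measurable_EFinP; exact: measurable_int fi. Qed.

Lemma L1S f (D : set mR) : measurable D -> L1 f -> mu.-integrable D (EFin \o f).
Proof. by move=> mD; exact: integrableS. Qed.

Lemma L1D f g : L1 f -> L1 g -> L1 (fun s => f s + g s).
Proof. by move=> fi gi; have := integrableD measurableT fi gi. Qed.

Lemma L1B f g : L1 f -> L1 g -> L1 (fun s => f s - g s).
Proof. by move=> fi gi; have := integrableB measurableT fi gi. Qed.

Lemma L1Z f (c : R) : L1 f -> L1 (fun s => c * f s).
Proof. by move=> fi; have := integrableZl measurableT c fi. Qed.

Lemma L1_bounded_mul f g (C : R) : L1 f -> measurable_fun [set: mR] g ->
  (forall s, `|g s| <= C) -> L1 (fun s => f s * g s).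
Proof.
move=> fi mg gC; have mf := L1_measurable fi.
apply: (@le_integrable _ _ _ mu setT _ _ (EFin \o (fun s => C * f s))) => //.
- by apply/measurable_EFinP; exact: measurable_funM.
- move=> s _ /=; rewrite lee_fin !normrM mulrC ler_wpM2r//.
  by rewrite (le_trans (gC s))// ler_norm.
- exact: L1Z.
Qed.

Lemma primE f r : prim f r = \int[mu]_s (if s <= r then f s else 0).
Proof.
rewrite /prim Rintegral_mkcond; apply: eq_Rintegral => s _.
by rewrite patchE; case: ifPn; rewrite ?inE ?notin_setE/= in_itv/=; [move=> ->|move=> /negP/negbTE ->].
Qed.

Lemma L1_cut f r : L1 f -> L1 (fun s => if s <= r then f s else 0).
Proof.
move=> fi; have mf := L1_measurable fi.
apply: (@le_integrable _ _ _ mu setT _ _ (EFin \o f)) => //.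
- apply/measurable_EFinP; apply: measurable_fun_ifT => //; exact: measurable_fun_ler.
- by move=> s _ /=; rewrite lee_fin; case: ifP => // _; rewrite normr0.
Qed.

Lemma prim_bounded f r : L1 f -> `|prim f r| <= \int[mu]_s `|f s|.
Proof.
move=> fi; rewrite primE.
have fc := L1_cut r fi.
apply: (le_trans (le_normr_Rintegral _ fc)) => //.
apply: le_Rintegral => //.
- by have := integrable_abse fc.
- by have := integrable_abse fi.
- by move=> s _; case: ifP => // _; rewrite normr0.
Qed.

(** The primitives of the positive and negative parts are monotone. *)
Lemma measurable_prim f : L1 f -> measurable_fun [set: mR] (prim f).
Proof.
move=> fi.
have h (g : R -> R) : L1 g -> (forall s, 0 <= g s) -> measurable_fun [set: mR] (prim g).
  move=> gi g0; apply: nondecreasing_measurable => //.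
  move=> a b ab; rewrite /prim; apply: fine_le.
  - by apply: (integrable_fin_num _ (L1S _ gi)).
  - by apply: (integrable_fin_num _ (L1S _ gi)).
  - apply: ge0_subset_integral => //.
    + by apply: measurable_funTS; apply/measurable_EFinP; exact: L1_measurable.
    + by move=> s _; rewrite lee_fin.
    + by apply: subset_itvl; rewrite bnd_simp.
have fp : L1 f^\+ by exact: integrable_funrpos.
have fn : L1 f^\- by exact: integrable_funrneg.
have -> : prim f = (fun r => prim f^\+ r - prim f^\- r).
  apply/funext => r; rewrite /prim -RintegralB//; try exact: L1S.
  by apply: eq_Rintegral => s _; rewrite -[in LHS](funrposBneg f).
by apply: measurable_funB; apply: h => // s; rewrite ?funrpos_ge0 ?funrneg_ge0.
Qed.

(** Integration by parts for functions that are merely integrable: Fubini applied to f(s) g(t) on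
    the two halves t <= s and s < t of the plane. *)
Lemma integral_mul_prim_aux f g : L1 f -> L1 g ->
  [/\ L1 (fun s => f s * prim g s),
   L1 (fun s => prim f s * g s) &
   (\int[mu]_s f s) * (\int[mu]_s g s) =
   \int[mu]_s (f s * prim g s) + \int[mu]_s (prim f s * g s)].
Proof.
move=> fi gi; have mf := L1_measurable fi; have mg := L1_measurable gi.
pose h (z : mR * mR) : R := f z.1 * g z.2.
have mh : measurable_fun [set: mR * mR] h.
  apply: measurable_funM.
    by apply: (measurableT_comp mf); exact: measurable_fst.
  by apply: (measurableT_comp mg); exact: measurable_snd.
have intg s : (\int[mu]_t (`|f s| * `|g t|)%:E = `|f s|%:E * (\int[mu]_t `|g t|)%:E)%E.
  under eq_integral do rewrite EFinM.
  rewrite integralZl//; last by have := integrable_abse gi.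
  congr (_ * _)%E; rewrite /Rintegral fineK//.
  by have := integrable_fin_num measurableT (integrable_abse gi).
have ih : (mu \x mu)%E.-integrable [set: mR * mR] (EFin \o h).
  apply/integrable12ltyP; first exact/measurable_EFinP.
  under eq_integral => s _.
    under eq_integral do rewrite /= normrM.
    rewrite intg; over.
  rewrite integralZr//; last by have := integrable_abse fi.
  have := integrable_fin_num measurableT (integrable_abse fi).
  by move=> /fineK <-; rewrite -EFinM ltry.
have mle : measurable_fun [set: mR * mR] (fun z : mR * mR => z.2 <= z.1).
  by apply: measurable_fun_ler; [exact: measurable_snd|exact: measurable_fst].
pose h1 (z : mR * mR) : R := if z.2 <= z.1 then h z else 0.
pose h2 (z : mR * mR) : R := if z.2 <= z.1 then 0 else h z.
have ih1 : (mu \x mu)%E.-integrable [set: mR * mR] (EFin \o h1).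
  apply: (@le_integrable _ _ _ _ setT _ _ (EFin \o h)) => //.
  - by apply/measurable_EFinP; exact: measurable_fun_ifT.
  - by move=> z _ /=; rewrite /h1 lee_fin; case: ifP => // _; rewrite normr0.
have ih2 : (mu \x mu)%E.-integrable [set: mR * mR] (EFin \o h2).
  apply: (@le_integrable _ _ _ _ setT _ _ (EFin \o h)) => //.
  - by apply/measurable_EFinP; exact: measurable_fun_ifT.
  - by move=> z _ /=; rewrite /h2 lee_fin; case: ifP => // _; rewrite normr0.
have F1 s : fubini_F mu (EFin \o h1) s = (f s * prim g s)%:E.
  rewrite /fubini_F primE; have gc := L1_cut s gi.
  rewrite EFinM /Rintegral fineK; last exact: (integrable_fin_num measurableT gc).
  rewrite -integralZl//; apply: eq_integral => t _.
  by rewrite /= /h1 /h/= -EFinM; case: ifP => // _; rewrite mulr0.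
(* On this half s ranges over the open half-line ]-oo, t[, which differs from the one in [prim] by a
   null set. *)
have G2 t : fubini_G mu (EFin \o h2) t = (prim f t * g t)%:E.
  have -> : prim f t = \int[mu]_(s in `]-oo, t[) f s.
    rewrite /prim /Rintegral integral_itv_bndo_bndc//.
    by apply: measurable_funTS; exact/measurable_EFinP.
  rewrite /fubini_G mulrC.
  have fc : mu.-integrable `]-oo, t[ (EFin \o f) by exact: L1S.
  rewrite EFinM /Rintegral fineK; last exact: (integrable_fin_num _ fc).
  rewrite -integralZl// [RHS]integral_mkcond; apply: eq_integral => s _.
  rewrite /= /h2 /h patchE/= mem_setE in_itv/= ltNge; case: (t <= s) => //=.
  by rewrite mulrC EFinM.
have L1' : L1 (fun s => f s * prim g s).
  exact: (L1_bounded_mul fi (measurable_prim gi) (fun r => prim_bounded r gi)).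
have L2' : L1 (fun s => prim f s * g s).
  have := L1_bounded_mul gi (measurable_prim fi) (fun r => prim_bounded r fi).
  by congr (mu.-integrable _ _); apply/funext => s /=; rewrite mulrC.
split => //.
have H1 := integral12_prod_meas1 ih1.
have H2 := integral21_prod_meas1 ih2.
have H := integral12_prod_meas1 ih.
have Hs : (\int[mu \x mu]_z (EFin \o h) z =
    \int[mu \x mu]_z (EFin \o h1) z + \int[mu \x mu]_z (EFin \o h2) z)%E.
  rewrite -integralD//; apply: eq_integral => z _ /=.
  by rewrite -EFinD /h1 /h2; case: ifP; rewrite ?addr0 ?add0r.
have ifg : (\int[mu]_s fubini_F mu (EFin \o h) s = ((\int[mu]_s f s) * (\int[mu]_s g s))%:E)%E.
  under eq_integral => s _.
    rewrite /fubini_F/= /h/=; under eq_integral do rewrite EFinM.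
    rewrite integralZl//.
    have -> : (\int[mu]_t (g t)%:E = (\int[mu]_t g t)%:E)%E.
      by rewrite /Rintegral fineK//; exact: (integrable_fin_num measurableT gi).
    over.
  rewrite integralZr// EFinM; congr (_ * _)%E.
  by rewrite /Rintegral fineK//; exact: (integrable_fin_num measurableT fi).
move: Hs; rewrite -H ifg -H1 -H2.
under [X in (X + _)%E]eq_integral do rewrite F1.
under [X in (_ + X)%E]eq_integral do rewrite G2.
move=> E.
have := congr1 fine E; rewrite fineD//=.
- exact: (integrable_fin_num measurableT L1').
- exact: (integrable_fin_num measurableT L2').
Qed.

Lemma prim_cut f r s : s <= r -> prim (fun t => if t <= r then f t else 0) s = prim f s.
Proof.
move=> sr; rewrite !primE; apply: eq_Rintegral => t _.
by case: ifPn => // ts; rewrite (le_trans ts sr).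
Qed.

(** The product rule in integrated form, obtained by cutting both functions at r. *)
Lemma prim_product f g r : L1 f -> L1 g ->
  [/\ L1 (fun s => f s * prim g s), L1 (fun s => prim f s * g s) &
  prim f r * prim g r = prim (fun s => f s * prim g s + prim f s * g s) r].
Proof.
move=> fi gi; have [i1 i2 _] := integral_mul_prim_aux fi gi.
split => //.
have [j1 j2 E] := integral_mul_prim_aux (L1_cut r fi) (L1_cut r gi).
rewrite [prim f r]primE [prim g r]primE E -RintegralD// primE.
apply: eq_Rintegral => s _; case: ifPn => sr; last by rewrite mul0r mulr0 addr0.
by rewrite !prim_cut.
Qed.

Lemma eq_prim f g r : {ae mu, forall s, f s = g s} -> L1 f -> L1 g -> prim f r = prim g r.
Proof.
move=> fg fi gi; rewrite /prim /Rintegral; congr fine.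
apply: ae_eq_integral => //.
- by apply: measurable_funTS; apply/measurable_EFinP; exact: L1_measurable.
- by apply: measurable_funTS; apply/measurable_EFinP; exact: L1_measurable.
- by apply: ae_mono fg => s /= -> _.
Qed.

Lemma prim_eq0 f : L1 f -> (forall r, prim f r = 0) -> {ae mu, forall s, f s = 0}.
Proof.
move=> fi f0.
apply: (@ae_eq0_pisystem _ _ _ mu [set `]-oo, r]%classic | r in [set: R]] (fun k => `]-oo, k%:R]%classic)) => //.
- apply/seteqP; split.
    rewrite [X in X `<=` _](RGenOInfty.measurableE R); apply: smallest_sub.
      exact: smallest_sigma_algebra.
    move=> _ [r ->]; rewrite -setCitvl; apply: sigma_algebraC.
    by apply: sub_sigma_algebra; exists r.
  apply: smallest_sub; first exact: sigma_algebra_measurable.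
  by move=> _ [r _ <-]; exact: measurable_itv.
- move=> _ _ [a _ <-] [b _ <-]; exists (Num.min a b) => //.
  by apply/seteqP; split => x /=; rewrite !in_itv/= le_min => /andP.
- apply/seteqP; split => // x _; exists (Num.truncn `|x|).+1 => //=.
  by rewrite in_itv/= (le_trans (ler_norm _))// ltW// truncnS_gt.
- move=> _ [r _ <-]; have := f0 r; rewrite /prim /Rintegral => h.
  have fin : (\int[mu]_(x in `]-oo, r]) (f x)%:E)%E \is a fin_num.
    exact: (integrable_fin_num _ (L1S _ fi)).
  by rewrite -(fineK fin) h.
Qed.

End primitive.

Section radial_projection.
Context (R : realType) (n : nat).
Local Notation mR := (measurableTypeR R).
Local Notation mu := (@lebesgue_measure R).
Local Notation dx := (@lebesgue_rv R n).
Local Notation L1 f := (mu.-integrable [set: mR] (EFin \o (f : R -> R))).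
Local Notation L1n F := (dx.-integrable [set: 'rV[R]_n] (EFin \o (F : 'rV[R]_n -> R))).

Lemma L1n_measurable F : L1n F -> measurable_fun [set: 'rV[R]_n] F.
Proof. by move=> Fi; apply/measurable_EFinP; exact: measurable_int Fi. Qed.

Lemma L1n_bounded_mul F G (C : R) : L1n F -> measurable_fun [set: 'rV[R]_n] G ->
  (forall x, `|F x * G x| <= C * `|F x|) -> L1n (fun x => F x * G x).
Proof.
move=> Fi mG FC; have mF := L1n_measurable Fi.
apply: (@le_integrable _ _ _ dx setT _ _ (EFin \o (fun x => C * F x))) => //.
- by apply/measurable_EFinP; exact: measurable_funM.
- move=> x _ /=; rewrite lee_fin (le_trans (FC x))// normrM ler_wpM2r//.
  exact: ler_norm.
- exact: (integrableZl measurableT C Fi).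
Qed.

Lemma ge0_radial_projection_bounded (F : 'rV[R]_n -> R) (f k : R -> R) (C : R) :
  L1n F -> L1 f -> (forall x, 0 <= F x) -> (forall r, 0 <= f r) ->
  (forall k : R -> \bar R, (forall r, 0 <= k r)%E -> measurable_fun [set: mR] k ->
    (\int[dx]_x (k (enorm x) * (F x)%:E) = \int[mu]_r (k r * (f r)%:E))%E) ->
  measurable_fun [set: mR] k -> (forall r, `|k r| <= C) ->
  \int[dx]_x (F x * k (enorm x)) = \int[mu]_r (f r * k r).
Proof.
move=> Fi fi F0 f0 H mk kC.
have C0 : 0 <= C by rewrite (le_trans _ (kC 0)).
have P (b : R -> R) (B : R) : measurable_fun [set: mR] b -> (forall r, 0 <= b r) ->
    \int[dx]_x (F x * b (enorm x)) = \int[mu]_r (f r * b r).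
  move=> mb b0; rewrite /Rintegral; congr fine.
  have mb' : measurable_fun [set: mR] (EFin \o b) by exact/measurable_EFinP.
  have b0' r : (0 <= (EFin \o b) r)%E by rewrite lee_fin.
  transitivity (\int[dx]_x ((EFin \o b) (enorm x) * (F x)%:E))%E.
    by apply: eq_integral => x _; rewrite mulrC EFinM.
  rewrite H//; by apply: eq_integral => r _ /=; rewrite [in RHS]mulrC EFinM.
have mke : measurable_fun [set: 'rV[R]_n] (fun x => k (enorm x)).
  exact: (measurableT_comp mk (@measurable_enorm R n)).
have i1 : L1n (fun x => F x * k (enorm x)).
  apply: (L1n_bounded_mul (C := C)) => // x.
  by rewrite normrM mulrC ler_wpM2r.
have i2 : L1n (fun x => F x * C).
  apply: (L1n_bounded_mul (C := C)) => // x.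
  by rewrite normrM mulrC ler_wpM2r// ger0_norm.
have j1 : L1 (fun s => f s * k s) by exact: L1_bounded_mul kC.
have j2 : L1 (fun s => f s * C).
  by apply: (L1_bounded_mul (C := C)) => // r; rewrite ger0_norm.
(* The nonnegative case applies to k + C and to the constant C; the claim is the difference. *)
have E1 := P (fun r => k r + C) C.
have E2 := P (fun=> C) C.
have : \int[dx]_x (F x * (k (enorm x) + C)) = \int[mu]_r (f r * (k r + C)).
  apply: E1; first exact: measurable_funD.
  by move=> r; have := kC r; rewrite ler_norml => /andP[h _]; rewrite -lerBlDr sub0r.
under [in LHS]eq_Rintegral do rewrite mulrDr.
under [in RHS]eq_Rintegral do rewrite mulrDr.
rewrite RintegralD// RintegralD// E2//.
by move=> /addIr.
Qed.

Lemma ae_neq0 : (0 < n)%N -> {ae dx, forall x, x != 0}.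
Proof.
move=> n0; exists [set 0]; split.
- have -> : [set (0 : 'rV[R]_n)] = eball 0.
    apply/seteqP; split => x; rewrite /eball/=.
      by move=> ->; rewrite (eqP (_ : enorm 0 == 0)) ?enorm_eq0.
    by move=> h; apply/eqP; rewrite -enorm_eq0 eq_le h enorm_ge0.
  exact: measurable_eball.
- exact: lebesgue_rv_set1.
- by move=> x /= /negP; rewrite negbK => /eqP.
Qed.

Lemma ae_eq_Rintegral_rv F G : measurable_fun [set: 'rV[R]_n] F ->
  measurable_fun [set: 'rV[R]_n] G -> {ae dx, forall x, F x = G x} ->
  \int[dx]_x F x = \int[dx]_x G x.
Proof.
move=> mF mG FG; rewrite /Rintegral; congr fine; apply: ae_eq_integral => //.
- exact/measurable_EFinP.
- exact/measurable_EFinP.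
- by apply: ae_mono FG => x /= -> _.
Qed.

(* The density [f] of the push-forward of [F dx] by [x |-> |x|]: the integral
   of F over the spheres, obtained from the Radon-Nikodym theorem. *)
Lemma radial_projection (N : R) (F : 'rV[R]_n -> R) : (0 < n)%N -> L1n F ->
  (forall x, N <= enorm x -> F x = 0) ->
  exists f : R -> R, [/\ L1 f, (forall r, ~~ (0 < r < N) -> f r = 0) &
    forall (k : R -> R) (C : R), measurable_fun [set: mR] k ->
    (forall r, 0 < r < N -> `|k r| <= C) ->
    [/\ L1n (fun x => F x * k (enorm x)), L1 (fun r => f r * k r) &
    \int[dx]_x (F x * k (enorm x)) = \int[mu]_r (f r * k r)]].
Proof.
move=> n0 Fi FN; have mF := L1n_measurable Fi.
have Fpi : L1n F^\+ by exact: integrable_funrpos.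
have Fni : L1n F^\- by exact: integrable_funrneg.
have [fp [fp0 fpi fpE]] := radial_projection_ge0 n0 Fpi (funrpos_ge0 F).
have [fn [fn0 fni fnE]] := radial_projection_ge0 n0 Fni (funrneg_ge0 F).
have mI : measurable_fun [set: mR] (fun r : R => 0 < r < N).
  by apply: measurable_and; exact: measurable_fun_ltr.
have fi : L1 (fun r => if 0 < r < N then fp r - fn r else 0).
  have h := L1B fpi fni.
  apply: (@le_integrable _ _ _ mu setT _ _ (EFin \o (fun r => fp r - fn r))) => //.
    apply/measurable_EFinP; apply: measurable_fun_ifT => //; exact: L1_measurable.
  by move=> s _ /=; rewrite lee_fin; case: ifP => // _; rewrite normr0.
exists (fun r => if 0 < r < N then fp r - fn r else 0); split => //.
  by move=> r /negbTE ->.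
move=> k C mk kC.
(* k is bounded on ]0, N[ only. Cutting it there changes F k(|x|) on the null set {0} at most, since
   F vanishes for |x| >= N. *)
pose k1 r := if 0 < r < N then k r else 0.
have mk1 : measurable_fun [set: mR] k1 by exact: measurable_fun_ifT.
have k1C r : `|k1 r| <= `|C|.
  rewrite /k1; case: ifP => [/kC h|_]; last by rewrite normr0.
  by rewrite (le_trans h)// ler_norm.
have mke : measurable_fun [set: 'rV[R]_n] (fun x => k (enorm x)).
  exact: (measurableT_comp mk (@measurable_enorm R n)).
have mk1e : measurable_fun [set: 'rV[R]_n] (fun x => k1 (enorm x)).
  exact: (measurableT_comp mk1 (@measurable_enorm R n)).
have ii G : L1n G -> L1n (fun x => G x * k1 (enorm x)).
  move=> Gi; apply: (L1n_bounded_mul (C := `|C|)) => // x.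
  by rewrite normrM mulrC ler_wpM2r.
have aeE : {ae dx, forall x, F x * k1 (enorm x) = F x * k (enorm x)}.
  apply: ae_mono (ae_neq0 n0) => x x0; rewrite /k1 enorm_gt0 x0/=.
  by case: ltP => // /FN ->; rewrite !mul0r.
have j1 : L1n (fun x => F x * k (enorm x)).
  have := ii F Fi => /integrableP[_ h].
  apply/integrableP; split; first by apply/measurable_EFinP; exact: measurable_funM.
  apply: le_lt_trans h; rewrite le_eqVlt; apply/orP; left; apply/eqP.
  apply: ae_eq_integral => //.
  - by apply: measurableT_comp => //; apply/measurable_EFinP; exact: measurable_funM.
  - by apply: measurableT_comp => //; apply/measurable_EFinP; exact: measurable_funM.
  - by apply: ae_mono aeE => x /= ->.
have j2 : L1 (fun r => (if 0 < r < N then fp r - fn r else 0) * k r).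
  have := L1_bounded_mul fi mk1 k1C; congr (mu.-integrable _ _); apply/funext => r /=.
  by rewrite /k1; case: ifP; rewrite ?mul0r.
split => //.
rewrite -(@ae_eq_Rintegral_rv (fun x => F x * k1 (enorm x)))//; last 2 first.
- exact: measurable_funM.
- exact: measurable_funM.
have -> : \int[dx]_x (F x * k1 (enorm x)) =
    \int[dx]_x (F^\+ x * k1 (enorm x)) - \int[dx]_x (F^\- x * k1 (enorm x)).
  rewrite -RintegralB//; [|exact: ii..].
  by apply: eq_Rintegral => x _; rewrite -mulrBl -[in LHS](funrposBneg F).
rewrite (ge0_radial_projection_bounded Fpi fpi (funrpos_ge0 F) fp0 fpE mk1 k1C).
rewrite (ge0_radial_projection_bounded Fni fni (funrneg_ge0 F) fn0 fnE mk1 k1C).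
rewrite -RintegralB//.
- apply: eq_Rintegral => r _; rewrite /k1; case: ifP => _; first by rewrite mulrBl.
  by rewrite !mulr0 mul0r subrr.
- exact: L1_bounded_mul mk1 k1C.
- exact: L1_bounded_mul mk1 k1C.
Qed.

End radial_projection.

(** * The du Bois-Reymond lemma on ]0, N[, with tests in r^2 *)

Section du_bois_reymond.
Context (R : realType).
Local Notation mR := (measurableTypeR R).
Local Notation mu := (@lebesgue_measure R).
Local Notation L1 f := (mu.-integrable [set: mR] (EFin \o (f : R -> R))).

Lemma smooth1_bounded (b : R -> R) (u v : R) : smooth1 b ->
  exists2 C, 0 <= C & forall t, u <= t <= v -> `|b t| <= C.
Proof.
move=> /smooth1_continuous cb.
have : compact (b @` `[u, v]).
  by apply: continuous_compact; [exact: continuous_subspaceT|exact: segment_compact].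
move=> /compact_bounded[M [_ HM]].
exists (`|M| + 1); first by rewrite addr_ge0.
move=> t tuv; apply: (HM (`|M| + 1)).
  by rewrite (le_lt_trans (ler_norm _))// ltrDl.
by exists t => //=; rewrite in_itv.
Qed.

Lemma L1_bounded_itv (b : R -> R) (u v C : R) : measurable_fun [set: mR] b ->
  (forall t, ~~ (u <= t <= v) -> b t = 0) -> (forall t, u <= t <= v -> `|b t| <= C) -> L1 b.
Proof.
move=> mb b0 bC; apply: (@integrable_bounded_support _ _ _ mu _ `[u, v]%classic C) => //.
  have E := @lebesgue_measure_itv R `[u, v].
  by rewrite [X in (X < _)%E]E/=; case: ifPn => _ //=; rewrite -EFinB ltry.
move=> t; rewrite indicE mem_setE in_itv/=; case: (boolP (u <= t <= v)) => h.
  by rewrite mulr1 bC.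
by rewrite mulr0 b0// normr0.
Qed.

(** H(t) is minus the integral of b over ]t, +oo[: it vanishes to the right of the support of b and
    may be a nonzero constant to the left. *)
Lemma smooth1_antiderivative (b : R -> R) (u v : R) : smooth1 b ->
  (forall t, ~~ (u <= t <= v) -> b t = 0) ->
  exists H, [/\ smooth1 H, forall t, is_derive t (1:R) H (b t) &
    forall t, v <= t -> H t = 0].
Proof.
move=> sb b0; have mb := smooth1_measurable sb.
have [C C0 bC] := smooth1_bounded u v sb.
have bi : L1 b by exact: L1_bounded_itv b0 bC.
pose H t := prim b t - \int[mu]_s b s.
have dH t : is_derive t (1:R) H (b t).
  have tt : t < t + 1 by rewrite ltrDl.
  have bi' : mu.-integrable `]-oo, t + 1] (EFin \o b) by exact: L1S.
  have [||d1 d2] := @continuous_FTC1 _ b -oo%O t (t + 1) tt bi'.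
  - by rewrite ltNyr.
  - exact: smooth1_continuous sb t.
  rewrite derive1E in d2.
  have d3 : is_derive t (1:R) (prim b) (b t) by split.
  have d4 := is_deriveB d3 (is_derive_cst (\int[mu]_s b s) t 1).
  by apply: (is_derive_eq d4); rewrite subr0.
exists H; split => //; first exact: smooth1_prim sb dH.
move=> t vt; rewrite /H primE; apply/eqP; rewrite subr_eq0; apply/eqP.
apply: eq_Rintegral => s _; case: ifPn => // st; rewrite b0//.
by rewrite negb_and -!ltNge (le_lt_trans vt _) ?orbT// ltNge.
Qed.

Lemma Rintegral_derive (F f : R -> R) (a b : R) : a <= b ->
  (forall x, is_derive x (1:R) F (f x)) -> continuous f ->
  \int[mu]_(s in `[a, b]) f s = F b - F a.
Proof.
move=> ab dF cf; move: ab; rewrite le_eqVlt => /orP[/eqP ->|ab].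
  by rewrite set_itv1 Rintegral_set1 subrr.
have cF : continuous F.
  by move=> x; apply/differentiable_continuous/derivable1_diffP; case: (dF x).
rewrite /Rintegral (@continuous_FTC2 _ f F a b)//.
- exact: continuous_subspaceT.
- split => //.
  + by apply: cvg_at_right_filter; exact: cF.
  + by apply: cvg_at_left_filter; exact: cF.
- by move=> x _; rewrite derive1E; case: (dF x).
Qed.

(** With omega(r) = h(r^2) the hypothesis reads: f omega + g omega' has integral 0 whenever omega
    vanishes from N on, omega(0) being free. This freedom forces the constant of integration to be
    0. Choosing h' close to the indicator of t < b^2 shows that (g - prim f) 2 r has integral 0 over
    ]0, b[, for all b <= N. *)
Lemma du_bois_reymond (N : R) (f g : R -> R) : L1 f -> L1 g ->
  (forall r, ~~ (0 < r < N) -> f r = 0) -> (forall r, ~~ (0 < r < N) -> g r = 0) ->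
  (forall h h', smooth1 h -> smooth1 h' -> (forall t, is_derive t (1:R) h (h' t)) ->
    (forall t, N ^+ 2 <= t -> h t = 0) ->
    \int[mu]_r (f r * h (r ^+ 2) + g r * (2 * r * h' (r ^+ 2))) = 0) ->
  {ae mu, forall r, 0 < r < N -> g r = prim f r}.
Proof.
move=> fi gi f0 g0 hyp.
have [N0|N0] := leP N 0.
  by apply: aeW => r /andP[r0 rN]; have := lt_trans r0 rN; rewrite ltNge N0.
have mpf := measurable_prim fi.
have mI : measurable_fun [set: mR] (fun r : R => 0 < r < N).
  by apply: measurable_and; exact: measurable_fun_ltr.
pose S s := if 0 < s < N then (g s - prim f s) * (2 * s) else 0.
have mg := L1_measurable gi; have mf := L1_measurable fi.
have mS : measurable_fun [set: mR] S.
  apply: measurable_fun_ifT => //; apply: measurable_funM.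
    exact: measurable_funB.
  exact: measurable_funM.
have Si : L1 S.
  pose M := \int[mu]_s `|f s|.
  have i1 : L1 (fun s => (2 * N) * g s) by exact: L1Z.
  have i2 : L1 (fun s => if 0 <= s <= N then 2 * N * M else 0).
    apply: (@L1_bounded_itv _ 0 N `|2 * N * M|).
    - apply: measurable_fun_ifT => //.
      by apply: measurable_and; exact: measurable_fun_ler.
    - by move=> t /negbTE ->.
    - by move=> t ->.
  have i3 := integrable_abse i1.
  have i4 : L1 (fun s => `|2 * N * g s| + (if 0 <= s <= N then 2 * N * M else 0)).
    exact: (L1D i3 i2).
  apply: (@le_integrable _ _ _ mu setT _ _ _ _ _ i4) => //.
    exact/measurable_EFinP.
  move=> s _ /=; rewrite lee_fin /S; case: ifPn => [/andP[s0 sN]|_]; last first.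
    by rewrite normr0.
  rewrite (ltW s0) (ltW sN)/= [leRHS]ger0_norm; last first.
    by rewrite addr_ge0// !mulr_ge0// ?(ltW N0)// Rintegral_ge0.
  rewrite !normrM [`|2|]ger0_norm// [`|s|]gtr0_norm// [`|N|]gtr0_norm//.
  apply: (@le_trans _ _ ((`|g s| + M) * (2 * N))).
    apply: ler_pM => //; first by rewrite mulr_ge0// ltW.
      by rewrite (le_trans (ler_normB _ _))// lerD2l prim_bounded.
    by rewrite ler_pM2l// ltW.
  by rewrite mulrDl [`|g s| * _]mulrC [M * _]mulrC.
suff key : forall r, prim S r = 0.
  have := prim_eq0 Si key; apply: ae_mono => s; rewrite /S => + sN.
  rewrite sN => /eqP; rewrite mulf_eq0 => /orP[|]; first by rewrite subr_eq0 => /eqP.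
  by rewrite mulf_eq0 pnatr_eq0/= => /eqP s0; move: sN; rewrite s0 ltxx.
suff key b : 0 < b -> b <= N -> \int[mu]_(s in [set s | (- b < s < b)%R]) S s = 0.
  have pE r : 0 < r -> r <= N -> prim S r = 0.
    move=> r0 rN; rewrite -(key r r0 rN).
    transitivity (\int[mu]_(s in `]-oo, r[) S s).
      rewrite /prim /Rintegral integral_itv_bndo_bndc//.
      by apply: measurable_funTS; exact/measurable_EFinP.
    rewrite Rintegral_mkcond [RHS]Rintegral_mkcond; apply: eq_Rintegral => s _.
    rewrite !patchE mem_setE in_itv/=.
    have -> : (s \in [set s | (- r < s < r)%R]) = (- r < s < r) by apply/idP/idP; rewrite inE.
    case: (ltP s r) => sr; last by rewrite andbF.
    rewrite andbT; case: ltP => // h.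
    by rewrite /S ifF// ltNge (le_trans h)// oppr_le0 ltW.
  move=> r; have [r0|r0] := leP r 0.
    rewrite primE; transitivity (\int[mu]_s (0 : R)).
      apply: eq_Rintegral => s _; case: ifPn => // sr; rewrite /S ifF//.
      by rewrite ltNge (le_trans sr r0).
    by rewrite /Rintegral integral0.
  have [rN|rN] := leP r N; first exact: pE.
  rewrite -(pE N N0 (lexx _)) !primE; apply: eq_Rintegral => s _.
  case: (leP s N) => sN; first by rewrite (le_trans sN (ltW rN)).
  by case: ifP => // _; rewrite /S ifF// [s < N]ltNge (ltW sN) andbF.
move=> b0 bN.
(* On t >= 0, w is positive exactly for t < b^2. The second factor only cuts w off at t = -1, since
   the antiderivative asks for an integrand supported in a segment. *)
pose w (t : R) := flat_exp 0 (b ^+ 2 + (- t)) * flat_exp 0 (t + 1).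
have sw : smooth1 w.
  apply: smooth1M; apply: smooth1_flat; apply: smooth1D.
  - exact: smooth1_cst.
  - have := smooth1M (smooth1_cst (-1)) (@smooth1_id R).
    by under eq_fun do rewrite mulN1r.
  - exact: smooth1_id.
  - exact: smooth1_cst.
have w_gt0 t : 0 <= t -> (0 < w t) = (t < b ^+ 2).
  move=> t0; have e : 0 < flat_exp 0 (t + 1) by rewrite flat_exp_gt0 ltr_wpDl.
  by rewrite /w pmulr_lgt0// flat_exp_gt0 subr_gt0.
have w_ge0 t : 0 <= w t by rewrite mulr_ge0 ?flat_exp_ge0.
have w0 t : ~~ (- 1 <= t <= b ^+ 2) -> w t = 0.
  rewrite negb_and -!ltNge => /orP[h|h]; rewrite /w.
    by rewrite [X in _ * X]flat_exp_le0 ?mulr0// -lerBrDr sub0r ltW.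
  by rewrite flat_exp_le0 ?mul0r// subr_le0 ltW.
have -> : [set s | - b < s < b] = [set s | 0 < w (s ^+ 2)].
  apply/seteqP; split => s /=; rewrite w_gt0 ?sqr_ge0// -ltr_norml => h.
    by rewrite -real_normK ?num_real// ltrXn2r// ?nnegrE// ltW.
  rewrite ltNge; apply/negP => bs; move: h; rewrite ltNge => /negP; apply.
  by rewrite -[leRHS]real_normK ?num_real// lerXn2r// ?nnegrE// ltW.
have m2 : measurable_fun [set: mR] (fun s : R => s ^+ 2 : R).
  by apply: measurable_funX.
have mw : measurable_fun [set: mR] (fun s : R => w (s ^+ 2)).
  exact: (measurableT_comp (smooth1_measurable sw) m2).
rewrite /Rintegral integral_pos_set// => k.
pose be t := flat_exp 0 (k.+1%:R * w t).
have sbe : smooth1 be.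
  by apply: smooth1_flat; apply: smooth1M => //; exact: smooth1_cst.
have be0 t : ~~ (- 1 <= t <= b ^+ 2) -> be t = 0.
  by move=> /w0; rewrite /be => ->; rewrite mulr0 flat_exp_le0.
have be1 t : `|be t| <= 1 by rewrite ger0_norm ?flat_exp_ge0// flat_exp0_le1.
have [H [sH dH H0]] := smooth1_antiderivative sbe be0.
have bN2 : b ^+ 2 <= N ^+ 2 by rewrite lerXn2r// ?nnegrE ltW.
have hypH := hyp H be sH sbe dH (fun t Nt => H0 t (le_trans bN2 Nt)).
pose om (s : R) := H (s ^+ 2).
(* Truncated at 0, so that the primitive of om' is om - om 0 on r >= 0. *)
pose om' (s : R) := if 0 <= s then 2 * s * be (s ^+ 2) else 0.
have sq : smooth1 (fun s : R => s ^+ 2).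
  by under eq_fun do rewrite expr2; apply: smooth1M; exact: smooth1_id.
have dom (s : R) : is_derive s (1:R) om (2 * s * be (s ^+ 2)).
  have d1 : is_derive s (1:R) (fun s => s * s) (s + s).
    have := is_deriveM (is_derive_id s (1:R)) (is_derive_id s (1:R)).
    by move=> d; apply: (is_derive_eq d); rewrite /GRing.scale/= mulr1.
  have d2 : is_derive s (1:R) (fun s => s ^+ 2) (s + s).
    by move: d1; congr (is_derive _ _ _ _); apply/funext => t; rewrite expr2.
  have := @is_derive1_comp _ H (fun s => s ^+ 2) s _ _ (dH _) d2.
  by move=> d; apply: (is_derive_eq d); rewrite mulrC; congr (_ * _); ring.
have com : continuous (fun s : R => 2 * s * be (s ^+ 2)).
  apply: smooth1_continuous; apply: smooth1M.
    by apply: smooth1M; [exact: smooth1_cst|exact: smooth1_id].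
  apply: (@smooth1_comp _ _ _ sbe sq).
have be_ge t : b ^+ 2 <= t -> be t = 0.
  move=> bt; rewrite /be /w (@flat_exp_le0 _ 0 (b ^+ 2 - t)) ?subr_le0//.
  by rewrite mul0r mulr0 flat_exp_le0.
have om'N s : N <= s -> om' s = 0.
  move=> Ns; rewrite /om'; case: ifP => // s0; rewrite be_ge ?mulr0// (le_trans bN2)//.
  by rewrite lerXn2r// ?nnegrE// ltW.
have om'i : L1 om'.
  apply: (@L1_bounded_itv _ 0 N (2 * N)).
  - apply: measurable_fun_ifT => //; first exact: measurable_fun_ler.
    exact: continuous_measurable_fun.
  - move=> t; rewrite negb_and -!ltNge => /orP[t0|Nt]; last by rewrite om'N// ltW.
    by rewrite /om' leNgt t0.
  - move=> t /andP[t0 tN]; rewrite /om' t0 !normrM.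
    rewrite -[leRHS]mulr1 ler_pM// ler_pM// ?normr_id// ?ger0_norm//.
have prim_om r : 0 <= r -> prim om' r = om r - om 0.
  move=> r0; rewrite -(Rintegral_derive r0 dom com) primE [RHS]Rintegral_mkcond.
  apply: eq_Rintegral => s _; rewrite patchE mem_setE in_itv/= /om'.
  by case: (0 <= s); case: (s <= r).
have omN : om N = 0 by rewrite /om H0.
have tot : \int[mu]_s om' s = - om 0.
  rewrite -[RHS]add0r -[X in X - _]omN -prim_om ?(ltW N0)// primE.
  apply: eq_Rintegral => s _; case: ifPn => //; rewrite -ltNge => Ns.
  by rewrite om'N// ltW.
have [p1 p2 pE] := integral_mul_prim_aux fi om'i.
have mom : measurable_fun [set: mR] om.
  exact: (measurableT_comp (smooth1_measurable sH) m2).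
have [CH CH0 HC] := smooth1_bounded 0 (N ^+ 2) sH.
have iom : L1 (fun s => f s * om s).
  have h : L1 (fun s => f s * prim om' s + om 0 * f s) by apply: L1D => //; exact: L1Z.
  move: h; congr (mu.-integrable _ _); apply/funext => s /=; congr EFin.
  case: (boolP (0 < s < N)) => [/andP[s0 _]|sN]; last by rewrite f0// !mul0r mulr0 addr0.
  by rewrite prim_om ?ltW// mulrBr [om 0 * _]mulrC subrK.
have e1 : \int[mu]_s (f s * prim om' s) = \int[mu]_s (f s * om s) - om 0 * \int[mu]_s f s.
  rewrite -RintegralZl// -RintegralB//; last exact: L1Z.
  apply: eq_Rintegral => s _.
  case: (boolP (0 < s < N)) => [/andP[s0 _]|sN]; last by rewrite f0// !mul0r mulr0 subrr.
  by rewrite prim_om ?ltW// mulrBr [om 0 * _]mulrC.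
have igom : L1 (fun s => g s * om' s).
  apply: (@L1_bounded_mul _ _ _ (2 * N)) => //; first exact: L1_measurable.
  move=> s; rewrite /om'; case: ifPn => s0; last by rewrite normr0 mulr_ge0// ltW.
  have [sN|Ns] := leP s N.
    by rewrite !normrM -[leRHS]mulr1 ler_pM// ler_pM// ?normr_id// ?ger0_norm.
  rewrite be_ge ?mulr0 ?normr0 ?mulr_ge0// ?(ltW N0)// (le_trans bN2)//.
  by rewrite lerXn2r// ?nnegrE// ltW.
have e2 : \int[mu]_s (f s * om s) + \int[mu]_s (g s * om' s) = 0.
  rewrite -RintegralD// -[RHS]hypH; apply: eq_Rintegral => s _; congr (_ + _).
  case: (boolP (0 < s < N)) => [/andP[s0 _]|sN]; last by rewrite g0// !mul0r.
  by rewrite /om' (ltW s0).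
(* In the integration by parts [pE], the primitive of om' is om - om 0 and its total integral is -
   om 0, so the terms with the value at 0 cancel. *)
have e3 : \int[mu]_s (g s * om' s) - \int[mu]_s (prim f s * om' s) = 0.
  move: pE; rewrite tot e1; move: e2.
  set x1 := \int[mu]_s (f s * om s); set x2 := \int[mu]_s (g s * om' s).
  by set x3 := \int[mu]_s (prim f s * om' s); set x4 := \int[mu]_s f s => *; lra.
have Sb s : S s * flat_exp 0 (k.+1%:R * w (s ^+ 2)) = g s * om' s - prim f s * om' s.
  rewrite -/(be (s ^+ 2)) /S -mulrBl.
  have [s0|s0] := ltP 0 s => /=; last first.
    rewrite mul0r /om'; case: ifP => [h|]; last by rewrite mulr0.
    by rewrite (le_anti (introT andP (conj s0 h))) mulr0 mul0r mulr0.
  have [sN|Ns] := ltP s N; first by rewrite /om' (ltW s0) -mulrA.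
  by rewrite om'N// mulr0 mul0r.
have iS : L1 (fun s => g s * om' s - prim f s * om' s) by exact: L1B.
under eq_integral do rewrite Sb.
rewrite -(fineK (integrable_fin_num measurableT iS)).
have := RintegralB measurableT igom p2; rewrite e3 /Rintegral => ->.
by [].
Qed.

End du_bois_reymond.

(** * The metric of a model manifold *)

Section determinant.
Context {R : comNzRingType} {n : nat}.

(** The bordered matrix M has two block triangular factorisations, one for each side of the
    identity. *)
Lemma det_1_sub_rank1 (u : 'cV[R]_n) (v : 'rV[R]_n) :
  \det (1%:M - u *m v) = 1 - (v *m u) 0 0.
Proof.
pose M : 'M[R]_(1 + n) := block_mx 1%:M v u 1%:M.
have E1 : M = block_mx 1%:M 0 u 1%:M *m block_mx 1%:M v 0 (1%:M - u *m v).
  by rewrite mulmx_block !mul1mx !mulmx1 !mul0mx ?mulmx0 !addr0 addrC subrK.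
have E2 : M = block_mx (1%:M - v *m u) v 0 1%:M *m block_mx 1%:M 0 u 1%:M.
  by rewrite mulmx_block !mul1mx !mulmx1 ?mul0mx ?mulmx0 ?add0r subrK.
have : \det M = \det M by [].
rewrite {1}E1 E2 !det_mulmx det_lblock !det_ublock !det1 !mul1r !mulr1 => ->.
by rewrite {1}[1%:M - _]mx11_scalar det_scalar1 !mxE.
Qed.

End determinant.

Section dot.
Context {R : realType} {n : nat}.
Implicit Types u v w : 'rV[R]_n.

Lemma dotC v w : dot v w = dot w v.
Proof. by apply: eq_bigr => i _; rewrite mulrC. Qed.

Lemma dotDl u v w : dot (u + v) w = dot u w + dot v w.
Proof. by rewrite /dot -big_split; apply: eq_bigr => i _; rewrite mxE mulrDl. Qed.

Lemma dotZl a v w : dot (a *: v) w = a * dot v w.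
Proof. by rewrite /dot mulr_sumr; apply: eq_bigr => i _; rewrite mxE mulrA. Qed.

Lemma dotNl v w : dot (- v) w = - dot v w.
Proof. by rewrite -scaleN1r dotZl mulN1r. Qed.

Lemma dotDr u v w : dot w (u + v) = dot w u + dot w v.
Proof. by rewrite dotC dotDl ![dot _ w]dotC. Qed.

Lemma dotZr a v w : dot v (a *: w) = a * dot v w.
Proof. by rewrite dotC dotZl dotC. Qed.

Lemma dotNr v w : dot v (- w) = - dot v w.
Proof. by rewrite dotC dotNl dotC. Qed.

Lemma dotE v w : dot v w = (v *m w^T) 0 0.
Proof. by rewrite mxE; apply: eq_bigr => i _; rewrite mxE. Qed.

Lemma dot_basis v i : dot v (basis R i) = v 0 i.
Proof.
rewrite /dot (bigD1 i)//= big1 => [|j ji]; rewrite /basis mxE eqxx/=.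
  by rewrite eqxx mulr1 addr0.
by rewrite (negbTE ji) mulr0.
Qed.

Lemma sqr_coord_le v i : v 0 i ^+ 2 <= dot v v.
Proof.
rewrite /dot (bigD1 i)//= -expr2 lerDl.
by rewrite sumr_ge0// => j _; rewrite -expr2 sqr_ge0.
Qed.

(** The Euclidean gradient of |x| away from the pole; at 0 its value is 0. *)
Definition unit_dir v : 'rV[R]_n := (enorm v)^-1 *: v.

Lemma dot_unit_dir v : v != 0 -> dot (unit_dir v) (unit_dir v) = 1.
Proof.
move=> v0; rewrite dotZl dotZr mulrA.
have -> : dot v v = enorm v ^+ 2 by rewrite sqr_enorm.
by field; rewrite enorm_eq0.
Qed.

End dot.

Section metric.
Context {R : realType} {n : nat} (psi : R -> R).
Implicit Types v w : 'rV[R]_n.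
Variable x : 'rV[R]_n.
Hypotheses (x0 : x != 0) (psi0 : 0 < psi (enorm x)).

Variables (e : 'rV[R]_n) (q : R).
Hypotheses (eE : e = unit_dir x) (qE : q = psi (enorm x) / enorm x).
Let c := q ^+ 2.

Let r0 : 0 < enorm x. Proof. by rewrite enorm_gt0. Qed.
Let q0 : 0 < q. Proof. by rewrite qE divr_gt0. Qed.
Let c0 : 0 < c. Proof. by rewrite exprn_gt0. Qed.
Let ee : dot e e = 1. Proof. by rewrite eE dot_unit_dir. Qed.

(** Relative to the Euclidean structure of the chart, the metric is 1 on the radial direction e and
    c = (psi(r)/r)^2 on its orthogonal complement. The Gram matrix, its inverse and its determinant
    follow from this. *)
Lemma metricE v w : metric psi x v w = c * dot v w + (1 - c) * (dot v e * dot w e).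
Proof.
rewrite /metric (negbTE x0).
have E u : d_r x u = dot u e by rewrite /d_r eE dotZr [LHS]mulrC [dot u x]dotC.
have T u : d_theta x u = (enorm x)^-1 *: (u - dot u e *: e) by rewrite /d_theta E eE.
rewrite !E !T dotZl dotZr !(dotDl, dotDr, dotNl, dotNr, dotZl, dotZr) ee [dot e w]dotC.
by rewrite /c qE; field; rewrite gt_eqF.
Qed.

Let P : 'M[R]_n := e^T *m e.

Let PP : P *m P = P.
Proof.
rewrite /P mulmxA -(mulmxA _ e) [e *m e^T]mx11_scalar -dotE ee.
by rewrite -mulmxA mul_scalar_mx scale1r.
Qed.

Lemma gramE : gram psi x = c *: 1%:M + (1 - c) *: P.
Proof.
apply/matrixP => i j; rewrite mxE metricE !mxE dot_basis.
rewrite [dot (basis R i) e]dotC [dot (basis R j) e]dotC !dot_basis big_ord1 !mxE.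
by rewrite /basis ?mxE eqxx/= eq_sym.
Qed.

Let ginv : gram psi x *m (c^-1 *: 1%:M + (1 - c^-1) *: P) = 1%:M.
Proof.
rewrite gramE mulmxDl !mulmxDr -!scalemxAl -!scalemxAr !mul1mx !mulmx1 PP.
rewrite !scalerA mulfV ?gt_eqF// scale1r -addrA -!scalerDl.
rewrite (_ : _ + (_ + _) = 0) ?scale0r ?addr0//.
by field; rewrite gt_eqF.
Qed.

Lemma sharpE w : sharp psi x w = c^-1 *: w + (1 - c^-1) * dot w e *: e.
Proof.
have [gu _] := mulmx1_unit ginv.
have E : invmx (gram psi x) = c^-1 *: 1%:M + (1 - c^-1) *: P.
  by rewrite -[LHS]mulmx1 -[in LHS]ginv mulmxA mulVmx// mul1mx.
rewrite /sharp E.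
rewrite mulmxDr -!scalemxAr mulmx1 /P mulmxA [w *m e^T]mx11_scalar -dotE.
by rewrite mul_scalar_mx scalerA.
Qed.

Lemma volE : vol psi x = q ^+ n.-1.
Proof.
have n0 : (0 < n)%N.
  case: (posnP n) => // n0; move/eqP: x0; case.
  by apply/rowP => -[i ilt]; exfalso; move: ilt; rewrite n0.
have -> : vol psi x = Num.sqrt (c ^+ n.-1).
  congr Num.sqrt; rewrite gramE.
  (* With c taken out, the identity minus a rank one matrix is left, and the determinant is c^n (1 +
     (1 - c)/c) = c^(n-1). *)
  have -> : c *: 1%:M + (1 - c) *: P = c *: (1%:M - e^T *m (- ((1 - c) / c) *: e)).
    rewrite -scalemxAr scaleNr opprK scalerDr scalerA; congr (_ + _ *: _).
    by field; rewrite gt_eqF.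
  rewrite detZ det_1_sub_rank1 -scalemxAl mxE -dotE ee.
  rewrite -[in c ^+ n](prednK n0) exprS; field; by rewrite gt_eqF.
by rewrite /c exprAC sqrtr_sqr ger0_norm// exprn_ge0// ltW.
Qed.

Lemma metric_sharp v w : metric psi x (sharp psi x v) (sharp psi x w) =
  c^-1 * dot v w + (1 - c^-1) * (dot v e * dot w e).
Proof.
rewrite metricE !sharpE !(dotDl, dotDr, dotZl, dotZr) ee [dot e w]dotC.
by field; rewrite gt_eqF.
Qed.

(** c cancels: a radial differential pairs with any other through radial components alone. When du
    is radial, the weak equation depends on psi only through the volume. *)
Lemma metric_sharp_radial a w :
  metric psi x (sharp psi x (a *: e)) (sharp psi x w) = a * dot w e.
Proof.
rewrite metric_sharp !dotZl ee [dot e w]dotC; field; by rewrite gt_eqF.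
Qed.

Lemma metric_sharp_radial_r a w :
  metric psi x (sharp psi x w) (sharp psi x (a *: e)) = a * dot w e.
Proof.
rewrite metric_sharp dotZl dotZr ee; field; by rewrite gt_eqF.
Qed.

Lemma gnorm_sharp_radial a : gnorm psi x (sharp psi x (a *: e)) = `|a|.
Proof. by rewrite /gnorm metric_sharp_radial dotZl ee mulr1 -expr2 sqrtr_sqr. Qed.

(** As psi(r) >= r gives c >= 1, c times the dual metric dominates the Euclidean one; the Riemannian
    W^{1,p}_loc bound thus controls the coordinates of du. *)
Lemma coord_le_gnorm w i : enorm x <= psi (enorm x) ->
  `|w 0 i| <= q * gnorm psi x (sharp psi x w).
Proof.
move=> h; have q1 : 1 <= q by rewrite qE ler_pdivlMr// mul1r.
have c1 : 1 <= c by rewrite exprn_ege1.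
have we0 : 0 <= dot w e ^+ 2 by rewrite sqr_ge0.
have ww0 := sqr_coord_le w i.
have m0 : w 0 i ^+ 2 <= c * metric psi x (sharp psi x w) (sharp psi x w).
  rewrite metric_sharp -expr2 mulrDr mulrA mulfV ?gt_eqF// mul1r mulrA mulrBr mulr1 mulfV ?gt_eqF//.
  by rewrite (le_trans ww0)// lerDl mulr_ge0// subr_ge0.
rewrite -sqrtr_sqr; have -> : q * gnorm psi x (sharp psi x w) =
    Num.sqrt (c * metric psi x (sharp psi x w) (sharp psi x w)).
  by rewrite sqrtrM ?ltW// sqrtr_sqr ger0_norm// ltW.
exact: ler_wsqrtr.
Qed.

End metric.

(** * Passing between R^n and the half-line of radii *)

Section polar_coordinates.
Context (R : realType) (n : nat).
Local Notation mR := (measurableTypeR R).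
Local Notation mu := (@lebesgue_measure R).
Local Notation dx := (@lebesgue_rv R n).
Local Notation L1 f := (mu.-integrable [set: mR] (EFin \o (f : R -> R))).
Local Notation L1n F := (dx.-integrable [set: 'rV[R]_n] (EFin \o (F : 'rV[R]_n -> R))).
Variable c : R.
Hypotheses (c0 : 0 < c) (cE : forall A : set mR, measurable A ->
    (dx (@enorm R n @^-1` A) = \int[mu]_(r in A) (radial_density n c r)%:E)%E).

Lemma preimage_enorm_null (A : set mR) : measurable A -> mu A = 0%E ->
  dx (@enorm R n @^-1` A) = 0%E.
Proof.
move=> mA A0; rewrite cE//; apply: null_set_integral => //.
by apply: measurable_funTS; apply/measurable_EFinP; exact: measurable_radial_density.
Qed.

Lemma ae_enorm (P : R -> Prop) : {ae mu, forall r, 0 < r -> P r} ->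
  {ae dx, forall x, x != 0 -> P (enorm x)}.
Proof.
move=> [A [mA A0 PA]]; exists (@enorm R n @^-1` A); split.
- by rewrite -[X in measurable X]setTI; exact: measurable_enorm.
- exact: preimage_enorm_null.
- move=> x /= H; apply: PA => /= H2; apply: H => x0; apply: H2.
  by rewrite enorm_gt0.
Qed.

Lemma ae_enorm_neq (a : R) : {ae dx, forall x, enorm x != a}.
Proof.
exists (@enorm R n @^-1` [set a]); split.
- by rewrite -[X in measurable X]setTI; apply: measurable_enorm.
- by apply: preimage_enorm_null => //; exact: lebesgue_measure_set1.
- by move=> x /= /negP; rewrite negbK => /eqP.
Qed.

(** The density c r^(n-1) is positive for r > 0, so a measurable set of positive radii with null
    preimage is null. *)
Lemma ae_radial (P : R -> bool) : measurable_fun [set: mR] P ->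
  {ae dx, forall x, P (enorm x)} -> {ae mu, forall r, 0 < r -> P r}.
Proof.
move=> mP [E [mE E0 PE]].
pose A : set mR := [set r | (0 < r) && ~~ P r].
have mA : measurable A.
  have mb : measurable_fun [set: mR] (fun r : mR => (0 < r) && ~~ P r).
    apply: measurable_and; first exact: measurable_fun_ltr.
    exact: measurable_neg.
  have := mb measurableT [set true] I; rewrite setTI.
  by congr (measurable _); apply/seteqP; split => r.
have A0 : dx (@enorm R n @^-1` A) = 0%E.
  apply: (@subset_measure0 _ _ _ dx _ E) => //.
  - by rewrite -[X in measurable X]setTI; exact: measurable_enorm.
  - by move=> x /= /andP[_ /negP]; exact: PE.
have := A0; rewrite cE// => H.
have mw : measurable_fun A (EFin \o radial_density n c).
  by apply: measurable_funTS; apply/measurable_EFinP; exact: measurable_radial_density.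
have := (ae_eq_integral_abs mu mA mw).1.
under eq_integral => r _.
  rewrite gee0_abs; last by rewrite lee_fin radial_density_ge0// ltW.
  over.
move=> /(_ H); apply: ae_mono => r /= Hr r0; apply/negPn/negP => Pr.
have /Hr : A r by rewrite /A/= r0.
by case => /eqP; rewrite /radial_density r0 mulf_eq0 gt_eqF//= gt_eqF// exprn_gt0.
Qed.

Definition radial_densityN (N r : R) : R := if r < N then radial_density n c r else 0.

Lemma L1_radial_densityN N : L1 (radial_densityN N).
Proof.
apply: (@L1_bounded_itv _ _ 0 N `|c * N ^+ n.-1|).
- apply: measurable_fun_ifT => //; first exact: measurable_fun_ltr.
  exact: measurable_radial_density.
- move=> t; rewrite negb_and -!ltNge /radial_densityN /radial_density => /orP[t0|Nt].
    by rewrite [0 < t]ltNge (ltW t0)/=; case: ifP.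
  by rewrite ltNge (ltW Nt).
- move=> t /andP[t0 tN]; rewrite /radial_densityN /radial_density.
  case: ifP => _; last by rewrite normr0.
  case: ifP => _; last by rewrite normr0.
  rewrite !normrM ler_wpM2l// !normrX lerXn2r// ?nnegrE// ger0_norm//.
  by rewrite (le_trans tN)// ler_norm.
Qed.

Lemma polar_bounded (N : R) (k : R -> R) (C : R) : measurable_fun [set: mR] k ->
  (forall r, `|k r| <= C) ->
  \int[dx]_x ((if enorm x < N then 1 else 0) * k (enorm x)) =
  \int[mu]_r (radial_densityN N r * k r).
Proof.
move=> mk kC.
have mN : measurable_fun [set: 'rV[R]_n] (fun x => enorm x < N).
  by apply: measurable_fun_ltr => //; exact: measurable_enorm.
apply: ge0_radial_projection_bounded mk kC.
- apply: (@integrable_bounded_support _ _ _ dx _ (eball N) 1).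
  + exact: measurable_fun_ifT.
  + exact: measurable_eball.
  + exact: eball_fin.
  + move=> x; rewrite mul1r indicE; case: ifPn => h.
      by rewrite mem_set ?normr1// /eball/= ltW.
    by rewrite normr0.
- exact: L1_radial_densityN.
- by move=> x; case: ifP.
- by move=> r; rewrite /radial_densityN; case: ifP => // _; rewrite radial_density_ge0// ltW.
- move=> g g0 mg.
  pose g1 r : \bar R := (g r * (if r < N then 1 else 0)%:E)%E.
  have := @ge0_integral_polar _ _ c c0 cE g1 _ _.
  rewrite /g1 => -> //.
  + apply: eq_integral => r _; rewrite -muleA -EFinM /radial_densityN; case: ifP => _.
      by rewrite mul1r.
    by rewrite mul0r.
  + by move=> r; rewrite mule_ge0// lee_fin; case: ifP.
  + apply: emeasurable_funM => //; apply/measurable_EFinP; apply: measurable_fun_ifT => //.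
    exact: measurable_fun_ltr.
Qed.

Lemma polar_integrable (k : R -> R) : measurable_fun [set: mR] k ->
  L1 (fun r => k r * radial_density n c r) ->
  L1n (fun x => k (enorm x)) /\
  \int[dx]_x k (enorm x) = \int[mu]_r (k r * radial_density n c r).
Proof.
move=> mk ik.
have rd0 r : 0 <= radial_density n c r by rewrite radial_density_ge0// ltW.
have mke : measurable_fun [set: 'rV[R]_n] (fun x => k (enorm x)).
  exact: (measurableT_comp mk (@measurable_enorm R n)).
have P (g : R -> R) : measurable_fun [set: mR] g -> (forall r, 0 <= g r) ->
    (\int[dx]_x (g (enorm x))%:E = \int[mu]_r (g r * radial_density n c r)%:E)%E.
  move=> mg g0; have := @ge0_integral_polar _ _ c c0 cE (EFin \o g).
  by move=> /= ->//; [exact/measurable_EFinP].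
have ike : L1n (fun x => k (enorm x)).
  apply/integrableP; split; first exact/measurable_EFinP.
  have /integrableP[_] := ik; apply: le_lt_trans; rewrite le_eqVlt; apply/orP; left; apply/eqP.
  have := P (fun r => `|k r|) _ (fun r => normr_ge0 _) => /= ->.
    by apply: eq_integral => r _; rewrite /= normrM [`|radial_density _ _ _|]ger0_norm.
  exact: measurableT_comp.
split => //.
rewrite /Rintegral; congr fine; rewrite integralE [RHS]integralE.
have mkp := measurable_funrpos mk; have mkn := measurable_funrneg mk.
congr (_ - _)%E.
- transitivity (\int[dx]_x (k^\+ (enorm x))%:E)%E.
    by apply: eq_integral => x _; rewrite funeposE /funrpos EFin_max.
  rewrite P//.
  apply: eq_integral => r _; rewrite funeposE /funrpos -EFin_max.
  by rewrite maxr_pMl// mul0r.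
- transitivity (\int[dx]_x (k^\- (enorm x))%:E)%E.
    by apply: eq_integral => x _; rewrite funenegE /funrneg EFin_max.
  rewrite P//.
  apply: eq_integral => r _; rewrite funenegE /funrneg -EFinN -EFin_max -mulNr.
  by rewrite maxr_pMl// mul0r.
Qed.

End polar_coordinates.

Section partial_formulas.
Context {R : realType} {n : nat}.
Implicit Types (phi : 'rV[R]_n -> R) (h : R -> R) (x : 'rV[R]_n).

Lemma is_derive_sqnorm x i : is_derive x (basis R i) (@sqnorm R n) (2 * x 0 i).
Proof.
have -> : @sqnorm R n = \sum_(j < n) (fun y : 'rV[R]_n => y 0 j * y 0 j).
  by apply/funext => y; rewrite fct_sumE.
have d j : is_derive x (basis R i) (fun y : 'rV[R]_n => y 0 j * y 0 j)
    (x 0 j * basis R i 0 j + x 0 j * basis R i 0 j).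
  have d := is_derive_coord j x (basis R i).
  exact: (is_deriveM d d).
have D := is_derive_sum d.
apply: (is_derive_eq D).
rewrite (bigD1 i)//= big1 => [|j ji]; rewrite /basis mxE eqxx/=.
  by rewrite eqxx mulr1 addr0 -mulr2n mulr_natl.
by rewrite (negbTE ji) mulr0 addr0.
Qed.

Lemma partial_mul_radial phi h h' i x : smoothn phi ->
  (forall t, is_derive t (1:R) h (h' t)) ->
  partial i (fun y => phi y * h (sqnorm y)) x =
  partial i phi x * h (sqnorm x) + phi x * (2 * x 0 i * h' (sqnorm x)).
Proof.
move=> sphi dh.
have d1 : is_derive x (basis R i) phi (partial i phi x).
  by apply: derivableP; exact: smoothn_derivable.
have d2 := is_derive_comp1 (dh (sqnorm x)) (is_derive_sqnorm x i).
have [_] := is_deriveM d1 d2.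
rewrite /partial => ->; rewrite /GRing.scale/= addrC; congr (_ + _).
  by rewrite mulrC.
by congr (_ * _); rewrite mulrC.
Qed.

Lemma smoothn_radial h : smooth1 h -> smoothn (fun x : 'rV[R]_n => h (sqnorm x)).
Proof. by move=> sh; apply: smoothn_comp => //; exact: smoothn_sqnorm. Qed.

(** Summed over i, this is the divergence of the field x h(|x|^2). *)
Lemma partial_coord_radial h h' i x : smooth1 h ->
  (forall t, is_derive t (1:R) h (h' t)) ->
  partial i (fun y : 'rV[R]_n => y 0 i * h (sqnorm y)) x =
  h (sqnorm x) + 2 * x 0 i ^+ 2 * h' (sqnorm x).
Proof.
move=> sh dh; rewrite (partial_mul_radial i x (smoothn_coord i) dh).
have [_ d] := is_derive_coord i x (basis R i).
rewrite {1}/partial d /basis mxE !eqxx/= mul1r; congr (_ + _).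
by rewrite expr2; ring.
Qed.

End partial_formulas.

(** * Weak differentials of radial functions *)

Section radial_gradient.
Context (R : realType) (n : nat).
Local Notation mR := (measurableTypeR R).
Local Notation mu := (@lebesgue_measure R).
Local Notation dx := (@lebesgue_rv R n).
Local Notation L1 f := (mu.-integrable [set: mR] (EFin \o (f : R -> R))).
Local Notation L1n F := (dx.-integrable [set: 'rV[R]_n] (EFin \o (F : 'rV[R]_n -> R))).
Implicit Types x : 'rV[R]_n.

Lemma L1n_sum (I : Type) (s : seq I) (F : I -> 'rV[R]_n -> R) :
  (forall i, L1n (F i)) -> L1n (fun x => \sum_(i <- s) F i x) /\
  \int[dx]_x (\sum_(i <- s) F i x) = \sum_(i <- s) \int[dx]_x F i x.
Proof.
move=> iF; elim: s => [|i s [IH1 IH2]].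
  have -> : (fun x => \sum_(i <- [::]) F i x) = (fun=> 0).
    by apply/funext => x; rewrite big_nil.
  by rewrite big_nil /Rintegral integral0; split => //; exact: integrable0.
have -> : (fun x => \sum_(j <- i :: s) F j x) = (fun x => F i x + \sum_(j <- s) F j x).
  by apply/funext => x; rewrite big_cons.
rewrite big_cons -IH2 -RintegralD//; split => //.
exact: (integrableD measurableT (iF i) IH1).
Qed.

Lemma measurable_unit_dir i : measurable_fun [set: 'rV[R]_n] (fun x => unit_dir x 0 i : mR).
Proof.
under eq_fun do rewrite mxE.
apply: measurable_funM; last exact: measurable_coord.
have -> : (fun x : 'rV[R]_n => (enorm x)^-1) = (fun x => enorm x `^ (-1)).
  by apply/funext => x; rewrite powR_inv1// enorm_ge0.
apply: (measurableT_comp (f := fun t : mR => t `^ (-1) : mR)); last exact: measurable_enorm.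
exact: measurable_powR.
Qed.

Lemma unit_dir_le1 x i : `|unit_dir x 0 i| <= 1.
Proof.
rewrite mxE normrM normfV [`|enorm x|]ger0_norm ?enorm_ge0//.
have [->|x0] := eqVneq x 0; first by rewrite mxE normr0 mulr0.
by rewrite ler_pdivrMl ?enorm_gt0// mulr1 coord_le_enorm.
Qed.

Lemma unit_dir_enorm x i : unit_dir x 0 i * enorm x = x 0 i.
Proof.
have [->|x0] := eqVneq x 0; first by rewrite !mxE mulr0 mul0r.
by rewrite mxE mulrAC mulVf ?mul1r// enorm_eq0.
Qed.

Variables (c N M : R) (V : R -> R) (du : 'rV[R]_n -> 'rV[R]_n).
Hypotheses (n0 : (0 < n)%N) (N0 : 0 < N) (c0 : 0 < c)
  (cE : forall A : set mR, measurable A ->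
    (dx (@enorm R n @^-1` A) = \int[mu]_(r in A) (radial_density n c r)%:E)%E).
Hypotheses (mV : measurable_fun [set: mR] V) (VM : forall r, `|V r| <= M)
  (V0 : forall r, ~~ (0 < r < N) -> V r = 0).
Let G i x := if enorm x < N then du x 0 i else 0.
Hypotheses (mdu : forall i, measurable_fun [set: 'rV[R]_n] (fun x => du x 0 i : mR))
  (iG : forall i, L1n (G i))
  (weak : forall phi i, smoothn phi -> (forall x, N ^+ 2 < sqnorm x -> phi x = 0) ->
    \int[dx]_x (V (enorm x) * partial i phi x) = - \int[dx]_x (G i x * phi x)).

Let pN := radial_densityN n c N.

Let pNE r : 0 < r < N -> pN r = c * r ^+ n.-1.
Proof. by move=> /andP[r0 rN]; rewrite /pN /radial_densityN rN /radial_density r0. Qed.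

Let pN0 r : ~~ (0 < r < N) -> pN r = 0.
Proof.
rewrite negb_and -!leNgt /pN /radial_densityN /radial_density => /orP[r0|Nr].
  by rewrite [0 < r]ltNge r0/=; case: ifP.
by rewrite ltNge Nr.
Qed.

Let mh (h : R -> R) : smooth1 h -> measurable_fun [set: mR] (fun r : R => h (r ^+ 2) : mR).
Proof.
move=> sh; apply: (measurableT_comp (smooth1_measurable sh)).
exact: measurable_funX.
Qed.

Let bh (h : R -> R) : smooth1 h -> exists2 C, 0 <= C & forall r, 0 <= r <= N -> `|h (r ^+ 2)| <= C.
Proof.
move=> sh; have [C C0 HC] := smooth1_bounded 0 (N ^+ 2) sh.
exists C => // r /andP[r0 rN]; apply: HC.
by rewrite exprn_ge0//= lerXn2r// ?nnegrE// ltW.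
Qed.

Let ltle r : 0 < r < N -> 0 <= r <= N.
Proof. by move=> /andP[/ltW -> /ltW ->]. Qed.

Let sqe x : enorm x ^+ 2 = sqnorm x. Proof. exact: sqr_enorm. Qed.

Let GN i x : N <= enorm x -> G i x = 0.
Proof. by rewrite /G leNgt => /negbTE ->. Qed.

Let M0 : 0 <= M. Proof. by rewrite (le_trans _ (VM 0)). Qed.

Let sumE (h h' : R -> R) x : \sum_(i < n) (h (sqnorm x) + 2 * x 0 i ^+ 2 * h' (sqnorm x)) =
  n%:R * h (enorm x ^+ 2) + 2 * enorm x ^+ 2 * h' (enorm x ^+ 2).
Proof.
rewrite big_split/= sumr_const card_ord sqe; congr (_ + _); first by rewrite mulr_natl.
by rewrite -mulr_suml -mulr_sumr; congr (_ * _ * _).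
Qed.

(** V is the truncated profile, m the integral over spheres of the radial component of du, and [pN]
    is c r^(n-1) on ]0, N[. Testing with the field x h(|x|^2) gives the weak form of (r V pN)' = n V
    pN + r m, which the du Bois-Reymond lemma integrates. *)
Lemma radial_component : exists m : R -> R,
  [/\ L1 m, forall r, ~~ (0 < r < N) -> m r = 0,
    forall (k : R -> R) (C : R), measurable_fun [set: mR] k -> (forall r, 0 < r < N -> `|k r| <= C) ->
      \int[dx]_x ((\sum_(i < n) (G i x * unit_dir x 0 i)) * k (enorm x)) = \int[mu]_r (m r * k r) &
    {ae mu, forall r, 0 < r < N ->
      V r * pN r * r = prim (fun s => n%:R * (V s * pN s) + s * m s) r}].
Proof.
have iGe i : L1n (fun x => G i x * unit_dir x 0 i).
  apply: (L1n_bounded_mul (C := 1)) => //; first exact: measurable_unit_dir.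
  by move=> x; rewrite normrM mul1r ler_piMr// unit_dir_le1.
have [iF _] := L1n_sum (index_enum 'I_n) iGe.
have FN x : N <= enorm x -> \sum_(i < n) G i x * unit_dir x 0 i = 0.
  by move=> Nx; rewrite big1// => i _; rewrite GN// mul0r.
have [m [im m0 mE]] := radial_projection n0 iF FN.
exists m; split => //.
  by move=> k C mk kC; have [_ _ <-] := mE k C mk kC.
have iVp : L1 (fun s => V s * pN s).
  have := L1_bounded_mul (L1_radial_densityN n c N) mV VM.
  by congr (mu.-integrable _ _); apply/funext => s /=; rewrite mulrC.
have ism : L1 (fun s => s * m s).
  have h : L1 (fun s => m s * (if 0 < s < N then s else 0)).
    apply: (@L1_bounded_mul _ _ _ N) => //.
      apply: measurable_fun_ifT => //.
      by apply: measurable_and; exact: measurable_fun_ltr.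
    move=> s; case: ifP => [/andP[s0 sN]|_]; last by rewrite normr0 ltW.
    by rewrite gtr0_norm// ltW.
  move: h; congr (mu.-integrable _ _); apply/funext => s /=; congr EFin.
  by case: ifPn => h; [rewrite mulrC|rewrite m0// !(mulr0, mul0r)].
have if1 : L1 (fun s => n%:R * (V s * pN s) + s * m s) by apply: L1D => //; exact: L1Z.
have ig1 : L1 (fun s => V s * pN s * s).
  have h : L1 (fun s => V s * pN s * (if 0 < s < N then s else 0)).
    apply: (@L1_bounded_mul _ _ _ N) => //.
      apply: measurable_fun_ifT => //.
      by apply: measurable_and; exact: measurable_fun_ltr.
    move=> s; case: ifP => [/andP[s0 sN]|_]; last by rewrite normr0 ltW.
    by rewrite gtr0_norm// ltW.
  move: h; congr (mu.-integrable _ _); apply/funext => s /=; congr EFin.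
  by case: ifPn => // h; rewrite V0// !mul0r.
apply: du_bois_reymond => //.
- by move=> r h; rewrite V0// m0// mul0r !mulr0 addr0.
- by move=> r h; rewrite V0// !mul0r.
move=> h h' sh sh' dh hN.
have [C C0 hC] := bh sh; have [C' C0' hC'] := bh sh'.
have mhh := mh sh; have mhh' := mh sh'.
pose k (r : R) := n%:R * h (r ^+ 2) + 2 * r ^+ 2 * h' (r ^+ 2).
have mk : measurable_fun [set: mR] k.
  apply: measurable_funD; first exact: measurable_funM.
  by apply: measurable_funM => //; apply: measurable_funM => //; exact: measurable_funX.
have kC r : `|V r * k r| <= M * (n%:R * C + 2 * N ^+ 2 * C').
  have [h1|h1] := boolP (0 < r < N); last first.
    by rewrite V0// mul0r normr0 mulr_ge0// addr_ge0// !mulr_ge0// ?exprn_ge0// ltW.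
  rewrite normrM ler_pM// (le_trans (ler_normD _ _))// !normrM.
  move: (h1) => /andP[r0 rN].
  rewrite [`|n%:R|]ger0_norm// [`|2|]ger0_norm// [`|r|]gtr0_norm// -expr2.
  rewrite lerD// ?ler_wpM2l// ?hC ?ltle// ler_pM// ?mulr_ge0 ?exprn_ge0 ?(ltW r0)//.
    by rewrite ler_wpM2l// lerXn2r// ?nnegrE ltW.
  by rewrite hC'// ltle.
have mVk : measurable_fun [set: mR] (fun r => V r * k r) by exact: measurable_funM.
have iV i : L1n (fun x => V (enorm x) * partial i (fun y : 'rV[R]_n => y 0 i * h (sqnorm y)) x).
  have sphi : smoothn (fun y : 'rV[R]_n => y 0 i * h (sqnorm y)).
    by apply: smoothnM; [exact: smoothn_coord|exact: smoothn_radial].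
  have supp y : N ^+ 2 < sqnorm y -> y 0 i * h (sqnorm y) = 0.
    by move=> /ltW/hN ->; rewrite mulr0.
  have ip := smoothn_supp_integrable (smoothn_partial i sphi) (partial_supp i supp).
  have mVe : measurable_fun [set: 'rV[R]_n] (fun x => V (enorm x)).
    exact: (measurableT_comp mV (@measurable_enorm R n)).
  have i1 : L1n (fun x => partial i (fun y : 'rV[R]_n => y 0 i * h (sqnorm y)) x * V (enorm x)).
    by apply: (L1n_bounded_mul (C := M)) => // x; rewrite normrM mulrC ler_wpM2r.
  by move: i1; congr (dx.-integrable _ _); apply/funext => x /=; rewrite mulrC.
have E1 : \int[dx]_x (V (enorm x) * k (enorm x)) =
    - \int[dx]_x ((\sum_(i < n) (G i x * unit_dir x 0 i)) * (enorm x * h (enorm x ^+ 2))).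
  have [_ S1] := L1n_sum (index_enum 'I_n) iV.
  transitivity (\sum_(i < n) \int[dx]_x (V (enorm x) * partial i (fun y : 'rV[R]_n => y 0 i * h (sqnorm y)) x)).
    rewrite -S1; apply: eq_Rintegral => x _; rewrite -mulr_sumr; congr (_ * _).
    by rewrite /k -sumE; apply: eq_bigr => i _; rewrite (partial_coord_radial i x sh dh).
  have iGx i : L1n (fun x => G i x * (x 0 i * h (sqnorm x))).
    apply: (L1n_bounded_mul (C := N * C)) => //.
      apply: smoothn_measurable; apply: smoothnM; first exact: smoothn_coord.
      exact: smoothn_radial.
    move=> x; have [xN|Nx] := ltP (enorm x) N; last by rewrite GN// mul0r normr0 mulr0.
    rewrite normrM mulrC ler_wpM2r// normrM ler_pM//.
      by rewrite (le_trans (coord_le_enorm _ _))// ltW.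
    by rewrite -sqe hC// enorm_ge0 ltW.
  have [_ S2] := L1n_sum (index_enum 'I_n) iGx.
  transitivity (\sum_(i < n) - \int[dx]_x (G i x * (x 0 i * h (sqnorm x)))).
    apply: eq_bigr => i _; rewrite weak//.
      by apply: smoothnM; [exact: smoothn_coord|exact: smoothn_radial].
    by move=> x /ltW/hN ->; rewrite mulr0.
  rewrite sumrN -S2; congr (- _); apply: eq_Rintegral => x _.
  rewrite mulr_suml; apply: eq_bigr => i _.
  by rewrite -mulrA; congr (_ * _); rewrite mulrA unit_dir_enorm sqe.
have mrh : measurable_fun [set: mR] (fun r : mR => r * h (r ^+ 2)) by exact: measurable_funM.
have rhC r : 0 < r < N -> `|r * h (r ^+ 2)| <= N * C.
  move=> hr; rewrite normrM ler_pM//; last by rewrite hC// ltle.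
  by case/andP: hr => r0 rN; rewrite gtr0_norm// ltW.
have [_ L2 E2] := mE _ _ mrh rhC.
have E3 := polar_bounded c0 cE N mVk kC.
have L3 : L1 (fun r => pN r * (V r * k r)).
  exact: (L1_bounded_mul (L1_radial_densityN n c N) mVk kC).
transitivity (\int[mu]_r (pN r * (V r * k r)) + \int[mu]_r (m r * (r * h (r ^+ 2)))).
  rewrite -RintegralD//; apply: eq_Rintegral => r _; rewrite /k; ring.
rewrite -E2 -E3 -[X in _ + X]opprK -E1; apply/eqP; rewrite subr_eq0; apply/eqP.
apply: eq_Rintegral => x _; case: ifPn => xN; first by rewrite mul1r.
by rewrite V0 ?mul0r// negb_and xN orbT.
Qed.

(** The square of [prim S] is the primitive of 2 S [prim S], which is null almost everywhere; this
    passes from almost every r to every r without a continuity argument. *)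
Lemma prim_ae_eq0 (S : R -> R) : L1 S -> (forall r, ~~ (0 < r < N) -> S r = 0) ->
  {ae mu, forall r, 0 < r < N -> prim S r = 0} -> {ae mu, forall r, S r = 0}.
Proof.
move=> iS S0 pS; apply: prim_eq0 => // r.
have [i1 i2 E] := prim_product r iS iS.
have : prim S r * prim S r = 0.
  rewrite E (@eq_prim _ _ (fun=> 0)) ?primE.
  - transitivity (\int[mu]_s (0 : R)); last by rewrite /Rintegral integral0.
    by apply: eq_Rintegral => s _; case: ifP.
  - apply: ae_mono pS => s h; case: (boolP (0 < s < N)) => hs.
      by rewrite h// mulr0 mul0r addr0.
    by rewrite S0// mulr0 mul0r addr0.
  - exact: L1D.
  - exact: integrable0.
by move=> /eqP; rewrite mulf_eq0 orbb => /eqP.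
Qed.

Lemma L1_mulV (f : R -> R) : L1 f -> L1 (fun r => f r * V r).
Proof. by move=> fi; exact: L1_bounded_mul mV VM. Qed.

(** B and D are the integrals over spheres of phi x_i/|x| and of phi du_i, and m / [pN] is the
    candidate W for the derivative of V. The last conclusion, D = W B, says that phi cannot tell
    du_i from W x_i/|x| on almost every sphere. *)
Lemma radial_component_test (m : R -> R) (phi : 'rV[R]_n -> R) (rho : R) i :
  L1 m -> (forall r, ~~ (0 < r < N) -> m r = 0) ->
  {ae mu, forall r, 0 < r < N ->
      V r * pN r * r = prim (fun s => n%:R * (V s * pN s) + s * m s) r} ->
  smoothn phi -> rho < N ^+ 2 -> (forall x, rho < sqnorm x -> phi x = 0) ->
  exists B D : R -> R, [/\ L1 B, L1 D, forall r, ~~ (0 < r < N) -> D r = 0,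
    forall (k : R -> R) (C : R), measurable_fun [set: mR] k -> (forall r, `|k r| <= C) ->
      \int[dx]_x (phi x * unit_dir x 0 i * k (enorm x)) = \int[mu]_r (B r * k r) /\
      \int[dx]_x (G i x * phi x * k (enorm x)) = \int[mu]_r (D r * k r) &
    {ae mu, forall r, B r * m r = pN r * D r}].
Proof.
move=> im m0 Em sphi rhoN supp.
have out x : N <= enorm x -> rho < sqnorm x.
  by move=> Nx; rewrite (lt_le_trans rhoN)// -sqe lerXn2r// ?nnegrE ?enorm_ge0// ltW.
have suppN x : N <= enorm x -> phi x = 0 by move=> /out/supp.
have suppP x : N <= enorm x -> partial i phi x = 0.
  by move=> /out; exact: (partial_supp i supp).
have iphi := smoothn_supp_integrable sphi supp.
have ipart := smoothn_supp_integrable (smoothn_partial i sphi) (partial_supp i supp).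
have iB : L1n (fun x => phi x * unit_dir x 0 i).
  apply: (L1n_bounded_mul (C := 1)) => //; first exact: measurable_unit_dir.
  by move=> x; rewrite normrM mul1r ler_piMr// unit_dir_le1.
have iD : L1n (fun x => G i x * phi x).
  have [C C0 HC] := smoothn_supp_bound sphi supp.
  apply: (L1n_bounded_mul (C := C)) => //; first exact: smoothn_measurable.
  move=> x; rewrite normrM mulrC ler_wpM2r// (le_trans (HC x))//.
  by rewrite indicE; case: (_ \in _); rewrite ?mulr1 ?mulr0.
have [A [LA A0 AE]] := radial_projection n0 ipart suppP.
have [B [LB B0 BE]] := radial_projection n0 iB
  (fun x Nx => etrans (congr1 (fun t => t * unit_dir x 0 i) (suppN x Nx)) (mul0r _)).
have [D [LD D0 DE]] := radial_projection n0 iD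
  (fun x Nx => etrans (congr1 (fun t => t * phi x) (GN i Nx)) (mul0r _)).
exists B, D; split => //.
  move=> k C mk kC; split.
    by have [_ _ ->] := BE k C mk (fun r _ => kC r).
  by have [_ _ ->] := DE k C mk (fun r _ => kC r).
have mm2 h' : smooth1 h' -> measurable_fun [set: mR] (fun r : mR => 2 * r * h' (r ^+ 2)).
  by move=> sh'; apply: measurable_funM; [exact: measurable_funM|exact: mh].
have bb2 (h' : R -> R) C' r : 0 <= C' -> (forall r, 0 <= r <= N -> `|h' (r ^+ 2)| <= C') ->
    0 < r < N -> `|2 * r * h' (r ^+ 2)| <= 2 * N * C'.
  move=> C0' hC' hr; rewrite !normrM [`|2|]ger0_norm//; move: (hr) => /andP[r0 rN].
  rewrite [`|r|]gtr0_norm// ler_pM// ?mulr_ge0 ?(ltW r0)//.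
    by rewrite ler_wpM2l// ltW.
  by rewrite hC'// ltle.
have test h h' x : smooth1 h -> (forall t, is_derive t (1:R) h (h' t)) ->
    partial i (fun y => phi y * h (sqnorm y)) x = partial i phi x * h (enorm x ^+ 2) +
      phi x * unit_dir x 0 i * (2 * enorm x * h' (enorm x ^+ 2)).
  move=> sh dh; rewrite (partial_mul_radial i x sphi dh) sqe; congr (_ + _).
  by rewrite -(unit_dir_enorm x i); ring.
have sphih h : smooth1 h -> smoothn (fun y => phi y * h (sqnorm y)).
  by move=> sh; apply: smoothnM => //; exact: smoothn_radial.
have supph h x : rho < sqnorm x -> phi x * h (sqnorm x) = 0.
  by move=> /supp ->; rewrite mul0r.
(* The partial derivative of phi h(|x|^2) has integral 0, so B is the primitive of A, the integral
   over spheres of the partial derivative of phi. *)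
have BA : {ae mu, forall r, 0 < r < N -> B r = prim A r}.
  apply: du_bois_reymond => // h h' sh sh' dh _.
  have [C C0 hC] := bh sh; have [C' C0' hC'] := bh sh'.
  have [X1 X2 X3] := AE _ C (mh sh) (fun r hr => hC r (ltle hr)).
  have [Y1 Y2 Y3] := BE _ _ (mm2 _ sh') (fun r => bb2 h' C' r C0' hC').
  rewrite RintegralD// -X3 -Y3 -RintegralD//.
  transitivity (\int[dx]_x partial i (fun y => phi y * h (sqnorm y)) x).
    by apply: eq_Rintegral => x _; rewrite (test h h').
  by rewrite /Rintegral (integral_partial i (sphih h sh) (supph h)).
(* The same test functions in the definition of the weak differential: formally, (B V)' = A V +
   D. *)
have BV : {ae mu, forall r, 0 < r < N -> B r * V r = prim (fun s => A s * V s + D s) r}.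
  apply: du_bois_reymond.
  - by apply: L1D => //; exact: L1_mulV.
  - exact: L1_mulV.
  - by move=> r hr; rewrite A0// D0// mul0r addr0.
  - by move=> r hr; rewrite B0// mul0r.
  move=> h h' sh sh' dh _.
  have [C C0 hC] := bh sh; have [C' C0' hC'] := bh sh'.
  have mVh : measurable_fun [set: mR] (fun r : mR => V r * h (r ^+ 2)).
    by apply: measurable_funM => //; exact: mh.
  have Vh r : 0 < r < N -> `|V r * h (r ^+ 2)| <= M * C.
    by move=> hr; rewrite normrM ler_pM// hC// ltle.
  have mVh' : measurable_fun [set: mR] (fun r : mR => V r * (2 * r * h' (r ^+ 2))).
    by apply: measurable_funM => //; exact: mm2.
  have Vh' r : 0 < r < N -> `|V r * (2 * r * h' (r ^+ 2))| <= M * (2 * N * C').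
    by move=> hr; rewrite normrM ler_pM// bb2.
  have [X1 X2 X3] := AE _ _ mVh Vh.
  have [Y1 Y2 Y3] := BE _ _ mVh' Vh'.
  have [Z1 Z2 Z3] := DE _ C (mh sh) (fun r hr => hC r (ltle hr)).
  transitivity (\int[mu]_r (A r * (V r * h (r ^+ 2))) + \int[mu]_r (D r * h (r ^+ 2)) +
      \int[mu]_r (B r * (V r * (2 * r * h' (r ^+ 2))))).
    rewrite -RintegralD// -RintegralD//; last exact: L1D.
    by apply: eq_Rintegral => r _; rewrite mulrDl !mulrA.
  rewrite -X3 -Y3 -Z3 addrAC -RintegralD//.
  have W := weak i (sphih h sh) (fun x h1 => supph h x (lt_trans rhoN h1)).
  transitivity (\int[dx]_x (V (enorm x) * partial i (fun y => phi y * h (sqnorm y)) x) +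
      \int[dx]_x (G i x * (phi x * h (sqnorm x)))); last by rewrite W addNr.
  congr (_ + _).
    by apply: eq_Rintegral => x _; rewrite (test h h')//; ring.
  by apply: eq_Rintegral => x _; rewrite sqe mulrA.
have ipN : L1 pN by exact: L1_radial_densityN.
have cutL1 (f : R -> R) : L1 f -> (forall r, ~~ (0 < r < N) -> f r = 0) -> L1 (fun s => s * f s).
  move=> fi f0.
  have h : L1 (fun s => f s * (if 0 < s < N then s else 0)).
    apply: (@L1_bounded_mul _ _ _ N) => //.
      apply: measurable_fun_ifT => //.
      by apply: measurable_and; exact: measurable_fun_ltr.
    move=> s; case: ifP => [/andP[s0 sN]|_]; last by rewrite normr0 ltW.
    by rewrite gtr0_norm// ltW.
  move: h; congr (mu.-integrable _ _); apply/funext => s /=; congr EFin.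
  by case: ifPn => h; [rewrite mulrC|rewrite f0// !(mulr0, mul0r)].
pose f1 s := n%:R * (V s * pN s) + s * m s.
have if1 : L1 f1.
  apply: L1D; last exact: cutL1.
  apply: L1Z; have := L1_mulV ipN; congr (mu.-integrable _ _).
  by apply/funext => s /=; rewrite mulrC.
pose f2 s := A s * V s + D s.
have if2 : L1 f2 by apply: L1D => //; exact: L1_mulV.
(* Its primitive on ]0, N[ is r [pN], a multiple of r^n. *)
pose f3 s := n%:R * pN s.
have if3 : L1 f3 by exact: L1Z.
have primf3 r : 0 < r < N -> prim f3 r = pN r * r.
  move=> hr; move: (hr) => /andP[r0 rN].
  have := @integral_pow R n n0 (c / n%:R) r _ r0.
  rewrite divr_ge0 ?(ltW c0)// => /(_ isT).
  rewrite [n%:R * _]mulrC divfK ?pnatr_eq0 -?lt0n// => E.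
  have -> : prim f3 r = n%:R * prim pN r by rewrite /prim RintegralZl//; exact: L1S.
  have -> : prim pN r = c / n%:R * r ^+ n.
    rewrite /prim /Rintegral -[RHS]/(fine (c / n%:R * r ^+ n)%:E) -E; congr fine.
    apply: eq_integral => s; rewrite inE/= in_itv/= => sr.
    by rewrite /pN /radial_densityN (le_lt_trans sr rN).
  rewrite mulrA mulrCA mulfV ?pnatr_eq0 -?lt0n// mulr1 pNE// -mulrA -exprSr prednK//.
(* The derivative, by the product rule, of B (r V pN) - (r pN) (B V) = 0, in which each of the four
   factors is a primitive. After cancellation it is r (B m - pN D); V itself is never
   differentiated. *)
pose S s := (A s * prim f1 s + prim A s * f1 s) - (f3 s * prim f2 s + prim f3 s * f2 s).
have iS : L1 S.
  have [h1 h2 _] := prim_product 0 LA if1; have [h3 h4 _] := prim_product 0 if3 if2.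
  by apply: L1B; apply: L1D.
have S0 r : ~~ (0 < r < N) -> S r = 0.
  by move=> hr; rewrite /S /f1 /f2 /f3 A0// D0// pN0// V0// m0// !(mul0r, mulr0, addr0, subr0).
have pS r : prim S r = prim A r * prim f1 r - prim f3 r * prim f2 r.
  have [h1 h2 ->] := prim_product r LA if1; have [h3 h4 ->] := prim_product r if3 if2.
  by rewrite /prim -RintegralB//; apply: L1S => //; exact: L1D.
have S_ae : {ae mu, forall r, S r = 0}.
  apply: prim_ae_eq0 => //.
  have X := ae_mono2 (fun r h1 h2 => conj h1 h2) BA BV.
  apply: (ae_mono2 _ X Em) => r [h1 h2] h3 hr.
  by rewrite pS -h1// -h3// -h2// primf3//; ring.
have X := ae_mono2 (fun r h1 h2 => conj h1 h2) BA BV.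
have Y := ae_mono2 (fun r h1 h2 => conj h1 h2) Em S_ae.
apply: (ae_mono2 _ X Y) => r [h1 h2] [h3 h4].
have [hr|hr] := boolP (0 < r < N); last by rewrite m0// pN0// mulr0 mul0r.
have r0 : r != 0 by case/andP: hr => r0 _; rewrite gt_eqF.
move: h4; rewrite /S -h1// -h3// -h2// primf3// /f1 /f2 /f3 => E.
apply: (mulIf r0); apply/eqP; rewrite -subr_eq0 -E; apply/eqP; ring.
Qed.

Lemma ae_forall_ord (P : 'I_n -> 'rV[R]_n -> Prop) :
  (forall i, {ae dx, forall x, P i x}) -> {ae dx, forall x, forall i, P i x}.
Proof.
move=> H.
have : {ae dx, forall x, forall k : nat, forall i : 'I_n, i = k :> nat -> P i x}.
  apply: ae_foralln => k; have [kn|nk] := ltnP k n.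
    apply: ae_mono (H (Ordinal kn)) => x Px i ik.
    by have -> : i = Ordinal kn by exact: val_inj.
  by apply: aeW => x i ik; move: (ltn_ord i); rewrite ik ltnNge nk.
by apply: ae_mono => x Hx i; exact: (Hx i i erefl).
Qed.

(** The fundamental lemma applied to du_i - W x_i/|x|, made integrable by two cut-offs: |W| <= j,
    and |x|^2 < rho with rho < N^2, which keeps the tests away from the boundary of the ball. *)
Lemma radial_gradient : exists W : R -> R,
  [/\ measurable_fun [set: mR] W,
    L1 (fun s => n%:R * (V s * pN s) + s * (pN s * W s)),
    {ae mu, forall r, 0 < r < N ->
      V r * pN r * r = prim (fun s => n%:R * (V s * pN s) + s * (pN s * W s)) r} &
    forall rho, rho < N ^+ 2 ->
      {ae dx, forall x, sqnorm x < rho -> forall i, du x 0 i = W (enorm x) * unit_dir x 0 i}].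
Proof.
have [m [im m0 _ Em]] := radial_component.
have mm := L1_measurable im.
have ipN : L1 pN by exact: L1_radial_densityN.
have mpN := L1_measurable ipN.
(* Division by [pN], written as a power for measurability; where [pN] vanishes, so does m. *)
pose W r := m r * pN r `^ (-1).
have pNge0 r : 0 <= pN r.
  by rewrite /pN /radial_densityN; case: ifP => // _; rewrite radial_density_ge0// ltW.
have mW : measurable_fun [set: mR] W.
  apply: measurable_funM => //.
  by apply: (measurableT_comp (f := fun t : mR => t `^ (-1) : mR)).
have pNgt0 r : 0 < r < N -> 0 < pN r.
  by move=> hr; rewrite pNE// mulr_gt0// exprn_gt0//; case/andP: hr.
have WE r : pN r * W r = m r.
  have [hr|hr] := boolP (0 < r < N); last by rewrite pN0// m0// mul0r.
  by rewrite /W powR_inv1// mulrC divfK// gt_eqF// pNgt0.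
have fE : (fun s => n%:R * (V s * pN s) + s * (pN s * W s)) =
    (fun s => n%:R * (V s * pN s) + s * m s).
  by apply/funext => s; rewrite WE.
have iVp : L1 (fun s => V s * pN s).
  by have := L1_mulV ipN; congr (mu.-integrable _ _); apply/funext => s /=; rewrite mulrC.
have ism : L1 (fun s => s * m s).
  have h : L1 (fun s => m s * (if 0 < s < N then s else 0)).
    apply: (@L1_bounded_mul _ _ _ N) => //.
      apply: measurable_fun_ifT => //.
      by apply: measurable_and; exact: measurable_fun_ltr.
    move=> s; case: ifP => [/andP[s0 sN]|_]; last by rewrite normr0 ltW.
    by rewrite gtr0_norm// ltW.
  move: h; congr (mu.-integrable _ _); apply/funext => s /=; congr EFin.
  by case: ifPn => h; [rewrite mulrC|rewrite m0// !(mulr0, mul0r)].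
exists W; split => //; rewrite ?fE//.
  by apply: L1D => //; exact: L1Z.
move=> rho rhoN.
pose k (j : nat) (r : R) : R := if `|W r| <= j%:R then 1 else 0.
have mk j : measurable_fun [set: mR] (k j).
  apply: measurable_fun_ifT => //; apply: measurable_fun_ler => //.
  exact: measurableT_comp.
have k1 j r : `|k j r| <= 1 by rewrite /k; case: ifP; rewrite ?normr1 ?normr0.
have mWk j : measurable_fun [set: mR] (fun r => W r * k j r) by exact: measurable_funM.
have Wk j r : `|W r * k j r| <= j%:R.
  by rewrite /k; case: ifP => h; rewrite ?mulr1// mulr0 normr0.
pose chi (x : 'rV[R]_n) := flat_exp 0 (rho + (- sqnorm x)).
have schi : smoothn chi.
  apply: (@smoothn_comp _ _ (fun t => flat_exp 0 (rho + (- t))) (@sqnorm R n)).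
    apply: smooth1_flat; apply: smooth1D; first exact: smooth1_cst.
    have := smooth1M (smooth1_cst (-1)) (@smooth1_id R).
    by under eq_fun do rewrite mulN1r.
  exact: smoothn_sqnorm.
have chi0 x : rho < sqnorm x -> chi x = 0.
  by move=> h; rewrite /chi flat_exp_le0// subr_le0 ltW.
have chi1 x : `|chi x| <= 1 by rewrite ger0_norm ?flat_exp_ge0// flat_exp0_le1.
have mchi := smoothn_measurable schi.
have mke j : measurable_fun [set: 'rV[R]_n] (fun x => k j (enorm x)).
  exact: (measurableT_comp (mk j) (@measurable_enorm R n)).
have mWke j : measurable_fun [set: 'rV[R]_n] (fun x => W (enorm x) * k j (enorm x)).
  exact: (measurableT_comp (mWk j) (@measurable_enorm R n)).
have ichi := smoothn_supp_integrable schi chi0.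
pose F i j x := G i x * (k j (enorm x) * chi x) -
  chi x * (W (enorm x) * k j (enorm x) * unit_dir x 0 i).
have iF1 i j : L1n (fun x => G i x * (k j (enorm x) * chi x)).
  apply: (L1n_bounded_mul (C := 1)) => //; first exact: measurable_funM.
  by move=> x; rewrite mul1r normrM ler_piMr// normrM mulr_ile1.
have iF2 i j : L1n (fun x => chi x * (W (enorm x) * k j (enorm x) * unit_dir x 0 i)).
  apply: (L1n_bounded_mul (C := j%:R)) => //.
    by apply: measurable_funM => //; exact: measurable_unit_dir.
  move=> x; rewrite normrM mulrC ler_wpM2r// normrM -[leRHS]mulr1 ler_pM//.
  exact: unit_dir_le1.
have F0 i j : {ae dx, forall x, F i j x = 0}.
  apply: fundamental_lemma; first exact: (integrableB measurableT (iF1 i j) (iF2 i j)).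
  move=> w sw w01.
  have w1 x : `|w x| <= 1 by have /andP[h1 h2] := w01 x; rewrite ger0_norm.
  have mw := smoothn_measurable sw.
  have sphi : smoothn (fun x => chi x * w x) by exact: smoothnM.
  have phi0 x : rho < sqnorm x -> chi x * w x = 0 by move=> /chi0 ->; rewrite mul0r.
  have [B [D [LB LD D0 BD E]]] := radial_component_test i im m0 Em sphi rhoN phi0.
  have [_ E1] := BD _ _ (mk j) (k1 j).
  have [E2 _] := BD _ _ (mWk j) (Wk j).
  have i1 : L1n (fun x => G i x * (k j (enorm x) * chi x) * w x).
    apply: (L1n_bounded_mul (C := 1)) => // x; by rewrite mul1r normrM ler_piMr.
  have i2 : L1n (fun x => chi x * (W (enorm x) * k j (enorm x) * unit_dir x 0 i) * w x).
    apply: (L1n_bounded_mul (C := 1)) => // x; by rewrite mul1r normrM ler_piMr.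
  have i3 := integrableB measurableT i1 i2.
  have -> : (\int[dx]_x (F i j x * w x)%:E = (\int[dx]_x (F i j x * w x))%:E)%E.
    rewrite /Rintegral fineK//; apply: (integrable_fin_num measurableT).
    by move: i3; congr (dx.-integrable _ _); apply/funext => x /=; rewrite -EFinB -mulrBl.
  congr EFin.
  transitivity (\int[dx]_x (G i x * (k j (enorm x) * chi x) * w x) -
     \int[dx]_x (chi x * (W (enorm x) * k j (enorm x) * unit_dir x 0 i) * w x)).
    by rewrite -RintegralB//; apply: eq_Rintegral => x _; rewrite -mulrBl.
  apply/eqP; rewrite subr_eq0; apply/eqP.
  transitivity (\int[dx]_x (G i x * (chi x * w x) * k j (enorm x))).
    by apply: eq_Rintegral => x _; ring.
  rewrite E1; transitivity (\int[mu]_r (B r * (W r * k j r))); last first.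
    by rewrite -E2; apply: eq_Rintegral => x _; ring.
  have LDk : L1 (fun r => D r * k j r) by exact: L1_bounded_mul (k1 j).
  have LBk : L1 (fun r => B r * (W r * k j r)) by exact: L1_bounded_mul (Wk j).
  rewrite /Rintegral; congr fine; apply: ae_eq_integral => //.
  - exact: measurable_int LDk.
  - exact: measurable_int LBk.
  - apply: ae_mono E => r /= Er _; congr EFin; rewrite mulrA; congr (_ * _).
    have [hr|hr] := boolP (0 < r < N); last by rewrite D0// /W m0// mul0r mulr0.
    have p0 : pN r != 0 by rewrite gt_eqF// pNgt0.
    by apply: (mulfI p0); rewrite -Er -WE; ring.
have F0' : {ae dx, forall x, forall i (j : nat), F i j x = 0}.
  by apply: ae_forall_ord => i; apply: ae_foralln => j; exact: F0.
apply: ae_mono F0' => x Fx xrho i.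
(* For a fixed x, the truncation |W| <= j is inactive as soon as j exceeds |W(|x|)|. *)
pose j := (Num.truncn `|W (enorm x)|).+1.
have kj : k j (enorm x) = 1 by rewrite /k ifT// ltW// truncnS_gt.
have := Fx i j; rewrite /F kj mul1r mulr1 mulrC -mulrBr => /eqP.
have chi_gt0 : 0 < chi x by rewrite flat_exp_gt0 subr_gt0.
rewrite mulf_eq0 gt_eqF//= subr_eq0 => /eqP <-.
rewrite /G ifT// ltNge; apply/negP => Nx.
have : N ^+ 2 <= sqnorm x by rewrite -sqe lerXn2r// ?nnegrE ?enorm_ge0// ltW.
by rewrite leNgt (lt_trans xrho rhoN).
Qed.

End radial_gradient.

(** * The profile equation *)

Section half_line.
Context {R : realType}.
Local Notation mR := (measurableTypeR R).
Local Notation mu := (@lebesgue_measure R).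
Implicit Types f g F : R -> R.

Lemma is_derive_continuous f (l x : R) : is_derive x (1:R) f l -> {for x, continuous f}.
Proof. by move=> d; apply/differentiable_continuous/derivable1_diffP. Qed.

Lemma is_derive_near f g (l x : R) : (\forall y \near x, f y = g y) ->
  is_derive x (1:R) f l -> is_derive x (1:R) g l.
Proof.
move=> fg [d1 d2]; split.
  by apply: near_eq_derivable d1 => //; rewrite oner_eq0.
by rewrite -d2; apply/esym/near_eq_derive => //; rewrite oner_eq0.
Qed.

Lemma is_derive_right f (l x : R) : is_derive x (1:R) f l ->
  h^-1 * (f (x + h) - f x) @[h --> (0:R)^'+] --> l.
Proof.
move=> [d1 <-]; rewrite /derive; apply: cvg_trans; last first.
  exact: (cvg_dnbhs_at_right d1).
rewrite (_ : (fun h => h^-1 * _) = (fun h : R => h^-1 *: ((f \o shift x) (h *: 1) - f x)))//.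
by apply/funext => h; rewrite /GRing.scale/= mulr1 [h + x]addrC.
Qed.

Lemma nondecreasing_gt0 F (F' : R -> R) (c : R) :
  (forall r, c < r -> is_derive r (1:R) F (F' r)) -> (forall r, c < r -> 0 <= F' r) ->
  forall a b, c < a -> a <= b -> F a <= F b.
Proof.
move=> dF F'0 a b ca ab; have ca' r : r \in `[a, b] -> c < r.
  by rewrite in_itv/= => /andP[ar _]; exact: lt_le_trans ar.
have [||x xab E] := @MVT_segment _ F F' a b ab.
- by move=> x xab; apply/dF/ca'/subset_itv_oo_cc.
- apply: derivable_within_continuous => x xab.
  by have [] := dF x (ca' x xab).
by rewrite -subr_ge0 E mulr_ge0 ?subr_ge0// F'0// ca'.
Qed.

Lemma nonincreasing_gt0 F (F' : R -> R) (c : R) :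
  (forall r, c < r -> is_derive r (1:R) F (F' r)) -> (forall r, c < r -> F' r <= 0) ->
  forall a b, c < a -> a <= b -> F b <= F a.
Proof.
move=> dF F'0 a b ca ab.
have := @nondecreasing_gt0 (fun r => - F r) (fun r => - F' r) c _ _ a b ca ab.
rewrite lerN2; apply => r cr; last by rewrite oppr_ge0 F'0.
by have := dF r cr => d; exact: is_deriveN.
Qed.

Definition prim0 f (r : R) : R := \int[mu]_(s in `]0, r]) f s.

(** What a C^1 primitive on ]0, +oo[ starting at 0 requires; the value of f at 0 does not enter. *)
Definition regular0 f := (forall r, 0 < r -> {for r, continuous f}) /\
  (forall N, exists C, forall r, 0 < r <= N -> `|f r| <= C).

Lemma regular0_measurable f : regular0 f -> measurable_fun (`]0, +oo[%classic : set mR) f.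
Proof.
move=> [cf _]; apply: open_continuous_measurable_fun; first exact: interval_open.
by move=> x; rewrite inE/= in_itv/= andbT; exact: cf.
Qed.

Let itv0_fin (N : R) : (mu (`]0%R, N]%classic : set mR) < +oo)%E.
Proof.
have E := @lebesgue_measure_itv R `]0, N]; rewrite [X in (X < _)%E]E /=.
by case: ifP => // _; rewrite -EFinB ltry.
Qed.

Lemma regular0_integrable f N : regular0 f -> mu.-integrable `]0, N] (EFin \o f).
Proof.
move=> rf; have mf := regular0_measurable rf; have [cf /(_ N)[C fC]] := rf.
have fin := itv0_fin N.
apply: (@measurable_bounded_integrable _ _ _ mu f `]0, N]%classic) => //.
- by apply: measurable_funS mf => //; exact: subset_itvl.
- exists C; split; first exact: num_real.
  by move=> M CM x; rewrite /= in_itv/= => xN; exact: le_trans (fC x xN) (ltW CM).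
Qed.

Lemma is_derive_prim0 f (r : R) : regular0 f -> 0 < r -> is_derive r (1:R) (prim0 f) (f r).
Proof.
move=> rf r0; have rr : r < r + 1 by rewrite ltrDl.
have i := regular0_integrable (r + 1) rf.
have [//||d1 d2] := @continuous_FTC1 _ f (BRight 0) r (r + 1) rr i.
- by case: rf => cf _; exact: cf.
- by rewrite derive1E in d2; split.
Qed.

Lemma prim0_bound f N C : regular0 f -> 0 <= C -> (forall r, 0 < r <= N -> `|f r| <= C) ->
  forall r, 0 < r <= N -> `|prim0 f r| <= C * r.
Proof.
move=> rf C0 fC r /andP[r0 rN].
have i := regular0_integrable r rf.
rewrite /prim0; apply: (le_trans (le_normr_Rintegral _ i)) => //.
have -> : C * r = \int[mu]_(s in `]0, r]) C.
  rewrite Rintegral_cst//; have E := @lebesgue_measure_itv R `]0, r].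
  by rewrite [X in fine X]E /= lte_fin r0 sube0.
apply: le_Rintegral => //.
- have := i => /integrable_norm; exact.
- apply: (@measurable_bounded_integrable _ _ _ mu (cst C) `]0, r]%classic) => //; first exact: itv0_fin.
  exists C; split; first exact: num_real.
  by move=> M CM x _ /=; rewrite ger0_norm// ltW.
- by move=> s; rewrite /= in_itv/= => /andP[s0 sr]; apply: fC; rewrite s0 (le_trans sr).
Qed.

Lemma prim0_gt0 f (r : R) : regular0 f -> (forall s, 0 < s -> 0 < f s) -> 0 < r -> 0 < prim0 f r.
Proof.
move=> rf f0 r0.
have dF (s : R) : 0 < s -> is_derive s (1:R) (prim0 f) (f s) by exact: is_derive_prim0.
have nd := nondecreasing_gt0 dF (fun s s0 => ltW (f0 s s0)).
have [|||x] := @MVT _ (prim0 f) f (r / 2) r.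
- by rewrite ltr_pdivrMr// ltr_pMr// ltr1n.
- move=> x; rewrite in_itv/= => /andP[h _]; apply: dF; apply: lt_trans h.
  by rewrite divr_gt0.
- apply: derivable_within_continuous => x; rewrite in_itv/= => /andP[h _].
  have /dF[]// : 0 < x by apply: lt_le_trans h; rewrite divr_gt0.
rewrite in_itv/= => /andP[rx xr] E.
have x0 : 0 < x by apply: lt_trans rx; rewrite divr_gt0.
have : 0 <= prim0 f (r / 2).
  by apply: Rintegral_ge0 => s; rewrite /= in_itv/= => /andP[s0 _]; rewrite ltW// f0.
move=> /le_lt_trans; apply; rewrite -subr_gt0 E mulr_gt0 ?f0// subr_gt0.
by rewrite ltr_pdivrMr// ltr_pMr// ltr1n.
Qed.

Lemma regular0M f g : regular0 f -> regular0 g -> regular0 (fun r => f r * g r).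
Proof.
move=> [cf bf] [cg bg]; split=> [r r0|N].
  by apply: continuousM; [exact: cf|exact: cg].
have [C fC] := bf N; have [D gD] := bg N; exists (C * D) => r rN.
by rewrite normrM ler_pM// ?fC// gD.
Qed.

Lemma regular0X f k : regular0 f -> regular0 (fun r => f r ^+ k).
Proof.
move=> rf; elim: k => [|k IH].
  split=> [r r0|N]; first exact: cst_continuous.
  by exists 1 => r _; rewrite expr0 normr1.
rewrite (_ : (fun r => _) = (fun r => f r * f r ^+ k)); first exact: regular0M.
by apply/funext => r; rewrite exprS.
Qed.

Lemma regular0_powR f a : 0 <= a -> (forall r, 0 < r -> 0 < f r) -> regular0 f ->
  regular0 (fun r => f r `^ a).
Proof.
move=> a0 f0 [cf bf]; split=> [r r0|N].
  apply: (@continuous_comp _ _ _ f (fun t => t `^ a)); first exact: cf.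
  exact: is_derive_continuous (is_derive1_powR _ (f0 r r0)).
have [C fC] := bf N; exists (C `^ a) => r rN; have r0 : 0 < r by case/andP: rN.
have fr : f r <= C by apply: le_trans (fC r rN); exact: ler_norm.
rewrite ger0_norm ?powR_ge0//; apply: ge0_ler_powR => //; rewrite nnegrE.
  by rewrite ltW// f0.
by apply: le_trans fr; rewrite ltW// f0.
Qed.

End half_line.

(** * Convexity estimates for the model function *)

Section model.
Context {R : realType} (psi : R -> R) (hpsi : model_function psi).
Local Notation mR := (measurableTypeR R).
Local Notation mu := (@lebesgue_measure R).

(** f extends psi smoothly across 0, which makes f1 a two-sided derivative everywhere, while psi is
    arbitrary on ]-oo, 0[. *)
Lemma model_extension : exists f f1 : R -> R,
  [/\ forall r, 0 <= r -> psi r = f r, forall r : R, is_derive r (1:R) f (f1 r)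
    & forall r : R, derivable f1 r (1:R)].
Proof.
have [[f [df E]] _ _ _ _] := hpsi.
exists f, (derive1 f); split => //.
- by move=> r; split; [exact: (df 0%N)|rewrite derive1E].
- by move=> r; exact: (df 1%N).
Qed.

Section extension.
Variables (f f1 : R -> R).
Hypotheses (psiE : forall r, 0 <= r -> psi r = f r)
  (df : forall r : R, is_derive r (1:R) f (f1 r)).

(** The right derivative at 0 of t |-> psi(x + t (y - x)), bounded by the chord. Taken between 0, r
    and N, it yields the estimates that follow. *)
Lemma model_tangent x y : 0 <= x -> 0 <= y -> psi x + f1 x * (y - x) <= psi y.
Proof.
move=> x0 y0.
pose g t := f (x + t * (y - x)).
have g0 : g 0 = f x by rewrite /g mul0r addr0.
have dg : is_derive (0:R) (1:R) g (f1 x * (y - x)).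
  have d : is_derive (0:R) (1:R) (fun t : R => x + t * (y - x)) (y - x).
    have d1 := is_deriveD (is_derive_cst x (0:R) 1) (is_deriveM (is_derive_id (0:R) (1:R)) (is_derive_cst (y - x) (0:R) 1)).
    by apply: (is_derive_eq d1); rewrite /GRing.scale/=; ring.
  have := is_derive1_comp (f := f) (g := fun t : R => x + t * (y - x)) _ d.
  by rewrite mul0r addr0 => /(_ _ (df x)).
have := is_derive_right dg; under eq_fun do rewrite add0r; move=> cg.
rewrite addrC -lerBrDr; apply: (cvgr_to_le cg).
near=> t.
have t0 : 0 < t by near: t; exact: nbhs_right_gt.
have t1 : t <= 1 by near: t; exact: nbhs_right_le.
rewrite ler_pdivrMl// g0 /g -!psiE//; last first.
  rewrite (_ : x + _ = (1 - t) * x + t * y); last by ring.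
  by rewrite addr_ge0// mulr_ge0// ?subr_ge0// ltW.
have [_ _ _ _ cvx] := hpsi.
have t01 : 0 <= t <= 1 by rewrite t1 ltW.
have := cvx (Itv01 (ltW t0) t1) y x; rewrite !inE/= !in_itv/= !andbT => /(_ y0 x0).
rewrite !convRE /= /unstable.onem => h.
rewrite lerBlDr (_ : x + _ = t * y + (1 - t) * x); last by ring.
rewrite (_ : t * _ + psi x = t * psi y + (1 - t) * psi x); last by ring.
exact: h.
Unshelve. all: by end_near. Qed.

Lemma model_f1_0 : f1 0 = 1.
Proof.
have [_ _ _ d0 _] := hpsi.
have cg : (h^-1 * (psi h - psi 0)) @[h --> (0:R)^'+] --> f1 0.
  apply: cvg_trans (is_derive_right (df 0)); apply: near_eq_cvg; near=> h.
  by rewrite add0r !psiE//; near: h; exact: nbhs_right_ge.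
exact: (cvg_unique _ cg d0).
Unshelve. all: by end_near. Qed.

Lemma model_ge_id r : 0 <= r -> r <= psi r.
Proof.
move=> r0; have := model_tangent (lexx 0) r0.
by rewrite model_0// model_f1_0 add0r subr0 mul1r.
Qed.

Lemma model_gt0 r : 0 < r -> 0 < psi r.
Proof. by move=> r0; apply: (lt_le_trans r0); rewrite model_ge_id// ltW. Qed.

Lemma model_le_mul r : 0 <= r -> psi r <= r * f1 r.
Proof.
move=> r0; have := model_tangent r0 (lexx 0).
by rewrite model_0// sub0r mulrN subr_le0 mulrC.
Qed.

Lemma model_f1_le x y : 0 <= x -> x <= y -> f1 x <= f1 y.
Proof.
move=> x0; rewrite le_eqVlt => /predU1P[->//|xy].
have y0 := le_trans x0 (ltW xy).
have h1 := model_tangent x0 y0; have h2 := model_tangent y0 x0.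
rewrite -(ler_pM2r (_ : 0 < y - x)) ?subr_gt0//; lra.
Qed.

Lemma model_f1_ge1 r : 0 <= r -> 1 <= f1 r.
Proof. by move=> r0; rewrite -model_f1_0 model_f1_le. Qed.

Lemma model_le x y : 0 <= x -> x <= y -> psi x <= psi y.
Proof.
move=> x0 xy; apply: le_trans (model_tangent x0 (le_trans x0 xy)).
by rewrite lerDl mulr_ge0 ?subr_ge0// (le_trans ler01)// model_f1_ge1.
Qed.

Lemma model_le_chord r N : 0 <= r -> r <= N -> psi r * N <= r * psi N.
Proof.
move=> r0 rN; have N0 := le_trans r0 rN.
have h1 := model_tangent r0 N0; have h2 := model_tangent r0 (lexx 0).
rewrite model_0// in h2.
(* The weights r and N - r eliminate the slope f1 r. *)
have : (psi r + f1 r * (N - r)) * r + (psi r + f1 r * (0 - r)) * (N - r) <= psi N * r + 0 * (N - r).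
  by rewrite lerD// ler_wpM2r// subr_ge0.
by rewrite mul0r addr0 [r * _]mulrC; apply: le_trans; rewrite le_eqVlt; apply/orP; left; apply/eqP; ring.
Qed.

Lemma model_is_derive (r : R) : 0 < r -> is_derive r (1:R) psi (f1 r).
Proof.
move=> r0; apply: is_derive_near (df r); near=> y; apply/esym/psiE.
by near: y; apply: filterS (lt_nbhsr r0) => y /ltW.
Unshelve. all: by end_near. Qed.

End extension.

Lemma model_regular0 : regular0 psi.
Proof.
have [f [f1 [psiE df _]]] := model_extension; split => [r r0|N].
  exact: is_derive_continuous (model_is_derive psiE df r0).
exists (psi N) => r /andP[r0 rN]; rewrite ger0_norm ?(model_le psiE df)// ?ltW//.
exact: (model_gt0 psiE df).
Qed.

End model.

(** * Measurability and local integrability of a radial solution *)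

Section profile.
Context {R : realType} {n : nat}.
Local Notation mR := (measurableTypeR R).
Local Notation mu := (@lebesgue_measure R).
Local Notation dx := (@lebesgue_rv R n).
Local Notation L1 f := (mu.-integrable [set: mR] (EFin \o (f : R -> R))).
Local Notation L1n F := (dx.-integrable [set: 'rV[R]_n] (EFin \o (F : 'rV[R]_n -> R))).
Implicit Types (x : 'rV[R]_n) (U : R -> R).

Lemma enorm_basis (i : 'I_n) (r : R) : enorm (r *: basis R i) = `|r|.
Proof.
rewrite /enorm -sqrtr_sqr /dot; congr Num.sqrt.
rewrite (bigD1 i)//= big1 => [|j ji]; rewrite !mxE eqxx/=.
  by rewrite eqxx mulr1 addr0 expr2.
by rewrite (negbTE ji) mulr0 mul0r.
Qed.

(** Restriction to a coordinate axis, on which |x| is the absolute value of the coordinate. U is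
    arbitrary on negative reals, hence the absolute value in the conclusion. *)
Lemma measurable_profile U : (0 < n)%N ->
  measurable_fun [set: 'rV[R]_n] (fun x => U (enorm x) : mR) ->
  measurable_fun [set: mR] (fun r : R => U `|r| : mR).
Proof.
move=> n0 mU; pose i : 'I_n := Ordinal n0.
have -> : (fun r : R => U `|r|) = (fun x => U (enorm x)) \o (fun r : R => r *: basis R i).
  by apply/funext => r; rewrite /= enorm_basis.
apply: (measurableT_comp mU); apply: measurable_rvP => j.
under eq_fun do rewrite mxE.
exact: measurable_funM.
Qed.

Variables (psi : R -> R) (hpsi : model_function psi).

Lemma measurable_model_enorm : measurable_fun [set: 'rV[R]_n] (fun x => psi (enorm x) : mR).
Proof.
have [f [f1 [psiE df _]]] := model_extension hpsi.
have -> : (fun x => psi (enorm x)) = f \o (@enorm R n).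
  by apply/funext => x /=; rewrite psiE// enorm_ge0.
apply: measurableT_comp; last exact: measurable_enorm.
apply: continuous_measurable_fun => r; exact: is_derive_continuous (df r).
Qed.

Lemma vol_radial x : x != 0 -> vol psi x = (psi (enorm x) / enorm x) ^+ n.-1.
Proof.
move=> x0; have [f [f1 [psiE df _]]] := model_extension hpsi.
have psi0 : 0 < psi (enorm x) by rewrite (model_gt0 hpsi psiE df)// enorm_gt0.
exact: (volE x0 psi0 erefl erefl).
Qed.

Lemma measurable_vol : measurable_fun [set: 'rV[R]_n] (vol psi : _ -> mR).
Proof.
have -> : vol psi = (fun x => if 0 < enorm x then (psi (enorm x) * enorm x `^ (-1)) ^+ n.-1
    else vol psi (0 : 'rV[R]_n)).
  apply/funext => x; rewrite enorm_gt0; case: eqVneq => [->//|x0].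
  by rewrite vol_radial//= powR_inv1 ?enorm_ge0.
apply: measurable_fun_ifT => //.
  by apply: measurable_fun_ltr => //; exact: measurable_enorm.
apply: measurable_funX; apply: measurable_funM; first exact: measurable_model_enorm.
apply: (measurableT_comp (f := fun t : mR => t `^ (-1) : mR)); last exact: measurable_enorm.
exact: measurable_powR.
Qed.

Lemma measurable_metric_sharp (v w : 'rV[R]_n -> 'rV[R]_n) :
  (forall i, measurable_fun [set: 'rV[R]_n] (fun x => v x 0 i : mR)) ->
  (forall i, measurable_fun [set: 'rV[R]_n] (fun x => w x 0 i : mR)) ->
  measurable_fun [set: 'rV[R]_n]
    (fun x => metric psi x (sharp psi x (v x)) (sharp psi x (w x)) : mR).
Proof.
move=> mv mw.
have mdot (a b : 'rV[R]_n -> 'rV[R]_n) :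
    (forall i, measurable_fun [set: 'rV[R]_n] (fun x => a x 0 i : mR)) ->
    (forall i, measurable_fun [set: 'rV[R]_n] (fun x => b x 0 i : mR)) ->
    measurable_fun [set: 'rV[R]_n] (fun x => dot (a x) (b x) : mR).
  move=> ma mb; rewrite /dot.
  elim: (index_enum _) => [|i s IH]; last first.
    have -> : (fun x => \sum_(j <- i :: s) a x 0 j * b x 0 j) =
        (fun x => a x 0 i * b x 0 i + \sum_(j <- s) a x 0 j * b x 0 j).
      by apply/funext => x; rewrite big_cons.
    exact: (measurable_funD (measurable_funM (ma i) (mb i)) IH).
  have -> : (fun x => \sum_(j <- [::]) a x 0 j * b x 0 j) = (fun=> 0).
    by apply/funext => x; rewrite big_nil.
  exact: measurable_cst.
pose k x := psi (enorm x) * enorm x `^ (-1).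
have mk : measurable_fun [set: 'rV[R]_n] (k : _ -> mR).
  apply: measurable_funM; first exact: measurable_model_enorm.
  apply: (measurableT_comp (f := fun t : mR => t `^ (-1) : mR)); last exact: measurable_enorm.
  exact: measurable_powR.
pose ki x := (k x ^+ 2) `^ (-1).
have mki : measurable_fun [set: 'rV[R]_n] (ki : _ -> mR).
  apply: (measurableT_comp (f := fun t : mR => t `^ (-1) : mR)); last exact: measurable_funX.
  exact: measurable_powR.
have me i : measurable_fun [set: 'rV[R]_n] (fun x => unit_dir x 0 i : mR).
  exact: measurable_unit_dir.
have -> : (fun x => metric psi x (sharp psi x (v x)) (sharp psi x (w x))) =
  (fun x => if 0 < enorm x then ki x * dot (v x) (w x) +
      (1 - ki x) * (dot (v x) (unit_dir x) * dot (w x) (unit_dir x))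
    else metric psi 0 (sharp psi 0 (v 0)) (sharp psi 0 (w 0))).
  apply/funext => x; rewrite enorm_gt0; case: eqVneq => [->//|x0]/=.
  have [f [f1 [psiE df _]]] := model_extension hpsi.
  have psi0 : 0 < psi (enorm x) by rewrite (model_gt0 hpsi psiE df)// enorm_gt0.
  rewrite (metric_sharp x0 psi0 erefl erefl) /ki /k powR_inv1 ?sqr_ge0//.
  by rewrite powR_inv1// enorm_ge0.
apply: measurable_fun_ifT => //.
  by apply: measurable_fun_ltr => //; exact: measurable_enorm.
apply: measurable_funD; first by apply: measurable_funM => //; exact: mdot.
apply: measurable_funM; first exact: measurable_funB.
by apply: measurable_funM; exact: mdot.
Qed.

Lemma model_ratio_bounds (r N : R) : 0 < r -> r <= N -> 1 <= psi r / r <= psi N / N.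
Proof.
have [f [f1 [psiE df _]]] := model_extension hpsi.
move=> r0 rN; have N0 := lt_le_trans r0 rN.
apply/andP; split.
  by rewrite ler_pdivlMr// mul1r (model_ge_id hpsi psiE df)// ltW.
rewrite ler_pdivrMr// mulrAC ler_pdivlMr// (le_trans (model_le_chord hpsi psiE df (ltW r0) rN))//.
by rewrite mulrC.
Qed.

Variables (c : R) (c0 : 0 < c)
  (cE : forall A : set mR, measurable A ->
    (dx (@enorm R n @^-1` A) = \int[mu]_(r in A) (radial_density n c r)%:E)%E).
Hypothesis n0 : (0 < n)%N.

Lemma profile_bounded U (N : R) : {ae dx, forall x, 0 < U (enorm x)} ->
  Linfloc (fun x : 'rV[R]_n => U (enorm x)) ->
  exists2 M, 0 < M & {ae mu, forall r : R, 0 < r -> r < N -> 0 < U `|r| <= M}.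
Proof.
move=> U0 [mU /(_ _ (@rcube_compact R n N))[M UM]].
exists (Num.max 1 M); first by rewrite lt_max ltr01.
have mUr := measurable_profile n0 mU.
pose P (r : R) := (r < N) ==> (0 < U `|r| <= Num.max 1 M).
have : {ae mu, forall r, 0 < r -> P r}.
  apply: (ae_radial c0 cE).
  - rewrite /P; under eq_fun do rewrite implybE.
    apply: measurable_or; first by apply: measurable_neg; exact: measurable_fun_ltr.
    by apply: measurable_and; [exact: measurable_fun_ltr|exact: measurable_fun_ler].
  - move: U0 UM; apply: ae_mono2 => x u0 uM; apply/implyP => xN.
    rewrite ger0_norm ?enorm_ge0// u0/= le_max; apply/orP; right.
    apply: le_trans (ler_norm _) (uM _); move=> i.
    by apply: le_trans (coord_le_enorm x i) (ltW xN).
by apply: ae_mono => r H r0 rN; have /implyP := H r0; exact.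
Qed.

Section local.
Variables (p : R) (U : R -> R) (du : 'rV[R]_n -> 'rV[R]_n).
Hypotheses (p1 : 1 < p) (mU : measurable_fun [set: 'rV[R]_n] (fun x => U (enorm x) : mR))
  (wdu : W1ploc psi p (fun x => U (enorm x)) du).

Lemma measurable_du i : measurable_fun [set: 'rV[R]_n] (fun x => du x 0 i : mR).
Proof.
have [_ mdu _ _] := wdu.
exact: (measurableT_comp (f := fun x => x 0 i : mR) (@measurable_coord R n i) mdu).
Qed.

Let gn x := gnorm psi x (sharp psi x (du x)).

Lemma gradient_Lp (N : R) :
  L1n (fun x => (if enorm x < N then 1 else 0) * (`|gn x| `^ p * vol psi x)).
Proof.
have [_ _ _ [mg /(_ _ (@rcube_compact R n N)) gi]] := wdu.
have v0 x : 0 <= vol psi x by exact: sqrtr_ge0.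
have mh : measurable_fun [set: 'rV[R]_n] (fun x => `|gn x| `^ p * vol psi x : mR).
  apply: measurable_funM; last exact: measurable_vol.
  apply: (measurableT_comp (f := fun t : mR => t `^ p : mR)); first exact: measurable_powR.
  exact: measurableT_comp mg.
have mI : measurable_fun [set: 'rV[R]_n] (fun x => (if enorm x < N then 1 else 0 : R) : mR).
  apply: measurable_fun_ifT => //.
  by apply: measurable_fun_ltr => //; exact: measurable_enorm.
apply/integrableP; split; first by apply/measurable_EFinP; exact: measurable_funM.
apply: le_lt_trans gi; rewrite [leRHS]integral_mkcond; apply: ge0_le_integral => //.
- by apply/measurable_EFinP; apply: measurableT_comp => //; exact: measurable_funM.
- apply/(measurable_restrictT _ _).1; first exact: measurable_rcube.
  by apply: measurable_funTS; exact/measurable_EFinP.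
move=> x _; rewrite patchE /= normrM; case: ifPn => xN.
  rewrite normr1 mul1r mem_set; last first.
    by move=> i; apply: le_trans (coord_le_enorm x i) (ltW xN).
  by rewrite ger0_norm// mulr_ge0// powR_ge0.
by rewrite normr0 mul0r; case: ifP => // _; rewrite lee_fin mulr_ge0// powR_ge0.
Qed.

(** [coord_le_gnorm] combined with gn <= 1 + gn^p, with vol >= 1, and with the bound of psi(r)/r by
    its value Q at N. *)
Lemma gradient_coord_L1 (N : R) i : L1n (fun x => if enorm x < N then du x 0 i else 0).
Proof.
have v0 x : 0 <= vol psi x by exact: sqrtr_ge0.
have mI : measurable_fun [set: 'rV[R]_n] (fun x => (if enorm x < N then 1 else 0 : R) : mR).
  apply: measurable_fun_ifT => //.
  by apply: measurable_fun_ltr => //; exact: measurable_enorm.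
have iI : L1n (fun x => if enorm x < N then 1 else 0).
  apply: (@integrable_bounded_support _ _ _ dx _ (eball N) 1) => //.
  - exact: measurable_eball.
  - exact: eball_fin.
  - move=> x; rewrite mul1r indicE; case: ifPn => h.
      by rewrite mem_set ?normr1// /eball/= ltW.
    by rewrite normr0.
pose Q := psi N / N.
pose b x := Q * ((if enorm x < N then 1 else 0) + (if enorm x < N then 1 else 0) * (`|gn x| `^ p * vol psi x)).
have ib : L1n b.
  have := integrableZl measurableT Q (integrableD measurableT iI (gradient_Lp N)).
  exact.
pose d x := (if enorm x < N then du x 0 i else 0).
have md : measurable_fun [set: 'rV[R]_n] (d : _ -> mR).
  apply: measurable_fun_ifT => //; last exact: measurable_du.
  by apply: measurable_fun_ltr => //; exact: measurable_enorm.
have mb : measurable_fun [set: 'rV[R]_n] (b : _ -> mR).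
  by apply/measurable_EFinP; exact: measurable_int ib.
(* The pole, where the metric is given by another formula, is discarded as a null set. *)
pose m x := if enorm x <= 0 then 0 else d x.
have im : L1n m.
  have mm : measurable_fun [set: 'rV[R]_n] (m : _ -> mR).
    apply: measurable_fun_ifT => //.
    by apply: measurable_fun_ler => //; exact: measurable_enorm.
  apply: (@le_integrable _ _ _ dx setT _ _ (EFin \o b)) => //; first exact/measurable_EFinP.
  move=> x _ /=; rewrite lee_fin /m /d /b; case: ifPn => x0; first by rewrite normr0.
  rewrite -ltNge in x0; case: ifPn => xN; last by rewrite normr0.
  have /andP[q1 qQ] := model_ratio_bounds x0 (ltW xN).
  have Q0 : 0 <= Q by apply: le_trans qQ; apply: le_trans q1.
  have xx : x != 0 by rewrite -enorm_gt0.
  have [f [f1 [psiE df _]]] := model_extension hpsi.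
  have psi0 := model_gt0 hpsi psiE df x0.
  have gn0 : 0 <= gn x by exact: sqrtr_ge0.
  have h := coord_le_gnorm xx psi0 erefl erefl (du x) i
    (model_ge_id hpsi psiE df (ltW x0)).
  apply: le_trans h _; rewrite [leRHS]ger0_norm; last first.
    by rewrite mulr_ge0// addr_ge0// mulr_ge0// mulr_ge0// powR_ge0.
  rewrite ler_pM//; first by rewrite (le_trans ler01).
  rewrite mul1r -/(gn x) (ger0_norm gn0).
  have vol1 : 1 <= vol psi x by rewrite vol_radial// exprn_ege1.
  have gp : gn x <= 1 + gn x `^ p.
    have [g1|/ltW g1] := leP (gn x) 1; first by rewrite (le_trans g1)// lerDl powR_ge0.
    rewrite (@le_trans _ _ (gn x `^ p))// ?lerDr//.
    by rewrite -[leLHS]powRr1// ler_powR// ltW.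
  by apply: (le_trans gp); rewrite lerD2l ler_peMr// powR_ge0.
apply/integrableP; split; first exact/measurable_EFinP.
have /integrableP[_] := im; apply: le_lt_trans; rewrite le_eqVlt; apply/orP; left; apply/eqP.
have mm : measurable_fun [set: 'rV[R]_n] (m : _ -> mR).
  by apply/measurable_EFinP; exact: measurable_int im.
apply: ae_eq_integral => //.
- by apply/measurable_EFinP; exact: measurableT_comp md.
- by apply/measurable_EFinP; exact: measurableT_comp mm.
- apply: ae_mono (@ae_neq0 R n n0) => x x0 _.
  by rewrite /= /m /d leNgt enorm_gt0 x0.
Qed.

End local.
End profile.

Section half_line_integrals.
Context {R : realType}.
Local Notation mR := (measurableTypeR R).
Local Notation mu := (@lebesgue_measure R).

Lemma ae_bounded_integrable0 (f : R -> R) (N C : R) : 0 <= C ->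
  measurable_fun (`]0%R, N]%classic : set mR) f ->
  {ae mu, forall r, 0 < r -> r <= N -> `|f r| <= C} ->
  mu.-integrable `]0, N] (EFin \o f).
Proof.
move=> C0 mf fC.
have E := @lebesgue_measure_itv R `]0, N].
have fin : (mu (`]0%R, N]%classic : set mR) < +oo)%E.
  by rewrite [X in (X < _)%E]E /=; case: ifP => // _; rewrite -EFinB ltry.
apply/integrableP; split; first exact/measurable_EFinP.
apply: (@le_lt_trans _ _ (\int[mu]_(x in `]0%R, N]) C%:E)%E); last first.
  by rewrite integral_cst//= lte_mul_pinfty//; apply: fin.
apply: ae_ge0_le_integral => //.
- by apply/measurable_EFinP; exact: measurableT_comp mf.
- by move: fC; apply: ae_mono => r H; rewrite /= in_itv/= => /andP[r0 rN]; rewrite lee_fin H.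
Qed.

Lemma prim0_continuous (g : R -> R) (r : R) : 0 < r ->
  mu.-integrable `]0, r + 1] (EFin \o g) -> {for r, continuous (prim0 g)}.
Proof.
move=> r0 ig; have rr : r < r + 1 by rewrite ltrDl.
pose k := g \_ (`]0%R, r + 1]%classic : set mR).
have ik : mu.-integrable [set: mR] (EFin \o k).
  have := @integrable_mkcond _ _ _ mu _ (EFin \o g) (measurable_itv `]0, r + 1]).
  by rewrite -restrict_EFin => -[/(_ ig)].
have H : {within `[0, r + 1], continuous ((parameterized_integral mu 0)^~ k)}.
  apply: parameterized_integral_continuous; first by rewrite ltW// (lt_trans r0).
  exact: (@integrableS _ _ _ mu setT).
have rin : r \in (`]0, r + 1[ : interval R) by rewrite in_itv/= r0 rr.
have h : {for r, continuous ((parameterized_integral mu 0)^~ k)}.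
  exact: (within_continuous_continuous (lt_trans r0 rr) H rin).
have E y : y <= r + 1 -> prim0 g y = parameterized_integral mu 0 y k.
  move=> yr; rewrite /parameterized_integral -Rintegral_itv_obnd_cbnd; last first.
    exact: (@integrableS _ _ _ mu setT).
  apply: eq_Rintegral => s; rewrite inE/= in_itv/= => /andP[s0 sy].
  by rewrite /k patchE mem_set//= in_itv/= s0 (le_trans sy).
rewrite /prop_for /continuous_at E ?(ltW rr)//; apply: cvg_trans h; apply: near_eq_cvg.
near=> y; rewrite E//; apply: ltW; near: y.
exact: lt_nbhsl.
Unshelve. all: by end_near. Qed.

End half_line_integrals.

Section profile_integrals.
Context {R : realType}.
Local Notation mR := (measurableTypeR R).
Local Notation mu := (@lebesgue_measure R).
Variables (psi : R -> R) (hpsi : model_function psi) (n : nat) (p q : R) (U : R -> R).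
Hypotheses (n0 : (0 < n)%N) (p1 : 1 < p) (q0 : 0 <= q)
  (mU : measurable_fun [set: mR] (fun r : R => U `|r| : mR))
  (UM : forall N : R, exists2 M, 0 < M &
     {ae mu, forall r : R, 0 < r -> r < N -> 0 < U `|r| <= M}).

(** The function P of the overview, for a profile not yet known to be continuous and measurable only
    after composition with the absolute value. [slope] will turn out to be - v'. *)
Definition mass r := prim0 (fun s => U `|s| `^ q * psi s ^+ n.-1) r.
Definition slope r := (mass r / psi r ^+ n.-1) `^ (p - 1)^-1.

(* Integrating (r ^ n * U)' shows that U r * r ^ n = prim0 moment r. *)
Definition moment s := n%:R * (s ^+ n.-1 * U `|s|) - s ^+ n * slope s.

Let psi0 (r : R) : 0 < r -> 0 < psi r.
Proof. have [f [f1 [psiE df _]]] := model_extension hpsi; exact: (model_gt0 hpsi psiE df). Qed.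

Let psi_le (x y : R) : 0 <= x -> x <= y -> psi x <= psi y.
Proof. have [f [f1 [psiE df _]]] := model_extension hpsi; exact: (model_le hpsi psiE df). Qed.

Let UMN (N : R) : exists2 M, 0 < M &
  {ae mu, forall r : R, 0 < r -> r <= N -> 0 < U `|r| <= M}.
Proof.
have [M M0 H] := UM (N + 1); exists M => //; move: H; apply: ae_mono => r H r0 rN.
by apply: H => //; apply: le_lt_trans rN _; rewrite ltrDl.
Qed.

Let sub0 N : (`]0%R, N]%classic : set mR) `<=` `]0, +oo[.
Proof. by move=> r; rewrite /= !in_itv/= andbT => /andP[]. Qed.

Lemma measurable_mass_density :
  measurable_fun (`]0, +oo[%classic : set mR) (fun s => U `|s| `^ q * psi s ^+ n.-1).
Proof.
apply: measurable_funM.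
  apply: measurable_funTS.
  apply: (measurableT_comp (f := fun t : mR => t `^ q : mR)); [exact: measurable_powR|exact: mU].
exact: regular0_measurable (regular0X n.-1 (model_regular0 hpsi)).
Qed.

Lemma mass_density_bound (N : R) : exists2 M, 0 < M &
  {ae mu, forall s, 0 < s -> s <= N -> `|U `|s| `^ q * psi s ^+ n.-1| <= M `^ q * psi s ^+ n.-1}.
Proof.
have [M M0 H] := UMN N; exists M => //; move: H; apply: ae_mono => s H s0 sN.
have ps : 0 <= psi s ^+ n.-1 by rewrite exprn_ge0// ltW// psi0.
have /andP[u0 uM] := H s0 sN.
rewrite ger0_norm ?mulr_ge0 ?powR_ge0//; apply: ler_wpM2r => //.
by apply: ge0_ler_powR; rewrite ?nnegrE// ltW.
Qed.

Lemma mass_integrable (N : R) :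
  mu.-integrable `]0, N] (EFin \o (fun s => U `|s| `^ q * psi s ^+ n.-1)).
Proof.
have [M M0 H] := mass_density_bound N.
apply: (@ae_bounded_integrable0 _ _ _ (M `^ q * psi `|N| ^+ n.-1)).
- rewrite mulr_ge0 ?powR_ge0// exprn_ge0//; have [_ + _ _ _] := hpsi; exact.
- by apply: measurable_funS measurable_mass_density => //; exact: sub0.
- move: H; apply: ae_mono => s H s0 sN; apply: (le_trans (H s0 sN)).
  apply: ler_wpM2l; first exact: powR_ge0.
  rewrite lerXn2r ?nnegrE ?(ltW (psi0 _))//; last first.
    by apply: psi_le; [exact: ltW|rewrite (le_trans sN)// ler_norm].
  by rewrite normr_gt0 gt_eqF// (lt_le_trans s0).
Qed.

Lemma mass_ge0 r : 0 <= mass r.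
Proof.
apply: Rintegral_ge0 => s; rewrite /= in_itv/= => /andP[s0 _].
by rewrite mulr_ge0 ?powR_ge0// exprn_ge0// ltW// psi0.
Qed.

(** Otherwise U would vanish almost everywhere on ]0, r]. Positivity keeps the power in [slope] away
    from 0, where it need not be differentiable. *)
Lemma mass_gt0 (r : R) : 0 < r -> 0 < mass r.
Proof.
move=> r0; rewrite lt_def mass_ge0 andbT; apply/eqP => m0.
have i := mass_integrable r.
have [M M0 H] := UMN r.
have f0 s : (`]0%R, r]%classic : set mR) s -> (0 <= (U `|s| `^ q * psi s ^+ n.-1)%:E)%E.
  by rewrite /= in_itv/= => /andP[s0 _]; rewrite lee_fin mulr_ge0 ?powR_ge0// exprn_ge0// ltW// psi0.
have E0 : (\int[mu]_(s in `]0%R, r]) `|(U `|s| `^ q * psi s ^+ n.-1)%:E| = 0)%E.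
  have ifin : (\int[mu]_(s in `]0%R, r]) (U `|s| `^ q * psi s ^+ n.-1)%:E)%E \is a fin_num.
    exact: (@integrable_fin_num _ _ _ mu _ (measurable_itv `]0, r]) _ i).
  transitivity (\int[mu]_(s in `]0%R, r]) (U `|s| `^ q * psi s ^+ n.-1)%:E)%E.
    by apply: eq_integral => s; rewrite inE => /f0 h; rewrite gee0_abs.
  by rewrite -(fineK ifin); congr EFin.
have mf : measurable_fun (`]0%R, r]%classic : set mR)
    (fun s => (U `|s| `^ q * psi s ^+ n.-1)%:E).
  by have := measurable_int _ i.
have ae0 := (ae_eq_integral_abs mu (measurable_itv `]0, r]) mf).1 E0.
have : {ae mu, forall s : R, ~ (0 < s <= r)}.
  move: H ae0; apply: ae_mono2 => s H A /andP[s0 sr].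
  have /andP[u0 _] := H s0 sr.
  have := A; rewrite /= in_itv/= s0 sr => /(_ isT) [] /eqP.
  by rewrite gt_eqF// mulr_gt0 ?powR_gt0// exprn_gt0// psi0.
move=> [A [mA A0 sA]].
have : (mu (`]0%R, r]%classic : set mR) <= mu A)%E.
  apply: le_measure; rewrite ?inE//.
  by move=> s; rewrite /= in_itv/= => h; apply: sA => /=; apply.
have E := @lebesgue_measure_itv R `]0, r].
by rewrite [X in (X <= _)%E]E /= lte_fin r0 A0 -EFinB subr0 lee_fin leNgt r0.
Qed.

Lemma mass_continuous (r : R) : 0 < r -> {for r, continuous mass}.
Proof. by move=> r0; apply: prim0_continuous => //; exact: mass_integrable. Qed.

(* Monotonicity of psi gives [mass r <= M^q * r * psi r ^ (n - 1)] on [0, N]. *)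
Lemma slope_bound (N : R) : exists2 C, 0 < C & forall r : R, 0 < r <= N -> slope r <= C.
Proof.
have [M M0 H] := mass_density_bound N.
exists ((M `^ q * (1 + `|N|)) `^ (p - 1)^-1).
  by rewrite powR_gt0// mulr_gt0 ?powR_gt0// ltr_wpDr.
move=> r /andP[r0 rN]; rewrite /slope.
have ps : 0 < psi r ^+ n.-1 by rewrite exprn_gt0// psi0.
apply: ge0_ler_powR; rewrite ?nnegrE ?invr_ge0 ?subr_ge0 ?(ltW p1)//.
- by rewrite divr_ge0 ?mass_ge0// ltW.
- by rewrite mulr_ge0 ?powR_ge0// addr_ge0.
rewrite ler_pdivrMr// /mass.
have cst_int : mu.-integrable `]0, r] (EFin \o (fun=> M `^ q * psi r ^+ n.-1)).
  apply: (@ae_bounded_integrable0 _ _ _ (M `^ q * psi r ^+ n.-1)) => //.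
    by rewrite mulr_ge0 ?powR_ge0// ltW.
  by apply: aeW => s _ _; rewrite ger0_norm// mulr_ge0 ?powR_ge0// ltW.
have : prim0 (fun s => U `|s| `^ q * psi s ^+ n.-1) r <= \int[mu]_(s in `]0, r]) (M `^ q * psi r ^+ n.-1).
  have fin1 : (\int[mu]_(s in `]0%R, r]) (U `|s| `^ q * psi s ^+ n.-1)%:E)%E \is a fin_num.
    exact: (@integrable_fin_num _ _ _ mu _ (measurable_itv `]0, r]) _ (mass_integrable r)).
  have fin2 : (\int[mu]_(s in `]0%R, r]) (M `^ q * psi r ^+ n.-1)%:E)%E \is a fin_num.
    exact: (@integrable_fin_num _ _ _ mu _ (measurable_itv `]0, r]) _ cst_int).
  rewrite -lee_fin /prim0 /Rintegral !fineK//.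
  apply: ae_ge0_le_integral => //.
  - move=> s; rewrite /= in_itv/= => /andP[s0 _].
    by rewrite lee_fin mulr_ge0 ?powR_ge0// exprn_ge0// ltW// psi0.
  - by have := measurable_int _ (mass_integrable r).
  - by move=> s _; rewrite lee_fin mulr_ge0 ?powR_ge0// ltW.
  - move: H; apply: ae_mono => s H; rewrite /= in_itv/= => /andP[s0 sr].
    rewrite lee_fin (le_trans (ler_norm _))// (le_trans (H s0 (le_trans sr rN)))//.
    apply: ler_wpM2l; first exact: powR_ge0.
    by rewrite lerXn2r ?nnegrE ?(ltW (psi0 _))//; apply: psi_le => //; exact: ltW.
move=> /le_trans; apply; rewrite Rintegral_cst//.
have E := @lebesgue_measure_itv R `]0, r].
rewrite [X in fine X]E /= lte_fin r0 sube0 /= -mulrA -mulrA; apply: ler_wpM2l; first exact: powR_ge0.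
rewrite mulrC; apply: ler_wpM2r; first exact: ltW.
by rewrite (le_trans rN)// (le_trans (ler_norm _))// lerDr.
Qed.

Lemma slope_continuous (r : R) : 0 < r -> {for r, continuous slope}.
Proof.
move=> r0; have [cpsi _] := regular0X n.-1 (model_regular0 hpsi).
have ps : psi r ^+ n.-1 != 0 by rewrite expf_neq0// gt_eqF// psi0.
apply: (@continuous_comp _ _ _ (fun s => mass s / psi s ^+ n.-1) (fun t => t `^ (p - 1)^-1)).
  apply: continuousM; first exact: mass_continuous.
  by apply: continuousV => //; exact: cpsi.
apply: is_derive_continuous; apply: is_derive1_powR.
by rewrite divr_gt0 ?mass_gt0// exprn_gt0// psi0.
Qed.

Lemma slope_regular0 : regular0 slope.
Proof.
split; first exact: slope_continuous.
move=> N; have [C C0 H] := slope_bound N; exists C => r rN.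
by rewrite ger0_norm ?powR_ge0// H.
Qed.

Lemma moment_measurable : measurable_fun (`]0, +oo[%classic : set mR) moment.
Proof.
apply: measurable_funB.
  by apply: measurable_funTS; apply: measurable_funM => //; apply: measurable_funM => //.
apply: measurable_funM; first by apply: measurable_funTS; exact: measurable_funX.
exact: regular0_measurable slope_regular0.
Qed.

Lemma moment_integrable (N : R) : mu.-integrable `]0, N] (EFin \o moment).
Proof.
have [M M0 H] := UMN N; have [C C0 sC] := slope_bound N.
apply: (@ae_bounded_integrable0 _ _ _ (n%:R * (`|N| ^+ n.-1 * M) + `|N| ^+ n * C)).
- by rewrite addr_ge0// !mulr_ge0// ?exprn_ge0// ltW.
- by apply: measurable_funS moment_measurable => //; exact: sub0.
- move: H; apply: ae_mono => s H s0 sN.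
  have /andP[u0 uM] := H s0 sN.
  have sN' : s <= `|N| by rewrite (le_trans sN)// ler_norm.
  apply: (le_trans (ler_normB _ _)); apply: lerD.
    rewrite !normrM (ger0_norm (ler0n _ _)); apply: ler_wpM2l => //.
    rewrite (ger0_norm (ltW u0)) (ger0_norm (exprn_ge0 _ (ltW s0))).
    rewrite ler_pM ?exprn_ge0 ?(ltW s0) ?(ltW u0)//.
    by rewrite lerXn2r// nnegrE// ltW.
  rewrite normrM ler_pM//.
    by rewrite ger0_norm ?exprn_ge0 ?(ltW s0)// lerXn2r// nnegrE// ltW.
  by rewrite ger0_norm ?powR_ge0// sC// s0.
Qed.

End profile_integrals.

Section signed_power.
Context {R : realType} (p : R).
Hypothesis p1 : 1 < p.

(** The flux of the p-Laplacian in one variable; it is 0 at t = 0 also when p < 2. *)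
Definition signed_powR (t : R) : R := `|t| `^ (p - 2) * t.

Lemma norm_signed_powR t : `|signed_powR t| = `|t| `^ (p - 1).
Proof.
rewrite /signed_powR normrM ger0_norm ?powR_ge0//.
have [->|t0] := eqVneq t 0.
  by rewrite normr0 mulr0 powR0// subr_eq0 gt_eqF.
rewrite -[X in _ * X]powRr1// -powRD ?normr_eq0; last by rewrite t0 implybT.
by congr (_ `^ _); ring.
Qed.

Lemma signed_powR_le0 t a : 0 <= a -> signed_powR t = - a -> t = - a `^ (p - 1)^-1.
Proof.
move=> a0 ta; have := norm_signed_powR t; rewrite ta normrN (ger0_norm a0) => aE.
have t0 : t <= 0.
  rewrite leNgt; apply/negP => t0.
  have : 0 < signed_powR t by rewrite mulr_gt0// powR_gt0// normr_gt0 gt_eqF.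
  by rewrite ta oppr_gt0 ltNge a0.
by rewrite aE -powRrM mulfV ?subr_eq0 ?gt_eqF// powRr1// ler0_norm// opprK.
Qed.

Lemma measurable_signed_powR :
  measurable_fun [set: measurableTypeR R] (signed_powR : _ -> measurableTypeR R).
Proof.
apply: measurable_funM => //.
apply: (measurableT_comp (f := fun t : measurableTypeR R => t `^ (p - 2) : measurableTypeR R)).
  exact: measurable_powR.
exact: normr_measurable.
Qed.

End signed_power.

(** * Reduction of the weak equation to the half-line of radii *)

Section profile_equation.
Context {R : realType} {n : nat}.
Local Notation mR := (measurableTypeR R).
Local Notation mu := (@lebesgue_measure R).
Local Notation dx := (@lebesgue_rv R n).
Local Notation L1 f := (mu.-integrable [set: mR] (EFin \o (f : R -> R))).
Local Notation L1n F := (dx.-integrable [set: 'rV[R]_n] (EFin \o (F : 'rV[R]_n -> R))).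
Implicit Types (x : 'rV[R]_n).

Lemma prim_prim0 (f g : R -> R) (r : R) : measurable_fun [set: mR] f ->
  measurable_fun (`]0%R, r]%classic : set mR) g -> (forall s, s <= 0 -> f s = 0) ->
  {ae mu, forall s, 0 < s -> s <= r -> f s = g s} -> prim f r = prim0 g r.
Proof.
move=> mf mg f0 fg.
transitivity (\int[mu]_(s in `]0, r]) f s).
  rewrite /prim Rintegral_mkcond [RHS]Rintegral_mkcond; apply: eq_Rintegral => s _.
  rewrite !patchE; case: ifPn => h1; case: ifPn => h2 //.
    move: h1 h2; rewrite notin_setE inE/= !in_itv/= => sr /negP.
    by rewrite sr andbT -leNgt => /f0.
  by move: h1 h2; rewrite notin_setE inE/= !in_itv/= => h /andP[_ h'].
rewrite /prim0 /Rintegral; congr fine; apply: ae_eq_integral => //.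
- by apply/measurable_EFinP; exact: measurable_funTS.
- exact/measurable_EFinP.
- by move: fg; apply: ae_mono => s H; rewrite /= in_itv/= => /andP[s0 sr]; rewrite H.
Qed.

Variables (c : R) (c0 : 0 < c)
  (cE : forall A : set mR, measurable A ->
    (dx (@enorm R n @^-1` A) = \int[mu]_(r in A) (radial_density n c r)%:E)%E).
Hypothesis n0 : (0 < n)%N.
Variables (psi : R -> R) (hpsi : model_function psi) (p q : R) (U : R -> R)
  (du : 'rV[R]_n -> 'rV[R]_n).
Hypotheses (p1 : 1 < p) (q0 : 0 <= q) (UL : Linfloc (fun x : 'rV[R]_n => U (enorm x)))
  (wdu : W1ploc psi p (fun x => U (enorm x)) du)
  (weq : weak_equation psi p q (fun x => U (enorm x)) du).

Let mU : measurable_fun [set: 'rV[R]_n] (fun x => U (enorm x) : mR).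
Proof. by case: UL. Qed.

Let mUr := measurable_profile n0 mU.

Let mI N : measurable_fun [set: mR] (fun r : R => 0 < r < N).
Proof. by apply: measurable_and; exact: measurable_fun_ltr. Qed.

Let psi0 r : 0 < r -> 0 < psi r.
Proof. have [f [f1 [psiE df _]]] := model_extension hpsi; exact: (model_gt0 hpsi psiE df). Qed.

Let psi_le (x y : R) : 0 <= x -> x <= y -> psi x <= psi y.
Proof. have [f [f1 [psiE df _]]] := model_extension hpsi; exact: (model_le hpsi psiE df). Qed.

Let mpsi : measurable_fun [set: mR] (fun r : R => psi `|r| : mR).
Proof. by apply: (measurable_profile n0); exact: measurable_model_enorm. Qed.

Section local.
Variables (N0 N M : R).
Hypotheses (N00 : 0 < N0) (N0N : N0 < N) (M0 : 0 < M)
  (UM : {ae mu, forall r : R, 0 < r -> r < N -> 0 < U `|r| <= M}).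

Let N_gt0 : 0 < N. Proof. exact: lt_trans N0N. Qed.

(** U cut to ]0, N[ and to its essential bounds: equal to U almost everywhere there, but bounded at
    every point, as [radial_gradient] asks. *)
Let V r := if (0 < r < N) && (0 < U `|r| <= M) then U `|r| else 0.

Let V_ge0 r : 0 <= V r.
Proof. by rewrite /V; case: ifP => // /andP[_ /andP[/ltW]]. Qed.

Let VM r : V r <= M.
Proof. by rewrite /V; case: ifP => [/andP[_ /andP[]]//|_]; exact: ltW. Qed.

Let mV : measurable_fun [set: mR] V.
Proof.
apply: measurable_fun_ifT => //; apply: measurable_and => //.
by apply: measurable_and; [exact: measurable_fun_ltr|exact: measurable_fun_ler].
Qed.

Let VU : {ae mu, forall r, 0 < r < N -> V r = U `|r|}.
Proof.
by move: UM; apply: ae_mono => r H /andP[r0 rN]; rewrite /V r0 rN H.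
Qed.

Let VUx : {ae dx, forall x, enorm x < N -> V (enorm x) = U (enorm x)}.
Proof.
have H : {ae mu, forall r, 0 < r -> (r < N -> V r = U r)}.
  by move: VU; apply: ae_mono => r H r0 rN; rewrite H ?r0// gtr0_norm.
have := ae_enorm cE H; have := @ae_neq0 R n n0; apply: ae_mono2 => x x0; exact.
Qed.

Let weakV phi i : smoothn phi -> (forall x, N ^+ 2 < sqnorm x -> phi x = 0) ->
  \int[dx]_x (V (enorm x) * partial i phi x) =
  - \int[dx]_x ((if enorm x < N then du x 0 i else 0) * phi x).
Proof.
move=> sphi supp; have [wd _ _ _] := wdu.
have tphi := smoothn_test_function sphi supp.
have mphi := smoothn_measurable sphi.
have mdphi := smoothn_measurable (smoothn_partial i sphi).
have mdi := measurable_du wdu i.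
(* phi is known to vanish for |x| > N and the cut-off acts for |x| >= N; the sphere |x| = N between
   them is a null set. *)
have out x : enorm x != N -> ~~ (enorm x < N) -> N ^+ 2 < sqnorm x.
  move=> xN; rewrite -leNgt le_eqVlt eq_sym (negbTE xN)/= => Nx.
  by rewrite -sqr_enorm ltrXn2r// ltW.
transitivity (\int[dx]_x (U (enorm x) * partial i phi x)).
  apply: ae_eq_Rintegral_rv.
  - apply: measurable_funM => //.
    exact: (measurableT_comp mV (@measurable_enorm R n)).
  - exact: measurable_funM.
  - have := ae_enorm_neq cE N; move: VUx; apply: ae_mono2 => x H xN.
    have [h|h] := boolP (enorm x < N); first by rewrite H.
    by rewrite (partial_supp _ supp) ?mulr0// out.
rewrite /Rintegral (wd phi i tphi) fineN; congr (- _).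
apply: ae_eq_Rintegral_rv.
- exact: measurable_funM.
- apply: measurable_funM => //; apply: measurable_fun_ifT => //.
  by apply: measurable_fun_ltr => //; exact: measurable_enorm.
- have := ae_enorm_neq cE N; apply: ae_mono => x xN.
  have [h|h] := boolP (enorm x < N); first by [].
  by rewrite (supp x (out x xN h)) !mulr0.
Qed.

Let pN := radial_densityN n c N.

Let gradW : exists W : R -> R,
  [/\ measurable_fun [set: mR] W,
    L1 (fun s => n%:R * (V s * pN s) + s * (pN s * W s)),
    {ae mu, forall r, 0 < r < N ->
      V r * pN r * r = prim (fun s => n%:R * (V s * pN s) + s * (pN s * W s)) r} &
    forall rho, rho < N ^+ 2 ->
      {ae dx, forall x, sqnorm x < rho -> forall i, du x 0 i = W (enorm x) * unit_dir x 0 i}].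
Proof.
apply: (@radial_gradient R n c N M V du n0 N_gt0 c0 cE mV) => //.
- by move=> r; rewrite ger0_norm.
- by move=> r /negbTE h; rewrite /V h.
- by move=> i; exact: (gradient_coord_L1 hpsi n0 p1 wdu).
Qed.

Let vr (r : R) : R := (psi `|r| * `|r| `^ (-1)) ^+ n.-1.

Let mvr : measurable_fun [set: mR] (vr : mR -> mR).
Proof.
apply: measurable_funX; apply: measurable_funM => //.
apply: (measurableT_comp (f := fun t : mR => t `^ (-1) : mR)); first exact: measurable_powR.
exact: normr_measurable.
Qed.

(** The Euclidean factor r^(n-1) cancels, and the Riemannian area psi^(n-1) remains up to c. *)
Let vr_dens (r : R) : 0 < r -> vr r * radial_density n c r = c * psi r ^+ n.-1.
Proof.
move=> r0; rewrite /vr /radial_density r0 gtr0_norm// powR_inv1 ?ltW// exprMn exprVn.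
by rewrite mulrCA -mulrA mulVf ?mulr1// expf_neq0// gt_eqF.
Qed.

Let vr_vol x : x != 0 -> vol psi x = vr (enorm x).
Proof.
by move=> xx; rewrite vol_radial// /vr ger0_norm ?enorm_ge0// powR_inv1 ?enorm_ge0.
Qed.

Let vr_ge0 r : 0 < r -> 0 <= vr r.
Proof.
move=> r0; rewrite /vr exprn_ge0// mulr_ge0// ?powR_ge0// ltW// gtr0_norm//; exact: psi0.
Qed.

Let density0 r : ~~ (0 < r) -> radial_density n c r = 0.
Proof. by move=> /negbTE r0; rewrite /radial_density r0. Qed.

Section gradient.
Variables (W : R -> R).
Hypotheses (mW : measurable_fun [set: mR] W)
  (duW : forall rho, rho < N ^+ 2 ->
      {ae dx, forall x, sqnorm x < rho -> forall i, du x 0 i = W (enorm x) * unit_dir x 0 i}).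

(** Strictly between N0^2 and N^2: du is known to be radial on |x|^2 < rho, which contains the ball
    of radius N0 where the equation is tested. *)
Let rho := (N0 ^+ 2 + N ^+ 2) / 2.
Let N0rho : N0 ^+ 2 < rho.
Proof. by have : N0 ^+ 2 < N ^+ 2; [rewrite ltrXn2r// ltW|rewrite /rho; lra]. Qed.
Let rhoN : rho < N ^+ 2.
Proof. by have : N0 ^+ 2 < N ^+ 2; [rewrite ltrXn2r// ltW|rewrite /rho; lra]. Qed.

Let duE : {ae dx, forall x, sqnorm x < rho -> du x = W (enorm x) *: unit_dir x}.
Proof.
by move: (duW rhoN); apply: ae_mono => x H xr; apply/rowP => i; rewrite H// [RHS]mxE.
Qed.

(** The local L^p bound on the Riemannian gradient, read in polar coordinates. *)
Let Wp : L1 (fun r => if 0 < r < N0 then `|W r| `^ p * psi r ^+ n.-1 else 0).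
Proof.
have mWp : measurable_fun [set: mR] (fun r => `|W r| `^ p : mR).
  apply: (measurableT_comp (f := fun t : mR => t `^ p : mR)); first exact: measurable_powR.
  exact: measurableT_comp.
pose g (r : R) : \bar R := ((if r < N0 then 1 else 0) * (`|W r| `^ p * (if 0 < r then vr r else 0)))%:E.
have mg : measurable_fun [set: mR] g.
  apply/measurable_EFinP; apply: measurable_funM.
    by apply: measurable_fun_ifT => //; exact: measurable_fun_ltr.
  apply: measurable_funM => //.
  by apply: measurable_fun_ifT => //; exact: measurable_fun_ltr.
have g0 r : (0 <= g r)%E.
  rewrite /g lee_fin; case: ifP => _; last by rewrite mul0r.
  rewrite mul1r mulr_ge0 ?powR_ge0//; case: ifP => // r0; exact: vr_ge0.
have E := ge0_integral_polar c0 cE g0 mg.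
apply/integrableP; split.
  apply/measurable_EFinP; have -> : (fun r => if 0 < r < N0 then `|W r| `^ p * psi r ^+ n.-1 else 0) =
     (fun r => if 0 < r < N0 then `|W r| `^ p * psi `|r| ^+ n.-1 else 0).
    by apply/funext => r; case: ifP => // /andP[r0 _]; rewrite [`|r|]gtr0_norm.
  by apply: measurable_fun_ifT => //; apply: measurable_funM => //; exact: measurable_funX.
rewrite (_ : (\int[mu]_x _)%E = (c^-1%:E * \int[mu]_r (g r * (radial_density n c r)%:E))%E); last first.
  rewrite -ge0_integralZl//.
  - apply: eq_integral => r _; rewrite /= /g -!EFinM; congr EFin.
    case: (boolP (0 < r)) => [r0|r0]/=; last by rewrite density0// normr0 !mulr0.
    case: ifP => _; last by rewrite normr0 !mul0r mulr0.
    rewrite ger0_norm ?mulr_ge0 ?powR_ge0 ?exprn_ge0 ?ltW ?psi0//.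
    by rewrite mul1r -[_ * vr r * _]mulrA vr_dens// !mulrA [c^-1 * _]mulrC mulfVK ?gt_eqF.
  - apply: emeasurable_funM => //; apply/measurable_EFinP; exact: measurable_radial_density.
  - by move=> r _; rewrite mule_ge0// lee_fin radial_density_ge0// ltW.
  - by rewrite lee_fin invr_ge0 ltW.
rewrite -E; apply: lte_mul_pinfty => //; first by rewrite lee_fin invr_ge0 ltW.
have /integrableP[mL] := gradient_Lp hpsi wdu N0.
apply: le_lt_trans; rewrite le_eqVlt; apply/orP; left; apply/eqP.
apply: ae_eq_integral => //.
- exact: (measurableT_comp mg (@measurable_enorm R n)).
- exact: measurableT_comp.
- move: duE; have := @ae_neq0 R n n0; apply: ae_mono2 => x x0 H _.
  rewrite /g /=; congr EFin; case: ifPn => xN; last by rewrite !mul0r normr0.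
  have xr : sqnorm x < rho.
    by apply: lt_trans N0rho; rewrite -sqr_enorm ltrXn2r// enorm_ge0.
  have ex0 : 0 < enorm x by rewrite enorm_gt0.
  rewrite !mul1r ex0 (H xr) (gnorm_sharp_radial x0 (psi0 ex0) erefl erefl) normr_id vr_vol//.
  by rewrite [RHS]ger0_norm// mulr_ge0 ?powR_ge0// vr_ge0.
Qed.

Let sg := signed_powR p.

Let f r := if 0 < r < N0 then V r `^ q * psi r ^+ n.-1 else 0.
Let g r := if 0 < r < N0 then - (sg (W r) * psi r ^+ n.-1) else 0.

Let mf : measurable_fun [set: mR] f.
Proof.
have -> : f = (fun r => if 0 < r < N0 then V r `^ q * psi `|r| ^+ n.-1 else 0).
  by apply/funext => r; rewrite /f; case: ifP => // /andP[r0 _]; rewrite gtr0_norm.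
apply: measurable_fun_ifT => //; apply: measurable_funM; last exact: measurable_funX.
apply: (measurableT_comp (f := fun t : mR => t `^ q : mR)); [exact: measurable_powR|exact: mV].
Qed.

Let mg : measurable_fun [set: mR] g.
Proof.
have -> : g = (fun r => if 0 < r < N0 then - (sg (W r) * psi `|r| ^+ n.-1) else 0).
  by apply/funext => r; rewrite /g; case: ifP => // /andP[r0 _]; rewrite gtr0_norm.
apply: measurable_fun_ifT => //; apply: measurableT_comp => //; apply: measurable_funM.
  exact: (measurableT_comp (measurable_signed_powR p) mW).
exact: measurable_funX.
Qed.

Let f_ge0 r : 0 <= f r.
Proof.
rewrite /f; case: ifP => // /andP[r0 _].
by rewrite mulr_ge0 ?powR_ge0// exprn_ge0// ltW// psi0.
Qed.

Let psiN r : 0 < r < N0 -> psi r ^+ n.-1 <= psi N0 ^+ n.-1.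
Proof.
move=> /andP[r0 rN]; rewrite lerXn2r ?nnegrE ?(ltW (psi0 _))//.
by apply: psi_le; exact: ltW.
Qed.

Let fi : L1 f.
Proof.
apply: (@L1_bounded_itv _ _ 0 N0 (M `^ q * psi N0 ^+ n.-1)) => //.
- by move=> r h; rewrite /f; case: ifP => // /andP[a b]; move: h; rewrite (ltW a) (ltW b).
- move=> r; rewrite ger0_norm// /f; case: ifP => [rN|_]; last first.
    by move=> _; rewrite mulr_ge0 ?powR_ge0// exprn_ge0// ltW// psi0.
  move=> _; rewrite ler_pM ?powR_ge0 ?psiN//.
    by have /andP[r0 _] := rN; rewrite exprn_ge0// ltW// psi0.
  by apply: ge0_ler_powR; rewrite ?nnegrE ?V_ge0 ?(ltW M0) ?VM.
Qed.

Let gi : L1 g.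
Proof.
pose b r := (if 0 < r < N0 then psi N0 ^+ n.-1 else 0) +
   (if 0 < r < N0 then `|W r| `^ p * psi r ^+ n.-1 else 0).
have ib : L1 b.
  apply: L1D; last exact: Wp.
  apply: (@L1_bounded_itv _ _ 0 N0 (psi N0 ^+ n.-1)) => //.
  - exact: measurable_fun_ifT.
  - by move=> r h; case: ifP => // /andP[a b']; move: h; rewrite (ltW a) (ltW b').
  - by move=> r _; case: ifP => _; rewrite ?normr0 ?ger0_norm// exprn_ge0// ltW// psi0.
apply: (@le_integrable _ _ _ mu setT _ _ (EFin \o b)) => //; first exact/measurable_EFinP.
move=> r _ /=; rewrite lee_fin /g /b; case: ifPn => rN; last by rewrite normr0.
have [r0 _] := andP rN.
have pr : 0 <= psi r ^+ n.-1 by rewrite exprn_ge0// ltW// psi0.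
apply: le_trans (ler_norm _); rewrite normrN normrM norm_signed_powR// (ger0_norm pr).
(* |W|^(p-1) <= 1 + |W|^p, so that [Wp] makes the flux integrable. *)
apply: (@le_trans _ _ ((1 + `|W r| `^ p) * psi r ^+ n.-1)); last first.
  by rewrite mulrDl mul1r lerD2r psiN.
apply: ler_wpM2r => //; have [w1|/ltW w1] := leP `|W r| 1.
  rewrite (@le_trans _ _ 1) ?lerDl ?powR_ge0//.
  apply: (@le_trans _ _ (1 `^ (p - 1))); last by rewrite powR1.
  by apply: ge0_ler_powR; rewrite ?nnegrE// subr_ge0 ltW.
rewrite (@le_trans _ _ (`|W r| `^ p)) ?lerDr//.
by rewrite ler_powR// lerBlDr lerDl.
Qed.

(** The test h(|x|^2) has the radial differential 2 h'(|x|^2) x, so both sides of the weak equation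
    become integrals over radii with weight c psi^(n-1). As h is free at the pole, this is the
    hypothesis of [du_bois_reymond]. *)
Lemma weak_equation_radial h h' : smooth1 h -> smooth1 h' ->
  (forall t, is_derive t (1:R) h (h' t)) -> (forall t, N0 ^+ 2 <= t -> h t = 0) ->
  \int[mu]_r (f r * h (r ^+ 2) + g r * (2 * r * h' (r ^+ 2))) = 0.
Proof.
move=> sh sh' dh supp.
have h'0 t : N0 ^+ 2 < t -> h' t = 0.
  move=> Nt; have d1 : is_derive t (1:R) h 0.
    apply: (@is_derive_near _ (cst 0)).
    by apply: filterS (lt_nbhsr Nt) => y /ltW /supp.
  by have [_ <-] := dh t; have [_ ->] := d1.
pose phi (x : 'rV[R]_n) := h (sqnorm x).
have sphi : smoothn phi by exact: smoothn_radial.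
have tphi : test_function phi.
  by apply: (@smoothn_test_function _ _ _ (N0 ^+ 2)) => // x /ltW /supp.
have dphi x : differential phi x = (2 * h' (sqnorm x)) *: x.
  apply/rowP => i; rewrite !mxE /partial.
  have [_ ->] := is_derive_comp1 (dh (sqnorm x)) (is_derive_sqnorm x i).
  by rewrite mulrCA mulrA.
have mh : measurable_fun [set: mR] (fun r : R => h (r ^+ 2) : mR).
  apply: (measurableT_comp (f := h : mR -> mR)); first exact: smooth1_measurable.
  exact: measurable_funX.
have mh' : measurable_fun [set: mR] (fun r : R => 2 * r * h' (r ^+ 2) : mR).
  apply: measurable_funM; first exact: measurable_funM.
  apply: (measurableT_comp (f := h' : mR -> mR)); first exact: smooth1_measurable.
  exact: measurable_funX.
pose kR (r : R) := (if 0 < r < N0 then V r `^ q else 0) * h (r ^+ 2) * vr r.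
pose kL (r : R) := (if 0 < r < N0 then sg (W r) else 0) * (2 * r * h' (r ^+ 2)) * vr r.
have mkR : measurable_fun [set: mR] kR.
  apply: measurable_funM => //; apply: measurable_funM => //.
  apply: measurable_fun_ifT => //.
  apply: (measurableT_comp (f := fun t : mR => t `^ q : mR)); [exact: measurable_powR|exact: mV].
have mkL : measurable_fun [set: mR] kL.
  apply: measurable_funM => //; apply: measurable_funM => //.
  by apply: measurable_fun_ifT => //; exact: (measurableT_comp (measurable_signed_powR p) mW).
have kRE r : kR r * radial_density n c r = c * (f r * h (r ^+ 2)).
  rewrite /kR /f; have [r0|r0] := boolP (0 < r); last by rewrite density0//= !mul0r mulr0.
  rewrite -mulrA vr_dens//=; case: ifP => _; last by rewrite !mul0r mulr0.
  by ring.
have kLE r : kL r * radial_density n c r = (- c) * (g r * (2 * r * h' (r ^+ 2))).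
  rewrite /kL /g; have [r0|r0] := boolP (0 < r); last by rewrite density0//= !mul0r mulr0.
  rewrite -mulrA vr_dens//=; case: ifP => _; last by rewrite !mul0r mulr0.
  by ring.
have [C1 C10 hb] := smooth1_bounded 0 (N0 ^+ 2) sh.
have [C2 C20 hb'] := smooth1_bounded 0 (N0 ^+ 2) sh'.
pose c1 (r : R) := if 0 < r < N0 then h (r ^+ 2) else 0.
pose c2 (r : R) := if 0 < r < N0 then 2 * r * h' (r ^+ 2) else 0.
have sq r : 0 < r < N0 -> 0 <= r ^+ 2 <= N0 ^+ 2.
  by move=> /andP[r0 rN]; rewrite sqr_ge0/= lerXn2r ?nnegrE ?ltW.
have i1 : L1 (fun r => f r * h (r ^+ 2)).
  have -> : (fun r => f r * h (r ^+ 2)) = (fun r => f r * c1 r).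
    by apply/funext => r; rewrite /f /c1; case: ifP => // _; rewrite !mul0r.
  apply: (@L1_bounded_mul _ _ _ C1) => //; first exact: measurable_fun_ifT.
  by move=> r; rewrite /c1; case: ifP => [/sq/hb//|_]; rewrite normr0.
have i2 : L1 (fun r => g r * (2 * r * h' (r ^+ 2))).
  have -> : (fun r => g r * (2 * r * h' (r ^+ 2))) = (fun r => g r * c2 r).
    by apply/funext => r; rewrite /g /c2; case: ifP => // _; rewrite !mul0r.
  apply: (@L1_bounded_mul _ _ _ (2 * N0 * C2)) => //; first exact: measurable_fun_ifT.
  move=> r; rewrite /c2; case: ifPn => rN; last by rewrite normr0 !mulr_ge0// ltW.
  have [r0 rN'] := andP rN.
  rewrite normrM ler_pM//; last exact/hb'/sq.
  rewrite ger0_norm; last by rewrite mulr_ge0// ltW.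
  by rewrite ler_pM2l// ltW.
have [|jR ER] := polar_integrable c0 cE mkR.
  by under eq_fun do rewrite kRE; exact: L1Z.
have [|jL EL] := polar_integrable c0 cE mkL.
  by under eq_fun do rewrite kLE; exact: L1Z.
have : \int[dx]_x kL (enorm x) = \int[dx]_x kR (enorm x).
  have := weq tphi => E.
  transitivity (fine (\int[dx]_x (gnorm psi x (sharp psi x (du x)) `^ (p - 2) *
    metric psi x (sharp psi x (du x)) (sharp psi x (differential phi x)) * vol psi x)%:E)).
    congr fine; apply: ae_eq_integral => //.
    - apply/measurable_EFinP; exact: (measurableT_comp mkL (@measurable_enorm R n)).
    - apply/measurable_EFinP.
      have mgn : measurable_fun [set: 'rV[R]_n] (fun x => gnorm psi x (sharp psi x (du x)) : mR).
        by have [_ _ _ []] := wdu.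
      apply: measurable_funM; last exact: measurable_vol.
      apply: measurable_funM.
        apply: (measurableT_comp (f := fun t : mR => t `^ (p - 2) : mR)) => //.
      apply: measurable_metric_sharp => // i; first exact: (measurable_du wdu i).
      under eq_fun do rewrite mxE.
      apply: smoothn_measurable; exact: smoothn_partial.
    - have ae2 : {ae dx, forall x, x != 0 /\ enorm x != N0}.
        by move: (@ae_neq0 R n n0) (ae_enorm_neq cE N0); apply: ae_mono2 => x.
      apply: ae_mono2 ae2 duE => x [x0 E0] H _ /=; congr EFin.
      have ex0 : 0 < enorm x by rewrite enorm_gt0.
      have psix := psi0 ex0.
      rewrite dphi -sqr_enorm /kL.
      have xE : (2 * h' (enorm x ^+ 2)) *: x = (2 * h' (enorm x ^+ 2) * enorm x) *: unit_dir x.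
        by rewrite -!scalerA; congr (_ *: (_ *: _)); apply/rowP => i; rewrite [RHS]mxE mulrC unit_dir_enorm.
      rewrite xE vr_vol//; congr (_ * _).
      have [xN|xN] := boolP (0 < enorm x < N0); last first.
        (* h' vanishes beyond N0^2, and the sphere |x| = N0 has been discarded. *)
        rewrite h'0; last by rewrite ltrXn2r// ?ltW// lt_neqAle eq_sym E0/= leNgt; move: xN; rewrite ex0.
        by rewrite (metric_sharp_radial_r x0 psix erefl erefl) !(mulr0, mul0r).
      have xr : sqnorm x < rho.
        by apply: lt_trans N0rho; rewrite -sqr_enorm; have /andP[_ ?] := xN; rewrite ltrXn2r// enorm_ge0.
      rewrite (H xr) (gnorm_sharp_radial x0 psix erefl erefl).
      rewrite (metric_sharp_radial x0 psix erefl erefl) dotZl dot_unit_dir// mulr1.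
      by rewrite /sg /signed_powR; ring.
  rewrite E; apply: ae_eq_Rintegral_rv.
  - apply: measurable_funM; last exact: measurable_vol.
    apply: measurable_funM; last exact: smoothn_measurable.
    apply: (measurableT_comp (f := fun t : mR => t `^ q : mR)); [exact: measurable_powR|exact: mU].
  - exact: (measurableT_comp mkR (@measurable_enorm R n)).
  - apply: ae_mono2 (@ae_neq0 R n n0) VUx => x x0 H.
    have ex0 : 0 < enorm x by rewrite enorm_gt0.
    rewrite /kR vr_vol// sqr_enorm; congr (_ * _).
    rewrite ex0/=; case: ifPn => xN; first by rewrite H// (lt_trans xN).
    have -> : phi x = 0 by apply: supp; rewrite -sqr_enorm lerXn2r ?nnegrE ?enorm_ge0 ?(ltW N00)// leNgt.
    by rewrite /phi supp ?mulr0// -sqr_enorm lerXn2r ?nnegrE ?enorm_ge0 ?(ltW N00)// leNgt.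
rewrite EL ER; under eq_Rintegral do rewrite kLE; under [RHS]eq_Rintegral do rewrite kRE.
rewrite !RintegralZl// => E.
rewrite RintegralD//; apply: (@mulfI _ c); first by rewrite gt_eqF.
by rewrite mulr0 mulrDr -E mulNr addNr.
Qed.

(** The identity g = [prim f] prescribes the signed power of W; its value is nonpositive, so
    [signed_powR_le0] inverts it. *)
Lemma gradient_profile : {ae mu, forall r, 0 < r < N0 ->
  W r = - (prim f r / psi r ^+ n.-1) `^ (p - 1)^-1}.
Proof.
have := @du_bois_reymond R N0 f g fi gi _ _ weak_equation_radial.
move=> H; have {}H := H _ _.
apply: ae_mono (H _ _) => [r E rN|r /negbTE E|r /negbTE E].
- have [r0 rN0] := andP rN.
  have pr : psi r ^+ n.-1 != 0 by rewrite expf_neq0// gt_eqF// psi0.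
  have Pf : 0 <= prim f r by apply: Rintegral_ge0 => s _; exact: f_ge0.
  apply: signed_powR_le0 => //.
    by rewrite divr_ge0// exprn_ge0// ltW// psi0.
  by apply: (mulIf pr); have := E rN; rewrite /g rN mulNr divfK// => <-; rewrite opprK.
- by rewrite /f E.
- by rewrite /g E.
Qed.

End gradient.

Hypothesis UMall : forall N' : R, exists2 M', 0 < M' &
  {ae mu, forall r : R, 0 < r -> r < N' -> 0 < U `|r| <= M'}.

(** The first-order relation between V and W from [gradW], in which W is now known to be minus
    [slope]; the constant c cancels. *)
Lemma profile_local_ode : {ae mu, forall r, 0 < r < N0 ->
  U `|r| * r ^+ n = prim0 (moment psi n p q U) r}.
Proof.
have [W [mW iW EV duW]] := gradW.
pose f r := if 0 < r < N0 then V r `^ q * psi r ^+ n.-1 else 0.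
have gp : {ae mu, forall r, 0 < r < N0 -> W r = - (prim f r / psi r ^+ n.-1) `^ (p - 1)^-1}.
  exact: gradient_profile mW duW.
have mf : measurable_fun [set: mR] f.
  have -> : f = (fun r => if 0 < r < N0 then V r `^ q * psi `|r| ^+ n.-1 else 0).
    by apply/funext => r; rewrite /f; case: ifP => // /andP[r0 _]; rewrite gtr0_norm.
  apply: measurable_fun_ifT => //; apply: measurable_funM; last exact: measurable_funX.
  apply: (measurableT_comp (f := fun t : mR => t `^ q : mR)); [exact: measurable_powR|exact: mV].
have mass_f r : 0 < r < N0 -> prim f r = mass psi n q U r.
  move=> /andP[r0 rN0]; apply: prim_prim0 => //.
  - apply: measurable_funS (measurable_mass_density hpsi n q mUr) => //.
    by move=> s; rewrite /= !in_itv/= andbT => /andP[].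
  - by move=> s s0; rewrite /f ltNge s0.
  - move: VU; apply: ae_mono => s H s0 sr.
    have sN0 := le_lt_trans sr rN0.
    by rewrite /f s0 sN0/= H// s0 (lt_trans sN0).
have Ws : {ae mu, forall r, 0 < r < N0 -> W r = - slope psi n p q U r}.
  by move: gp; apply: ae_mono => r H rN; rewrite (H rN) (mass_f r rN).
have pNE r : 0 < r < N -> pN r = c * r ^+ n.-1.
  by move=> /andP[r0 rN]; rewrite /pN /radial_densityN rN /radial_density r0.
pose k s := n%:R * (V s * pN s) + s * (pN s * W s).
have mk : measurable_fun [set: mR] k by exact: L1_measurable iW.
have k0 s : s <= 0 -> k s = 0.
  move=> s0; have -> : k s = pN s * (n%:R * V s + s * W s) by rewrite /k; ring.
  rewrite /pN /radial_densityN density0 -?leNgt//.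
  by case: ifP => _; rewrite mul0r.
have rn r : r ^+ n = r * r ^+ n.-1 by rewrite -exprS prednK.
have E r : 0 < r < N0 -> prim k r = c * prim0 (moment psi n p q U) r.
  move=> /andP[r0 rN0].
  rewrite (@prim_prim0 k (fun s => c * moment psi n p q U s)) //.
  - rewrite /prim0 RintegralZl//; exact: moment_integrable.
  - apply: measurable_funM => //.
    apply: measurable_funS (moment_measurable hpsi n p1 q0 mUr UMall) => //.
    by move=> s; rewrite /= !in_itv/= andbT => /andP[].
  - move: VU Ws; apply: ae_mono2 => s H1 H2 s0 sr.
    have sN0 := le_lt_trans sr rN0; have sN := lt_trans sN0 N0N.
    rewrite /k /moment H1 ?s0// H2 ?s0// pNE ?s0// rn; ring.
move: EV VU; apply: ae_mono2 => r H1 H2 rN0.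
have [r0 rN0'] := andP rN0; have rN : 0 < r < N by rewrite r0 (lt_trans rN0').
have := H1 rN; rewrite -/k E// H2// pNE// => h.
have cn : c != 0 by rewrite gt_eqF.
by apply: (mulfI cn); rewrite -h rn; ring.
Qed.

End local.
End profile_equation.

(** * The C^1 representative of a radial solution *)

Section profile_ode.
Context {R : realType}.
Local Notation mR := (measurableTypeR R).
Local Notation mu := (@lebesgue_measure R).

Lemma ae_open_false (a b : R) : a < b -> ~ {ae mu, forall r : R, ~ (a < r < b)}.
Proof.
move=> ab [A [mA A0 sA]].
have : (mu (`]a, b[%classic : set mR) <= mu A)%E.
  apply: le_measure; rewrite ?inE//.
  by move=> s; rewrite /= in_itv/= => h; apply: sA => /=; apply.
have E := @lebesgue_measure_itv R `]a, b[.
by rewrite [X in (X <= _)%E]E /= lte_fin ab A0 -EFinB lee_fin leNgt subr_gt0 ab.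
Qed.

(** A strict violation at one point would persist on an interval, which is not null. *)
Lemma ae_continuous_le (f : R -> R) (a b C : R) :
  (forall r, a < r < b -> {for r, continuous f}) ->
  {ae mu, forall r, a < r < b -> f r <= C} -> forall r, a < r < b -> f r <= C.
Proof.
move=> cf fC r rab; rewrite leNgt; apply/negP => Cf.
have := cf r rab => /cvgr_gt /(_ _ Cf) /nbhs_ballP[d /= d0 dC].
have [ar rb] := andP rab.
pose a' := Num.max a (r - d); pose b' := Num.min b (r + d).
have ab' : a' < b'.
  rewrite /a' /b' gt_max !lt_min (lt_trans ar rb) /=.
  by apply/andP; split; [|apply/andP; split]; lra.
apply: (@ae_open_false a' b') => //; move: fC; apply: ae_mono => s H.
rewrite /a' /b' gt_max lt_min => /andP[/andP[as' ds] /andP[sb sd]].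
have h : C < f s.
  by apply: dC; rewrite /ball/= ltr_distlC; apply/andP; split; lra.
by move: h; rewrite ltNge H// as' sb.
Qed.

Variables (n : nat) (psi : R -> R) (p q : R) (U : R -> R).
Hypotheses (n0 : (0 < n)%N) (hpsi : model_function psi) (p1 : 1 < p) (q0 : 0 <= q)
  (hU : radial_solution n psi p q U).

Let mU : measurable_fun [set: mR] (fun r : R => U `|r| : mR).
Proof. by have [_ [mU _] _] := hU; exact: (measurable_profile n0 mU). Qed.

Let UM (N : R) : exists2 M, 0 < M &
  {ae mu, forall r : R, 0 < r -> r < N -> 0 < U `|r| <= M}.
Proof.
have [c c0 cE] := @polar_measure R n n0; have [U0 UL _] := hU.
exact: (profile_bounded c0 cE n0 N U0 UL).
Qed.

Let J := prim0 (moment psi n p q U).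

Let ae_J : {ae mu, forall r, 0 < r -> U `|r| * r ^+ n = J r}.
Proof.
have [c c0 cE] := @polar_measure R n n0; have [U0 UL [du [wdu weq]]] := hU.
have H (k : nat) : {ae mu, forall r : R, 0 < r < k.+1%:R -> U `|r| * r ^+ n = J r}.
  have [M M0 UMk] := UM (k.+2%:R).
  have k1 : 0 < k.+1%:R :> R by rewrite ltr0n.
  have k2 : k.+1%:R < k.+2%:R :> R by rewrite ltr_nat.
  have Hk := profile_local_ode c0 cE n0 hpsi p1 q0 UL wdu weq k1 k2 M0 UMk UM.
  exact: Hk.
have := ae_foralln H; apply: ae_mono => r H' r0.
apply: (H' (Num.truncn r)); rewrite r0 /=.
by have /andP[_] := truncn_itv (ltW r0).
Qed.

(** J is a primitive of a locally integrable function, so v is continuous before anything is known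
    about the regularity of U. *)
Let v r := J r / r ^+ n.

Let vU : {ae mu, forall r, 0 < r -> U `|r| = v r}.
Proof.
move: ae_J; apply: ae_mono => r H r0; rewrite /v -H// mulfK//.
by rewrite expf_neq0// gt_eqF.
Qed.

Let cv r : 0 < r -> {for r, continuous v}.
Proof.
move=> r0; apply: continuousM.
  by apply: prim0_continuous => //; exact: moment_integrable.
apply: continuousV; first by rewrite expf_neq0// gt_eqF.
exact: exprn_continuous.
Qed.

Let v_bounds (N : R) : exists2 M, 0 < M & forall r, 0 < r < N -> 0 <= v r <= M.
Proof.
have [M M0 H] := UM N; exists M => // r rN.
apply/andP; split.
  rewrite -oppr_le0; apply: (@ae_continuous_le (fun r => - v r) 0 N 0) => //.
  - by move=> s /andP[s0 _]; apply: continuousN; exact: cv.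
  - move: H vU; apply: ae_mono2 => s H1 H2 /andP[s0 sN]; rewrite -H2// oppr_le0 ltW//.
    by have /andP[] := H1 s0 sN.
apply: (@ae_continuous_le v 0 N M) => //.
- by move=> s /andP[s0 _]; exact: cv.
- move: H vU; apply: ae_mono2 => s H1 H2 /andP[s0 sN]; rewrite -H2//.
  by have /andP[] := H1 s0 sN.
Qed.

Let m2 s := n%:R * (s ^+ n.-1 * v s) - s ^+ n * slope psi n p q U s.

Let v_regular : regular0 v.
Proof.
split; first exact: cv.
move=> N; have [M M0 H] := v_bounds (N + 1); exists M => r /andP[r0 rN].
have /andP[h1 h2] : 0 <= v r <= M.
  by apply: H; rewrite r0 (le_lt_trans rN)// ltrDl.
by rewrite ger0_norm.
Qed.

Let id_regular k : regular0 (fun s : R => s ^+ k).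
Proof.
apply: (@regular0X _ id); split; first by move=> r _; exact: cvg_id.
by move=> N; exists N => r /andP[r0 rN]; rewrite gtr0_norm.
Qed.

Let regular0D (f g : R -> R) : regular0 f -> regular0 g -> regular0 (fun s => f s + g s).
Proof.
move=> [cf bf] [cg bg]; split=> [r r0|N].
  by apply: continuousD; [exact: cf|exact: cg].
have [C fC] := bf N; have [D gD] := bg N; exists (C + D) => r rN.
by rewrite (le_trans (ler_normD _ _))// lerD ?fC ?gD.
Qed.

Let cst_regular (a : R) : regular0 (fun=> a).
Proof.
split; first by move=> r _; exact: cst_continuous.
by move=> N; exists `|a| => r _.
Qed.

Let m2_regular : regular0 m2.
Proof.
have -> : m2 = (fun s => n%:R * (s ^+ n.-1 * v s) + (-1) * (s ^+ n * slope psi n p q U s)).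
  by apply/funext => s; rewrite /m2 mulN1r.
apply: regular0D; apply: regular0M; try exact: cst_regular; apply: regular0M => //.
exact: slope_regular0.
Qed.

(** Replacing U by v under the integral makes the integrand continuous: J, so far only continuous,
    is C^1. *)
Let JE r : J r = prim0 m2 r.
Proof.
rewrite /J /prim0 /Rintegral; congr fine; apply: ae_eq_integral => //.
- by have := measurable_int _ (moment_integrable hpsi n p1 q0 mU UM r).
- by have := measurable_int _ (regular0_integrable r m2_regular).
- move: vU; apply: ae_mono => s H; rewrite /= in_itv/= => /andP[s0 _].
  by rewrite /moment /m2 H.
Qed.

Let dv (r : R) : 0 < r -> is_derive r (1:R) v (- slope psi n p q U r).
Proof.
move=> r0.
have dJ : is_derive r (1:R) J (m2 r).
  by rewrite (_ : J = prim0 m2); [exact: is_derive_prim0|apply/funext => s; exact: JE].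
have rn : r ^+ n != 0 by rewrite expf_neq0// gt_eqF.
have dX : is_derive r (1:R) (fun s : R => s ^+ n) (n%:R * r ^+ n.-1).
  have d := @is_deriveX _ _ _ n r 1 _ (is_derive_id r 1).
  by have := d; rewrite exprfctE /GRing.scale/= mulr1.
have dV := @is_deriveV R (fun s => s ^+ n) r _ 1 rn dX.
have d := is_deriveM dJ dV.
apply: (is_derive_eq d); rewrite /GRing.scale/= /m2.
have JvE : J r = v r * r ^+ n by rewrite /v divfK.
have rE : r ^+ n = r * r ^+ n.-1 by rewrite -exprS prednK.
have rn1 : r ^+ n.-1 != 0 by rewrite expf_neq0// gt_eqF.
have rne : r != 0 by rewrite gt_eqF.
rewrite JvE !rE; field.
by rewrite rn1 rne.
Qed.

Lemma profile_ode : exists v M,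
  [/\ 0 < M, forall r, 0 < r -> 0 < v r <= M, {ae mu, forall r, 0 < r -> U r = v r} &
    forall r : R, 0 < r -> is_derive r (1:R) v
      (- (prim0 (fun s => v s `^ q * psi s ^+ n.-1) r / psi r ^+ n.-1) `^ (p - 1)^-1)].
Proof.
have vni : forall a b, 0 < a -> a <= b -> v b <= v a.
  apply: nonincreasing_gt0 dv _ => r r0.
  by rewrite oppr_le0 powR_ge0.
have v0 r : 0 < r -> 0 < v r.
  (* v is nonincreasing, so v r <= 0 would give U <= 0 almost everywhere on ]r, r + 1[. *)
  move=> r0; rewrite ltNge; apply/negP => vr.
  have [M M0 H] := UM (r + 1); apply: (@ae_open_false r (r + 1)); first by rewrite ltrDl.
  move: H vU; apply: ae_mono2 => s H1 H2 /andP[rs sr]; have s0 := lt_trans r0 rs.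
  have /andP[+ _] := H1 s0 sr; rewrite H2// ltNge => /negP; apply.
  by apply: le_trans vr; apply: vni => //; exact: ltW.
(* By monotonicity a bound near 0 is global: beyond 1 the values are at most v 1. *)
have [M M0 vM] := v_bounds 2.
exists v, M; apply: And4; first exact: M0.
- move=> r r0; rewrite v0//=; have [r1|r1] := leP r 1.
    by have /andP[] : 0 <= v r <= M by apply: vM; rewrite r0 (le_lt_trans r1)// ltr1n.
  apply: (@le_trans _ _ (v 1)); first by apply: vni => //; exact: ltW.
  by have /andP[] : 0 <= v 1 <= M by apply: vM; rewrite ltr01 ltr1n.
- by move: vU; apply: ae_mono => r H r0; rewrite -H// gtr0_norm.
- move=> r r0; have E : mass psi n q U r = prim0 (fun s => v s `^ q * psi s ^+ n.-1) r; last first.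
    by rewrite -E; exact: dv.
  rewrite /mass /prim0 /Rintegral; congr fine; apply: ae_eq_integral => //.
  + by have := measurable_int _ (mass_integrable hpsi n q0 mU UM r).
  + apply/measurable_EFinP; apply: measurable_funS (_ : measurable_fun (`]0%R, +oo[%classic : set mR) _) => //.
      by move=> s; rewrite /= !in_itv/= andbT => /andP[].
    apply: regular0_measurable; apply: regular0M.
      exact: regular0_powR.
    exact: (regular0X _ (model_regular0 hpsi)).
  + move: vU; apply: ae_mono => s H; rewrite /= in_itv/= => /andP[s0 _].
    by rewrite H.
Qed.

End profile_ode.

(** * Asymptotics *)

Section calculus.
Context {R : realType}.
Implicit Types (f g F G : R -> R) (x a b l : R).

Lemma is_derive_cast f x a b : is_derive x (1:R) f a -> a = b -> is_derive x (1:R) f b.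
Proof. by move=> d <-. Qed.

Lemma is_derive_mul f g x a b : is_derive x (1:R) f a -> is_derive x (1:R) g b ->
  is_derive x (1:R) (fun r => f r * g r) (a * g x + f x * b).
Proof.
move=> df dg; have d := is_deriveM df dg; apply: (is_derive_cast d).
by rewrite /GRing.scale/= addrC; congr (_ + _); rewrite mulrC.
Qed.

Lemma is_derive_add f g x a b : is_derive x (1:R) f a -> is_derive x (1:R) g b ->
  is_derive x (1:R) (fun r => f r + g r) (a + b).
Proof. by move=> df dg; exact: is_deriveD. Qed.

Lemma is_derive_sub f g x a b : is_derive x (1:R) f a -> is_derive x (1:R) g b ->
  is_derive x (1:R) (fun r => f r - g r) (a - b).
Proof. by move=> df dg; exact: is_deriveB. Qed.

Lemma is_derive_scale f x a c : is_derive x (1:R) f a ->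
  is_derive x (1:R) (fun r => c * f r) (c * a).
Proof.
move=> df; have d := is_derive_mul (is_derive_cst c x 1) df; apply: (is_derive_cast d).
by rewrite mul0r add0r.
Qed.

Lemma is_derive_inv g x b : g x != 0 -> is_derive x (1:R) g b ->
  is_derive x (1:R) (fun r => (g r)^-1) (- b / g x ^+ 2).
Proof.
move=> g0 dg; have d := @is_deriveV R g x b 1 g0 dg; apply: (is_derive_cast d).
by rewrite /GRing.scale/= mulrC mulrN mulNr.
Qed.

Lemma is_derive_div f g x a b : g x != 0 ->
  is_derive x (1:R) f a -> is_derive x (1:R) g b ->
  is_derive x (1:R) (fun r => f r / g r) ((a - f x / g x * b) / g x).
Proof.
move=> g0 df dg; have d := is_derive_mul df (is_derive_inv g0 dg).
by apply: (is_derive_cast d); field.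
Qed.

Lemma is_derive_powRc g x b c : 0 < g x -> is_derive x (1:R) g b ->
  is_derive x (1:R) (fun r => g r `^ c) (c * g x `^ (c - 1) * b).
Proof.
move=> g0 dg; have d1 := is_derive1_powR c g0.
by have d := is_derive1_comp d1 dg; exact: d.
Qed.

Lemma powR_div (c y : R) : 0 < y -> y `^ (c - 1) = y `^ c / y.
Proof.
move=> y0; rewrite powRD ?(gt_eqF y0) ?implybT// powRN powRr1//.
exact: ltW.
Qed.

Lemma is_derive_powR_log g x b c : 0 < g x -> is_derive x (1:R) g b ->
  is_derive x (1:R) (fun r => g r `^ c) (c * g x `^ c * (b / g x)).
Proof.
move=> g0 dg; apply: (is_derive_cast (is_derive_powRc c g0 dg)).
by rewrite powR_div//; ring.
Qed.

Lemma is_derive_pow g x b n : is_derive x (1:R) g b ->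
  is_derive x (1:R) (fun r => g r ^+ n) (n%:R * g x ^+ n.-1 * b).
Proof. by move=> dg; have := @is_deriveX _ _ _ n x 1 _ dg; rewrite exprfctE. Qed.

(** F - (L - e/2) G is nondecreasing and F - (L + e/2) G is nonincreasing near infinity; after
    division by G, which tends to +oo, their initial values are absorbed. *)
Lemma lhopital_pinfty F G (F' G' : R -> R) (a L : R) :
  (forall r, a < r -> is_derive r (1:R) F (F' r)) ->
  (forall r, a < r -> is_derive r (1:R) G (G' r)) ->
  (forall r, a < r -> 0 < G' r) -> G r @[r --> +oo] --> +oo ->
  F' r / G' r @[r --> +oo] --> L -> F r / G r @[r --> +oo] --> L.
Proof.
move=> dF dG G'0 Gy FG; apply/cvgrPdist_le => /= e e0.
have e20 : 0 < e / 2 by rewrite divr_gt0.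
have /cvgrPdist_le /(_ _ e20) [R0 [_ HR]] := FG.
pose b := Num.max R0 a.
have ineq r : b < r -> (L - e / 2) * G' r <= F' r <= (L + e / 2) * G' r.
  rewrite /b gt_max => /andP[rR ra]; have := HR _ rR; rewrite /= ler_distlC.
  by rewrite ler_pdivlMr ?G'0// ler_pdivrMr ?G'0.
have ba r : b < r -> a < r by rewrite /b gt_max => /andP[].
have n1 := @nondecreasing_gt0 _ (fun r => F r - (L - e / 2) * G r)
  (fun r => F' r - (L - e / 2) * G' r) b
  (fun r br => is_derive_sub (dF r (ba r br)) (is_derive_scale _ (dG r (ba r br)))).
have n2 := @nonincreasing_gt0 _ (fun r => F r - (L + e / 2) * G r)
  (fun r => F' r - (L + e / 2) * G' r) b
  (fun r br => is_derive_sub (dF r (ba r br)) (is_derive_scale _ (dG r (ba r br)))).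
have {}n1 := n1 (fun r br => ltac:(by rewrite subr_ge0; have /andP[] := ineq r br)).
have {}n2 := n2 (fun r br => ltac:(by rewrite subr_le0; have /andP[] := ineq r br)).
pose c := b + 1; have bc : b < c by rewrite ltrDl.
pose C := `|F c - (L - e / 2) * G c| + `|F c - (L + e / 2) * G c|.
have C0 : 0 <= C by rewrite addr_ge0.
have /cvgryPge /(_ (2 * C / e + 1)) Gbig := Gy.
near=> r.
have cr : c <= r by near: r; apply: nbhs_pinfty_ge; exact: num_real.
have Gr : 2 * C / e + 1 <= G r by near: r.
have G0 : 0 < G r.
  by apply: lt_le_trans Gr; rewrite ltr_pwDr// divr_ge0// ?mulr_ge0// ltW.
have CG : C <= e / 2 * G r.
  have : 2 * C / e <= G r by apply: le_trans Gr; rewrite lerDl.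
  by rewrite ler_pdivrMr// => h; lra.
have h1 : F c - (L - e / 2) * G c <= F r - (L - e / 2) * G r.
  exact: n1.
have h2 : F r - (L + e / 2) * G r <= F c - (L + e / 2) * G c.
  exact: n2.
have k1 : - C <= F c - (L - e / 2) * G c.
  by rewrite lerNl; apply: le_trans (ler_norm _) _; rewrite normrN /C lerDl.
have k2 : F c - (L + e / 2) * G c <= C.
  by apply: le_trans (ler_norm _) _; rewrite /C lerDr.
rewrite ler_distlC ler_pdivlMr// ler_pdivrMr//; apply/andP; split; nra.
Unshelve. all: by end_near. Qed.

(** Stands for F(0+) >= 0 when F has no meaningful value at 0: on ]0, r], F stays below F(r) and
    above - K s. *)
Lemma ge0_of_vanish F (K r : R) : 0 < r ->
  (forall s, 0 < s -> s <= r -> - (K * s) <= F s) ->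
  (forall s, 0 < s -> s <= r -> F s <= F r) -> 0 <= F r.
Proof.
move=> r0 FK Fr; rewrite leNgt; apply/negP => F0.
pose K' := `|K| + 1; have K'0 : 0 < K' by rewrite ltr_wpDl.
(* Small enough for K' s <= - F r / 2, which contradicts the two bounds at s. *)
pose s := Num.min r (- F r / (2 * K')).
have s0 : 0 < s by rewrite lt_min r0 divr_gt0 ?oppr_gt0// mulr_gt0.
have sr : s <= r by rewrite ge_min lexx.
have sK : s * (2 * K') <= - F r.
  by rewrite -ler_pdivlMr ?mulr_gt0// ge_min lexx orbT.
have := le_trans (FK s s0 sr) (Fr s s0 sr).
have : K * s <= K' * s.
  by apply: ler_wpM2r; [exact: ltW|rewrite (le_trans (ler_norm K))// lerDl].
nra.
Qed.

(** G^d is an integrating factor: with d e/2 in the place of e, the inequality makes (y - e/2) G^d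
    nonincreasing near infinity, and G^d -> +oo leaves y <= e. *)
Lemma decay_cvg0 (y y' G g : R -> R) (d : R) : 0 < d ->
  (forall r : R, 0 < r -> 0 <= y r) ->
  (forall r : R, 0 < r -> is_derive r (1:R) y (y' r)) ->
  (forall r : R, 0 < r -> is_derive r (1:R) G (g r)) ->
  (forall r : R, 0 < r -> 0 < G r) -> G r @[r --> +oo] --> +oo ->
  (forall e, 0 < e -> \forall r \near +oo, y' r <= g r / G r * (e - d * y r)) ->
  y r @[r --> +oo] --> (0 : R).
Proof.
move=> d0 y0 dy dG G0 Gy H; apply/cvgrPdist_le => /= e e0.
have e1 : 0 < d * (e / 2) by rewrite mulr_gt0// divr_gt0.
have [R0 [_ HR]] := H _ e1.
pose b := Num.max R0 0.
have b0 r : b < r -> 0 < r by rewrite /b gt_max => /andP[].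
pose F r := (y r - e / 2) * G r `^ d.
have dF (r : R) : b < r -> is_derive r (1:R) F
    (y' r * G r `^ d + (y r - e / 2) * (d * G r `^ d * (g r / G r))).
  move=> br; have r0 := b0 r br.
  have d1 := is_derive_sub (dy r r0) (is_derive_cst (e / 2) r 1).
  apply: (is_derive_cast (is_derive_mul d1 (is_derive_powR_log d (G0 r r0) (dG r r0)))).
  by rewrite subr0.
have ni : forall s t, b < s -> s <= t -> F t <= F s.
  apply: (nonincreasing_gt0 dF) => r br; have r0 := b0 r br.
  have rR : R0 < r by move: br; rewrite /b gt_max => /andP[].
  have h := HR r rR.
  have -> : y' r * G r `^ d + (y r - e / 2) * (d * G r `^ d * (g r / G r)) =
    G r `^ d * (y' r - g r / G r * (d * (e / 2) - d * y r)) by ring.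
  by apply: mulr_ge0_le0; [exact: powR_ge0|rewrite subr_le0].
pose c := b + 1; have bc : b < c by rewrite ltrDl.
pose C := `|F c| + 1; have C0 : 0 < C by rewrite ltr_wpDl.
have /cvgryPge /(_ ((2 * C / e) `^ d^-1)) Gbig := Gy.
near=> r.
have cr : c <= r by near: r; apply: nbhs_pinfty_ge; exact: num_real.
have br : b < r := lt_le_trans bc cr.
have r0 := b0 r br.
have Gr : (2 * C / e) `^ d^-1 <= G r by near: r.
have Gd : 2 * C / e <= G r `^ d.
  have C2 : 0 <= 2 * C / e by rewrite divr_ge0 ?mulr_ge0// ltW.
  have -> : 2 * C / e = ((2 * C / e) `^ d^-1) `^ d.
    by rewrite -powRrM mulVf ?gt_eqF// powRr1.
  by apply: ge0_ler_powR; rewrite ?nnegrE ?powR_ge0 ?(ltW d0) ?(ltW (G0 r r0)).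
have Gd0 : 0 < G r `^ d by rewrite powR_gt0// G0.
have Fr : F r <= C.
  apply: le_trans (ni c r bc cr) _; apply: le_trans (ler_norm _) _.
  by rewrite /C lerDl.
rewrite sub0r normrN ger0_norm ?y0//.
have : (y r - e / 2) * G r `^ d <= e / 2 * G r `^ d.
  apply: (le_trans Fr); move: Gd; rewrite ler_pdivrMr// => h; lra.
rewrite ler_pM2r//; lra.
Unshelve. all: by end_near. Qed.

Lemma cvg_powR (f : R -> R) (L c : R) : 0 < L -> f r @[r --> +oo] --> L ->
  f r `^ c @[r --> +oo] --> L `^ c.
Proof.
move=> L0 fL; have cc := is_derive_continuous (is_derive1_powR c L0).
exact: (cvg_comp _ _ fL cc).
Qed.

Lemma cvg_powR0 (f : R -> R) (c : R) : 0 < c -> (forall r : R, 0 < r -> 0 <= f r) ->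
  f r @[r --> +oo] --> (0 : R) -> f r `^ c @[r --> +oo] --> (0 : R).
Proof.
move=> c0 f0 fL; apply/cvgrPdist_le => /= e e0.
have e1 : 0 < e `^ c^-1 by rewrite powR_gt0.
have /cvgrPdist_le /(_ _ e1) fe := fL.
near=> r.
have r0 : 0 < r by near: r; apply: nbhs_pinfty_gt; exact: num_real.
rewrite sub0r normrN ger0_norm ?powR_ge0//.
have : `|0 - f r| <= e `^ c^-1 by near: r.
rewrite sub0r normrN ger0_norm ?f0// => h.
have -> : e = (e `^ c^-1) `^ c by rewrite -powRrM mulVf ?gt_eqF// powRr1// ltW.
by apply: ge0_ler_powR; rewrite ?nnegrE ?f0 ?(ltW c0) ?powR_ge0.
Unshelve. all: by end_near. Qed.

(** Near infinity F - (L - e) G is nonincreasing and F - (L + e) G is nondecreasing; both tend to 0,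
    which determines their signs. *)
Lemma lhopital0_pinfty F G (F' G' : R -> R) (a L : R) :
  (forall r, a < r -> is_derive r (1:R) F (- F' r)) ->
  (forall r, a < r -> is_derive r (1:R) G (- G' r)) ->
  (forall r, a < r -> 0 < G' r) -> (forall r, a < r -> 0 < G r) ->
  F r @[r --> +oo] --> (0 : R) -> G r @[r --> +oo] --> (0 : R) ->
  F' r / G' r @[r --> +oo] --> L -> F r / G r @[r --> +oo] --> L.
Proof.
move=> dF dG G'0 G0 F_0 G_0 FG; apply/cvgrPdist_le => /= e e0.
have /cvgrPdist_le /(_ _ e0) [R0 [_ HR]] := FG.
pose b := Num.max R0 a.
have ineq r : b < r -> (L - e) * G' r <= F' r <= (L + e) * G' r.
  rewrite /b gt_max => /andP[rR ra]; have := HR _ rR; rewrite /= ler_distlC.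
  by rewrite ler_pdivlMr ?G'0// ler_pdivrMr ?G'0.
have ba r : b < r -> a < r by rewrite /b gt_max => /andP[].
have dH (k r : R) : b < r -> is_derive r (1:R) (fun s => F s - k * G s) (- F' r - k * - G' r).
  by move=> /ba ar; exact: is_derive_sub (dF r ar) (is_derive_scale k (dG r ar)).
have cH k : F r - k * G r @[r --> +oo] --> (0 : R).
  have := cvgB F_0 (cvgMr (a := k) G_0); rewrite mulr0 subr0; exact.
near=> r.
have br : b < r by near: r; apply: nbhs_pinfty_gt; exact: num_real.
have Gr : 0 < G r by exact/G0/ba.
have h1 : 0 <= F r - (L - e) * G r.
  apply: (cvgr_to_le (cH (L - e))); near=> s.
  apply: (nonincreasing_gt0 (dH (L - e))); [|exact: br|].
    move=> t bt; have /andP[h _] := ineq t bt; lra.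
  by near: s; apply: nbhs_pinfty_ge; exact: num_real.
have h2 : F r - (L + e) * G r <= 0.
  apply: (cvgr_to_ge (cH (L + e))); near=> s.
  apply: (nondecreasing_gt0 (dH (L + e))); [|exact: br|].
    move=> t bt; have /andP[_ h] := ineq t bt; lra.
  by near: s; apply: nbhs_pinfty_ge; exact: num_real.
rewrite ler_distlC ler_pdivlMr// ler_pdivrMr//; apply/andP; split; lra.
Unshelve. all: by end_near. Qed.

End calculus.

Section improper_integrals.
Context {R : realType}.
Local Notation mR := (measurableTypeR R).
Local Notation mu := (@lebesgue_measure R).
Variable (g : R -> R).
Hypotheses (rg : regular0 g) (g0 : forall r, 0 < r -> 0 <= g r).

Let cvg_nat : (prim0 g k%:R)%:E @[k --> \oo] --> (\int[mu]_(s in `]0%R, +oo[) (g s)%:E)%E.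
Proof.
have U : (`]0, +oo[%classic : set mR) = \bigcup_k (`]0, k%:R]%classic : set mR).
  apply/seteqP; split => r; rewrite /= in_itv/=; last first.
    by move=> [k _]; rewrite /= in_itv/= => /andP[->].
  rewrite andbT => r0; exists (Num.truncn r).+1 => //=.
  by rewrite in_itv/= r0 ltW// truncnS_gt.
rewrite U.
have E k : (prim0 g k%:R)%:E = (\int[mu]_(s in `]0%R, k%:R]) (g s)%:E)%E.
  rewrite /prim0 /Rintegral fineK//.
  exact: (@integrable_fin_num _ _ _ mu _ (measurable_itv `]0, k%:R]) _ (regular0_integrable _ rg)).
under eq_cvg do rewrite E.
apply: (@ge0_nondecreasing_set_cvg_integral _ mR R (fun k => `]0%R, k%:R]%classic) (EFin \o g) mu).
- move=> k m km; apply/subsetPset => r; rewrite /= !in_itv/= => /andP[-> /le_trans]; apply.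
  by rewrite ler_nat.
- by [].
- by move=> k; have := measurable_int _ (regular0_integrable k%:R rg).
- by move=> k r; rewrite /= in_itv/= => /andP[r0 _]; rewrite lee_fin g0.
Qed.

Let prim0_le (r s : R) : 0 < r -> r <= s -> prim0 g r <= prim0 g s.
Proof. by apply: (nondecreasing_gt0 (fun t t0 => is_derive_prim0 rg t0)). Qed.

Lemma prim0_bounded_integrable (B : R) : (forall r, 0 < r -> prim0 g r <= B) ->
  mu.-integrable `]0, +oo[ (EFin \o g).
Proof.
move=> gB; apply/integrableP; split.
  by apply/measurable_EFinP; exact: regular0_measurable.
have -> : (\int[mu]_(x in `]0%R, +oo[) `|(EFin \o g) x| = \int[mu]_(x in `]0%R, +oo[) (g x)%:E)%E.
  apply: eq_integral; by move=> r; rewrite inE/= in_itv/= andbT => r0; rewrite /= ger0_norm// g0.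
have <- := cvg_lim _ cvg_nat; last by [].
(* The bound B is given for r > 0, so the term k = 0 of the sequence is treated apart. *)
apply: (@le_lt_trans _ _ (Num.max B (prim0 g 0))%:E); last exact: ltry.
apply: lime_le; first by apply/cvg_ex; eexists; exact: cvg_nat.
near=> k; rewrite lee_fin le_max; have [->|k0] := posnP k; first by rewrite lexx orbT.
by rewrite gB// ltr0n.
Unshelve. all: by end_near. Qed.

Lemma prim0_cvg : mu.-integrable `]0, +oo[ (EFin \o g) ->
  prim0 g r @[r --> +oo] --> \int[mu]_(s in `]0, +oo[) g s.
Proof.
move=> ig; set I := (X in _ --> X).
have cI : prim0 g k%:R @[k --> \oo] --> I.
  have := cvg_nat; have fin : (\int[mu]_(s in `]0%R, +oo[) (g s)%:E)%E \is a fin_num.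
    exact: (@integrable_fin_num _ _ _ mu _ (measurable_itv `]0, +oo[) _ ig).
  by rewrite -(fineK fin) => /fine_cvg.
have le_I (r : R) : 0 < r -> prim0 g r <= I.
  move=> r0; apply: (cvgr_to_ge cI); near=> k; apply: prim0_le => //.
  by near: k; exact: nbhs_infty_ger.
apply/cvgrPdist_le => /= e e0.
have /cvgrPdist_le /(_ _ e0) [k _ Hk] := cI.
near=> r.
have r0 : 0 < r by near: r; apply: nbhs_pinfty_gt; exact: num_real.
have kr : k.+1%:R <= r by near: r; apply: nbhs_pinfty_ge; exact: num_real.
have := Hk k.+1 (leqnSn k); rewrite /= ler_distlC => /andP[h1 _].
have h2 : prim0 g k.+1%:R <= prim0 g r by apply: prim0_le => //; rewrite ltr0n.
have := le_I r r0 => h3.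
rewrite ler_distlC; apply/andP; split; lra.
Unshelve. all: by end_near. Qed.

(** [prim0 g] is nondecreasing: either it passes every B, or it is bounded and g is integrable. *)
Lemma prim0_cvgy : ~ mu.-integrable `]0, +oo[ (EFin \o g) ->
  prim0 g r @[r --> +oo] --> +oo.
Proof.
move=> nig; apply/cvgryPge => B.
have [[r [r0 Br]]|H] := pselect (exists r : R, 0 < r /\ B <= prim0 g r).
  near=> s; apply: (le_trans Br); apply: prim0_le; first exact: r0.
  by near: s; apply: nbhs_pinfty_ge; exact: num_real.
exfalso; apply: nig; apply: (@prim0_bounded_integrable B) => r r0.
by rewrite leNgt; apply/negP => h; apply: H; exists r; split => //; exact: ltW.
Unshelve. all: by end_near. Qed.

Lemma prim0_tail (r : R) : mu.-integrable `]0, +oo[ (EFin \o g) -> 0 < r ->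
  \int[mu]_(s in `]r, +oo[) g s = \int[mu]_(s in `]0, +oo[) g s - prim0 g r.
Proof.
move=> ig r0; rewrite /prim0 Rintegral_itvB// bnd_simp.
by rewrite ltW.
Qed.

End improper_integrals.

(** * Volume and area of geodesic balls in the model manifold *)

Section model_volume.
Context {R : realType}.
Local Notation mR := (measurableTypeR R).
Local Notation mu := (@lebesgue_measure R).
Variables (n : nat) (psi f1 : R -> R).
Hypotheses (n1 : (1 < n)%N) (hpsi : model_function psi)
  (dpsi : forall r : R, 0 < r -> is_derive r (1:R) psi (f1 r))
  (f1_ge1 : forall r : R, 0 < r -> 1 <= f1 r)
  (f1_le : forall r s : R, 0 < r -> r <= s -> f1 r <= f1 s)
  (psi_ge : forall r : R, 0 < r -> r <= psi r)
  (psi_le : forall r s : R, 0 < r -> r <= s -> psi r <= psi s)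
  (psi_mul : forall r : R, 0 < r -> psi r <= r * f1 r).

Definition area r := psi r ^+ n.-1.
Definition Vol := prim0 area.
(** With f1 = psi', the logarithmic derivative of [area]: the mean curvature of the geodesic
    sphere. *)
Definition drift r := (n.-1)%:R * (f1 r / psi r).

Lemma psi_gt0 (r : R) : 0 < r -> 0 < psi r.
Proof. by move=> r0; exact: lt_le_trans r0 (psi_ge r0). Qed.

Lemma area_gt0 (r : R) : 0 < r -> 0 < area r.
Proof. by move=> r0; rewrite exprn_gt0// psi_gt0. Qed.

Lemma area_le (r s : R) : 0 < r -> r <= s -> area r <= area s.
Proof.
move=> r0 rs; rewrite /area lerXn2r ?nnegrE ?(ltW (psi_gt0 _))//; last exact: psi_le.
exact: lt_le_trans rs.
Qed.

Lemma regular0_area : regular0 area.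
Proof. exact: regular0X (model_regular0 hpsi). Qed.

Lemma is_derive_area (r : R) : 0 < r -> is_derive r (1:R) area (drift r * area r).
Proof.
move=> r0; apply: (is_derive_cast (is_derive_pow n.-1 (dpsi r0))).
rewrite /area /drift; case: n n1 => // -[//|k] _ /=.
by rewrite exprS; field; rewrite gt_eqF// psi_gt0.
Qed.

Lemma is_derive_Vol (r : R) : 0 < r -> is_derive r (1:R) Vol (area r).
Proof. by move=> r0; apply: is_derive_prim0 => //; exact: regular0_area. Qed.

Lemma Vol_gt0 (r : R) : 0 < r -> 0 < Vol r.
Proof. by move=> r0; apply: prim0_gt0 => //; [exact: regular0_area|exact: area_gt0]. Qed.

Lemma Vol_le (r : R) : 0 < r -> Vol r <= r * area r.
Proof.
move=> r0; rewrite mulrC; apply: le_trans (ler_norm _) _.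
apply: (@prim0_bound _ _ r) => //; [exact: regular0_area|exact/ltW/area_gt0| |by rewrite r0 lexx].
move=> s /andP[s0 sr]; rewrite ger0_norm; first exact: area_le.
exact/ltW/area_gt0.
Qed.

Lemma ThetaE (r : R) : 0 < r -> Theta n psi r = Vol r / area r.
Proof.
move=> r0; rewrite /Theta /Vol /prim0 Rintegral_itv_obnd_cbnd//.
exact: (regular0_integrable r regular0_area).
Qed.

(** Agrees with [Theta] for r > 0, and is built on [prim0], whose derivative is at hand. *)
Definition theta r := Vol r / area r.

Lemma theta_gt0 (r : R) : 0 < r -> 0 < theta r.
Proof. by move=> r0; rewrite divr_gt0 ?Vol_gt0 ?area_gt0. Qed.

Lemma theta_le (r : R) : 0 < r -> theta r <= r.
Proof. by move=> r0; rewrite ler_pdivrMr ?area_gt0// Vol_le. Qed.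

Lemma is_derive_theta (r : R) : 0 < r -> is_derive r (1:R) theta (1 - drift r * theta r).
Proof.
move=> r0; have a0 := area_gt0 r0; have an0 : area r != 0 by rewrite gt_eqF.
apply: (is_derive_cast (is_derive_div an0 (is_derive_Vol r0) (is_derive_area r0))).
by rewrite /theta; field.
Qed.

Lemma regular0_theta : regular0 theta.
Proof.
split=> [r r0|N]; first exact: is_derive_continuous (is_derive_theta r0).
exists N => r /andP[r0 rN]; rewrite ger0_norm; last exact/ltW/theta_gt0.
exact: le_trans (theta_le r0) rN.
Qed.

(* psi ^ n = n * \int psi ^ (n - 1) * psi' and psi' is nondecreasing. *)
Lemma psi_pow_le (r : R) : 0 < r -> psi r ^+ n <= n%:R * f1 r * Vol r.
Proof.
move=> r0; rewrite -subr_ge0.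
pose F s := n%:R * f1 r * Vol s - psi s ^+ n.
have dF (s : R) : 0 < s -> is_derive s (1:R) F (n%:R * (f1 r - f1 s) * area s).
  move=> s0; apply: (is_derive_cast (is_derive_sub
    (is_derive_scale _ (is_derive_Vol s0)) (is_derive_pow n (dpsi s0)))).
  by rewrite /area; ring.
have nd (s : R) : 0 < s -> s <= r -> F s <= F r.
  move=> s0 sr.
  have [||x xab E] := @MVT_segment _ F (fun s => n%:R * (f1 r - f1 s) * area s) s r sr.
  - move=> x; rewrite in_itv/= => /andP[sx xr]; apply: dF; exact: lt_trans sx.
  - apply: derivable_within_continuous => x; rewrite in_itv/= => /andP[sx xr].
    by have [] := dF x (lt_le_trans s0 sx).
  move: xab; rewrite in_itv/= => /andP[sx xr]; have x0 := lt_le_trans s0 sx.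
  rewrite -subr_ge0 E; apply: mulr_ge0; last by rewrite subr_ge0.
  apply: mulr_ge0; last exact/ltW/area_gt0.
  by rewrite mulr_ge0// subr_ge0 f1_le.
(* For s <= r, psi(s)^n = area(s) psi(s) <= area(r) s psi'(r), which supplies the constant. *)
apply: (@ge0_of_vanish _ F (area r * f1 r)) => // s s0 sr.
apply: (@le_trans _ _ (- psi s ^+ n)).
  rewrite lerN2 -mulrA (_ : psi s ^+ n = area s * psi s); last first.
    by rewrite /area mulrC -exprS prednK// ltnW.
  apply: ler_pM; [exact/ltW/area_gt0|exact/ltW/psi_gt0|exact: area_le|].
  apply: le_trans (psi_mul s0) _; rewrite mulrC; apply: ler_wpM2r; first exact: ltW.
  exact: f1_le.
rewrite /F lerDr.
by rewrite -mulrA mulr_ge0// mulr_ge0//; [rewrite (le_trans ler01)// f1_ge1|exact/ltW/Vol_gt0].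
Qed.

Lemma area_ge1 (r : R) : 1 < r -> 1 <= area r.
Proof.
move=> r1; rewrite /area exprn_ege1// (le_trans (ltW r1))// psi_ge//.
exact: lt_trans r1.
Qed.

Lemma Vol_cvgy : Vol r @[r --> +oo] --> +oo.
Proof.
have nd := @nondecreasing_gt0 _ (fun r => Vol r - r) (fun r => area r - 1) 1
  (fun r r1 => is_derive_sub (is_derive_Vol (lt_trans ltr01 r1)) (is_derive_id r 1))
  (fun r r1 => ltac:(by rewrite subr_ge0 area_ge1)).
apply/cvgryPge => B; near=> r.
have r2 : 2 <= r by near: r; apply: nbhs_pinfty_ge; exact: num_real.
have rB : B + 2 <= r by near: r; apply: nbhs_pinfty_ge; exact: num_real.
have := nd 2 r (ltr1n _ _ : 1 < 2) r2.
have : 0 < Vol 2 by exact: Vol_gt0.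
lra.
Unshelve. all: by end_near. Qed.

(** L'Hopital's rule for r^gamma [area] / [Vol]: the quotient of derivatives is gamma r^(gamma-1) +
    (n-1) r^gamma psi'/psi, whose first term vanishes at infinity because gamma < 1. Then [theta]
    [drift] is a quotient of two functions with the same limit (n-1) ell. *)
Lemma drift_theta_power (gamma ell : R) : 0 <= gamma -> gamma < 1 -> 0 < ell ->
  r `^ gamma * f1 r / psi r @[r --> +oo] --> ell ->
  theta r * drift r @[r --> +oo] --> (1 : R).
Proof.
move=> g0 g1 l0 hl.
have n10 : 0 < (n.-1)%:R :> R by rewrite ltr0n -subn1 subn_gt0.
have r0 : r `^ (gamma - 1) @[r --> +oo] --> (0 : R).
  have rV : r^-1 @[r --> +oo] --> (0 : R).
    by apply/gtr0_cvgV0; [near=> r; near: r; apply: nbhs_pinfty_gt; exact: num_real|exact: cvg_id].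
  have H : r^-1 `^ (1 - gamma) @[r --> +oo] --> (0 : R).
    by apply: cvg_powR0 rV; [rewrite subr_gt0|move=> r r0; rewrite invr_ge0 ltW].
  apply: cvg_trans H.
  apply: near_eq_cvg; near=> r.
  have r0 : 0 < r by near: r; apply: nbhs_pinfty_gt; exact: num_real.
  by rewrite -(powR_inv1 (ltW r0)) -powRrM; congr (_ `^ _); ring.
have F : r `^ gamma * area r / Vol r @[r --> +oo] --> (n.-1)%:R * ell.
  apply: (@lhopital_pinfty _ _ _
    (fun r => gamma * r `^ (gamma - 1) * area r + r `^ gamma * (drift r * area r)) area 0) => //.
  - move=> r r1; apply: is_derive_mul; last exact: is_derive_area.
    by apply: is_derive_cast (is_derive_powRc gamma r1 (is_derive_id r 1)) _; rewrite mulr1.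
  - exact: is_derive_Vol.
  - exact: area_gt0.
  - exact: Vol_cvgy.
  have h : gamma * r `^ (gamma - 1) + (n.-1)%:R * (r `^ gamma * f1 r / psi r) @[r --> +oo]
      --> (gamma * 0 + (n.-1)%:R * ell : R).
    by apply: cvgD; apply: cvgM; [exact: cvg_cst|exact: r0|exact: cvg_cst|exact: hl].
  rewrite mulr0 add0r in h; apply: cvg_trans h; apply: near_eq_cvg; near=> r.
  have r1 : 0 < r by near: r; apply: nbhs_pinfty_gt; exact: num_real.
  have ar := area_gt0 r1; have pr := psi_gt0 r1.
  by rewrite /= /drift; field; rewrite !gt_eqF.
have nl : (n.-1)%:R * ell != 0 by rewrite mulf_neq0// gt_eqF.
have h : (n.-1)%:R * (r `^ gamma * f1 r / psi r) * (r `^ gamma * area r / Vol r)^-1 @[r --> +oo]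
    --> ((n.-1)%:R * ell * ((n.-1)%:R * ell)^-1 : R).
  by apply: cvgM; [apply: cvgM; [exact: cvg_cst|exact: hl]|exact: (cvgV nl F)].
rewrite mulfV// in h; apply: cvg_trans h; apply: near_eq_cvg; near=> r.
have r1 : 0 < r by near: r; apply: nbhs_pinfty_gt; exact: num_real.
have ar := area_gt0 r1; have pr := psi_gt0 r1; have Vr := Vol_gt0 r1.
have rg : 0 < r `^ gamma by rewrite powR_gt0.
by rewrite /= /drift /theta; field; rewrite !gt_eqF.
Unshelve. all: by end_near. Qed.

(** As before, with psi/psi' in the place of r^gamma. The quotient of derivatives is n - 1 minus
    (psi/psi') (log(psi'/psi))', the quantity assumed to tend to 0. *)
Lemma drift_theta_log (f2 : R -> R) : (forall r : R, 0 < r -> is_derive r (1:R) f1 (f2 r)) ->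
  psi r / f1 r * ((f2 r - f1 r / psi r * f1 r) / f1 r) @[r --> +oo] --> (0 : R) ->
  theta r * drift r @[r --> +oo] --> (1 : R).
Proof.
move=> df1 hl.
have n10 : 0 < (n.-1)%:R :> R by rewrite ltr0n -subn1 subn_gt0.
have f10 r : 0 < r -> 0 < f1 r by move=> r0; apply: lt_le_trans (f1_ge1 r0).
have F : area r * (psi r / f1 r) / Vol r @[r --> +oo] --> ((n.-1)%:R : R).
  apply: (@lhopital_pinfty _ _ _
    (fun r => drift r * area r * (psi r / f1 r) + area r * ((f1 r - psi r / f1 r * f2 r) / f1 r)) area 0) => //.
  - move=> r r1; apply: is_derive_mul; first exact: is_derive_area.
    by apply: is_derive_div; [rewrite gt_eqF// f10|exact: dpsi|exact: df1].
  - exact: is_derive_Vol.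
  - exact: area_gt0.
  - exact: Vol_cvgy.
  have h : (n.-1)%:R - psi r / f1 r * ((f2 r - f1 r / psi r * f1 r) / f1 r) @[r --> +oo]
      --> ((n.-1)%:R - 0 : R).
    by apply: cvgB => //; exact: cvg_cst.
  rewrite subr0 in h; apply: cvg_trans h; apply: near_eq_cvg; near=> r.
  have r1 : 0 < r by near: r; apply: nbhs_pinfty_gt; exact: num_real.
  have ar := area_gt0 r1; have pr := psi_gt0 r1; have fr := f10 r r1.
  by rewrite /= /drift; field; rewrite !gt_eqF.
have nl : (n.-1)%:R != 0 :> R by rewrite gt_eqF.
have h : (n.-1)%:R * (area r * (psi r / f1 r) / Vol r)^-1 @[r --> +oo]
    --> ((n.-1)%:R * (n.-1)%:R^-1 : R).
  by apply: cvgM; [exact: cvg_cst|exact: (cvgV nl F)].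
rewrite mulfV// in h; apply: cvg_trans h; apply: near_eq_cvg; near=> r.
have r1 : 0 < r by near: r; apply: nbhs_pinfty_gt; exact: num_real.
have ar := area_gt0 r1; have pr := psi_gt0 r1; have Vr := Vol_gt0 r1; have fr := f10 r r1.
by rewrite /= /drift /theta; field; rewrite !gt_eqF.
Unshelve. all: by end_near. Qed.

End model_volume.

(** * Estimates and limits for the profile *)

Section solution_profile.
Context {R : realType}.
Local Notation mR := (measurableTypeR R).
Local Notation mu := (@lebesgue_measure R).
Variables (n : nat) (psi f1 : R -> R) (p q M : R) (v : R -> R).
Hypotheses (n1 : (1 < n)%N) (hpsi : model_function psi)
  (dpsi : forall r : R, 0 < r -> is_derive r (1:R) psi (f1 r))
  (f1_ge1 : forall r : R, 0 < r -> 1 <= f1 r)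
  (f1_le : forall r s : R, 0 < r -> r <= s -> f1 r <= f1 s)
  (psi_ge : forall r : R, 0 < r -> r <= psi r)
  (psi_le : forall r s : R, 0 < r -> r <= s -> psi r <= psi s)
  (psi_mul : forall r : R, 0 < r -> psi r <= r * f1 r).
Let P := prim0 (fun s => v s `^ q * psi s ^+ n.-1).
Let W1 r := P r / psi r ^+ n.-1.
Let w r := W1 r `^ (p - 1)^-1.
Hypotheses (p1 : 1 < p) (pn : p < n%:R) (hq : n%:R * p / (n%:R - p) - 1 <= q)
  (M0 : 0 < M) (vM : forall r, 0 < r -> 0 < v r <= M)
  (dv : forall r : R, 0 < r -> is_derive r (1:R) v (- w r)).

Let A := area n psi.
Let Psi := Vol n psi.
Let Th := theta n psi.
Let b := drift n psi f1.
Let kappa := (q + 1 - p) / (p - 1).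

Let A0 r : 0 < r -> 0 < A r.
Proof. exact: area_gt0. Qed.
Let v0 r : 0 < r -> 0 < v r.
Proof. by move=> /vM /andP[]. Qed.
Let n0 : 0 < n%:R :> R. Proof. by rewrite ltr0n ltnW. Qed.
Let p0 : 0 < p. Proof. exact: lt_trans p1. Qed.

Lemma exponent_bound : n%:R / (n%:R - p) * p <= q + 1.
Proof. by rewrite -lerBlDr mulrAC. Qed.

Lemma exponent_gt : p < q + 1.
Proof.
apply: lt_le_trans exponent_bound; rewrite ltr_pMl// ltr_pdivlMr ?subr_gt0//.
by rewrite mul1r ltrBlDr ltrDl.
Qed.

Let q0 : 0 < q. Proof. by have := lt_trans p1 exponent_gt; rewrite ltrDr. Qed.
Let pm : 0 < p - 1. Proof. by rewrite subr_gt0. Qed.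
Let pm0 : p - 1 != 0. Proof. by rewrite gt_eqF. Qed.
Let kappa0 : 0 < kappa. Proof. by rewrite divr_gt0// subr_gt0 exponent_gt. Qed.

Lemma regular0_v : regular0 v.
Proof.
split=> [r r0|N]; first exact: is_derive_continuous (dv r0).
by exists M => r /andP[r0 _]; have /andP[? ?] := vM r0; rewrite gtr0_norm.
Qed.

Lemma regular0_P : regular0 (fun s => v s `^ q * psi s ^+ n.-1).
Proof.
apply: regular0M; last exact: regular0_area.
by apply: regular0_powR; [exact: ltW|exact: v0|exact: regular0_v].
Qed.

Lemma is_derive_P (r : R) : 0 < r -> is_derive r (1:R) P (v r `^ q * A r).
Proof. by move=> r0; apply: is_derive_prim0 => //; exact: regular0_P. Qed.

Lemma P_gt0 (r : R) : 0 < r -> 0 < P r.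
Proof.
move=> r0; apply: prim0_gt0 => //; first exact: regular0_P.
by move=> s s0; rewrite mulr_gt0 ?powR_gt0 ?v0//; exact: A0.
Qed.

Lemma W1_gt0 (r : R) : 0 < r -> 0 < W1 r.
Proof. by move=> r0; apply: divr_gt0; [exact: P_gt0|exact: A0]. Qed.

Lemma w_gt0 (r : R) : 0 < r -> 0 < w r.
Proof. by move=> r0; rewrite powR_gt0// W1_gt0. Qed.

Lemma v_nonincreasing (r s : R) : 0 < r -> r <= s -> v s <= v r.
Proof. apply: (nonincreasing_gt0 dv) => t t0; rewrite oppr_le0; exact/ltW/w_gt0. Qed.

Lemma P_ge (r : R) : 0 < r -> v r `^ q * Psi r <= P r.
Proof.
move=> r0; rewrite /Psi /Vol /P /prim0.
rewrite -RintegralZl//; last exact: (regular0_integrable r (regular0_area n hpsi)).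
apply: le_Rintegral => //.
- have i := regular0_integrable r (regular0_area n hpsi).
  exact: (@integrableZl _ _ _ mu _ (measurable_itv `]0, r]) _ _ i).
- exact: (regular0_integrable r regular0_P).
- move=> s; rewrite /= in_itv/= => /andP[s0 sr]; apply: ler_wpM2r; first exact/ltW/A0.
  apply: ge0_ler_powR; rewrite ?nnegrE ?(ltW q0)//; [exact/ltW/v0|exact/ltW/v0|].
  exact: v_nonincreasing.
Qed.

Lemma P_le (N : R) : 0 < N -> forall r, 0 < r <= N -> P r <= M `^ q * A r * r.
Proof.
move=> N0 r /andP[r0 rN]; apply: le_trans (ler_norm _) _.
apply: (@prim0_bound _ _ r) => //; [exact: regular0_P| | |by rewrite r0 lexx].
  by rewrite mulr_ge0 ?powR_ge0// ltW// A0.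
move=> s /andP[s0 sr]; rewrite ger0_norm; last first.
  by rewrite mulr_ge0 ?powR_ge0//; exact/ltW/A0.
apply: ler_pM; rewrite ?powR_ge0//; [exact/ltW/A0| |exact: area_le].
have /andP[vs sM] := vM s0.
by apply: ge0_ler_powR; rewrite ?nnegrE ?(ltW q0) ?(ltW vs) ?(ltW M0).
Qed.

Let tp r := Th r `^ (p - 1)^-1.
Let T := prim0 tp.

Lemma regular0_tp : regular0 tp.
Proof.
apply: regular0_powR; [by rewrite invr_ge0 ltW| |exact: regular0_theta].
exact: theta_gt0.
Qed.

Lemma tp_gt0 (r : R) : 0 < r -> 0 < tp r.
Proof. by move=> r0; rewrite powR_gt0//; exact: theta_gt0. Qed.

Lemma is_derive_T (r : R) : 0 < r -> is_derive r (1:R) T (tp r).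
Proof. by move=> r0; apply: is_derive_prim0 => //; exact: regular0_tp. Qed.

Lemma T_gt0 (r : R) : 0 < r -> 0 < T r.
Proof. by move=> r0; apply: prim0_gt0 => //; [exact: regular0_tp|exact: tp_gt0]. Qed.

Lemma w_tp (r : R) : 0 < r -> w r = (P r / Psi r) `^ (p - 1)^-1 * tp r.
Proof.
move=> r0; rewrite /w /tp -powRM; first last.
- exact/ltW/theta_gt0.
- by rewrite divr_ge0 ?(ltW (P_gt0 _))//; exact/ltW/Vol_gt0.
congr (_ `^ _); rewrite /W1 /Th /theta mulrA divfK// gt_eqF//.
exact: Vol_gt0.
Qed.

Lemma is_derive_vkappa (r : R) : 0 < r ->
  is_derive r (1:R) (fun r => v r `^ (- kappa))
    (kappa * ((P r / (v r `^ q * Psi r)) `^ (p - 1)^-1 * tp r)).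
Proof.
move=> r0; apply: (is_derive_cast (is_derive_powR_log (- kappa) (v0 r0) (dv r0))).
have vr := v0 r0; have Psi0 : 0 < Psi r by exact: Vol_gt0.
rewrite w_tp//.
have -> : P r / (v r `^ q * Psi r) = v r `^ (- q) * (P r / Psi r).
  by rewrite powRN; field; rewrite !gt_eqF// powR_gt0.
have PP : 0 <= P r / Psi r by apply/ltW/divr_gt0 => //; exact: P_gt0.
rewrite [in RHS]powRM ?powR_ge0//.
rewrite -powRrM.
(* This identity fixes the value of kappa: differentiating v^-kappa must produce the power
   v^(-q/(p-1)). *)
have -> : - q * (p - 1)^-1 = - kappa - 1 by rewrite /kappa; field.
by rewrite powR_div//; ring.
Qed.

Lemma vkappa_ge (r : R) : 0 < r -> kappa * T r <= v r `^ (- kappa).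
Proof.
move=> r0; rewrite -subr_ge0.
pose F s := v s `^ (- kappa) - kappa * T s.
have dF (s : R) : 0 < s -> is_derive s (1:R) F
    (kappa * ((P s / (v s `^ q * Psi s)) `^ (p - 1)^-1 * tp s) - kappa * tp s).
  by move=> s0; exact: is_derive_sub (is_derive_vkappa s0) (is_derive_scale _ (is_derive_T s0)).
(* The difference is at least - kappa T(s), and T(s) <= r^(1/(p-1)) s because theta <= r on ]0,
   r]. *)
apply: (@ge0_of_vanish _ F (kappa * r `^ (p - 1)^-1)) => // s s0 sr.
  apply: (@le_trans _ _ (- (kappa * T s))); last by rewrite /F lerDr powR_ge0.
  rewrite lerN2 -mulrA; apply: ler_wpM2l; first exact: ltW.
  apply: le_trans (ler_norm _) _; apply: (@prim0_bound _ _ r) => //.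
  - exact: regular0_tp.
  - exact: powR_ge0.
  - move=> t /andP[t0 tr]; rewrite ger0_norm ?powR_ge0//.
    apply: ge0_ler_powR; rewrite ?nnegrE ?invr_ge0 ?(ltW pm) ?(ltW r0)//.
      exact/ltW/theta_gt0.
    by apply: le_trans tr; exact: theta_le.
  - by rewrite s0.
apply: (nondecreasing_gt0 dF) => // t t0.
rewrite -mulrBr; apply: mulr_ge0; first exact: ltW.
rewrite subr_ge0 ler_peMl ?(ltW (tp_gt0 t0))//.
have h : 1 <= P t / (v t `^ q * Psi t).
  rewrite ler_pdivlMr ?mul1r ?P_ge// mulr_gt0 ?powR_gt0 ?v0//; exact: Vol_gt0.
apply: (@le_trans _ _ (1 `^ (p - 1)^-1)); first by rewrite powR1.
apply: ge0_ler_powR; rewrite ?nnegrE ?invr_ge0 ?(ltW pm)//.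
exact: le_trans h.
Qed.

Lemma is_derive_W1 (r : R) : 0 < r -> is_derive r (1:R) W1 (v r `^ q - b r * W1 r).
Proof.
move=> r0; have a0 : A r != 0 by rewrite gt_eqF// A0.
have dA : is_derive r (1:R) A (b r * A r) by exact: is_derive_area.
apply: (is_derive_cast (is_derive_div a0 (is_derive_P r0) dA)).
by rewrite /W1 -/(area n psi r) -/(A r); field.
Qed.

(** [psi_pow_le] multiplied by (n-1)/(n psi): the form in which convexity enters the Pohozaev
    argument. *)
Lemma drift_ge (r : R) : 0 < r -> (n.-1)%:R / n%:R * A r <= Psi r * b r.
Proof.
move=> r0; have ps : 0 < psi r by exact: psi_gt0.
have E : psi r ^+ n = A r * psi r.
  by rewrite -[RHS]/(psi r ^+ n.-1 * psi r) -exprSr prednK// ltnW.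
rewrite /b /drift -(ler_pM2r ps) -[leLHS]mulrA -E.
rewrite mulrAC ler_pdivrMr// (_ : _ * n%:R = (n.-1)%:R * (n%:R * f1 r * Psi r)); last first.
  by field; rewrite gt_eqF.
by apply: ler_wpM2l => //; exact: psi_pow_le.
Qed.

(** Equality holds at q + 1 = n p/(n - p), so this is the place of the assumption q >= p^* - 1. *)
Lemma pohozaev_exponents : (p - 1) / p + (q + 1)^-1 <= (n.-1)%:R / n%:R.
Proof.
have np : 0 < n%:R - p by rewrite subr_gt0.
have h : (q + 1)^-1 <= (n%:R - p) / (n%:R * p).
  rewrite -[leRHS]invrK lef_pV2 ?posrE; last first.
  - by rewrite invr_gt0 divr_gt0// mulr_gt0.
  - by rewrite ltr_wpDr// ltW.
  - by apply: le_trans exponent_bound; rewrite invf_div mulrAC.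
rewrite (le_trans (lerD (lexx _) h))// le_eqVlt; apply/orP; left; apply/eqP.
have -> : (n.-1)%:R = n%:R - 1 :> R by rewrite -subn1 natrB// ltnW.
by field; rewrite !gt_eqF.
Qed.

(* Monotonicity of the Pohozaev functional
   Psi ((p-1)/p w^p + v^(q+1)/(q+1)) - P v / (q+1), where w^p = W1^(p/(p-1)). *)
Lemma pohozaev (r : R) : 0 < r -> Th r * w r / v r <= p / ((p - 1) * (q + 1)).
Proof.
move=> r0; pose s1 := q + 1; have s10 : 0 < s1 by rewrite ltr_wpDr// ltW.
pose Z s := Psi s * ((p - 1) / p * W1 s `^ (p / (p - 1)) + s1^-1 * v s `^ s1) -
  s1^-1 * (P s * v s).
have W1p s : 0 < s -> W1 s `^ (p / (p - 1)) = w s * W1 s.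
  move=> s0; have -> : p / (p - 1) = (p - 1)^-1 + 1 by field.
  by rewrite powRD ?powRr1 ?(gt_eqF (W1_gt0 s0)) ?implybT// ltW// W1_gt0.
have vs1 s : 0 < s -> v s `^ s1 = v s `^ q * v s.
  by move=> s0; rewrite powRD ?powRr1 ?(gt_eqF (v0 s0)) ?implybT// ltW// v0.
(* The terms in v^q w Psi and in v^(q+1) A cancel. The remaining bracket is nonpositive by
   [pohozaev_exponents] and [drift_ge]. *)
have dZ (s : R) : 0 < s -> is_derive s (1:R) Z
    (w s * W1 s * (((p - 1) / p + s1^-1) * A s - Psi s * b s)).
  move=> s0.
  have dPsi : is_derive s (1:R) Psi (A s) by exact: is_derive_Vol.
  have d1 := is_derive_scale ((p - 1) / p) (is_derive_powR_log (p / (p - 1)) (W1_gt0 s0) (is_derive_W1 s0)).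
  have d2 := is_derive_scale s1^-1 (is_derive_powR_log s1 (v0 s0) (dv s0)).
  have d3 := is_derive_scale s1^-1 (is_derive_mul (is_derive_P s0) (dv s0)).
  apply: (is_derive_cast (is_derive_sub (is_derive_mul dPsi (is_derive_add d1 d2)) d3)).
  rewrite W1p// vs1//.
  have -> : P s = W1 s * A s by rewrite /W1 -/(area n psi s) -/(A s) divfK// gt_eqF// A0.
  have := W1_gt0 s0; have := v0 s0 => vs ws.
  by field; rewrite !gt_eqF.
(* Z is at most a multiple of s on ]0, r], from Psi(s) <= s A(s), W1 <= M^q r and v <= M; being
   nonincreasing, it is then nonpositive. *)
have Z0 : 0 <= - Z r.
  have Kpos : 0 <= (p - 1) / p * (M `^ q * r) `^ (p / (p - 1)) + s1^-1 * M `^ s1.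
    by rewrite addr_ge0// mulr_ge0 ?powR_ge0 ?divr_ge0 ?invr_ge0// ltW.
  apply: (@ge0_of_vanish _ (fun s => - Z s)
    (A r * ((p - 1) / p * (M `^ q * r) `^ (p / (p - 1)) + s1^-1 * M `^ s1))) => // s s0 sr.
    have Ps : 0 < Psi s by exact: Vol_gt0.
    rewrite lerN2; apply: (@le_trans _ _ (Psi s * ((p - 1) / p * W1 s `^ (p / (p - 1)) + s1^-1 * v s `^ s1))).
      by rewrite /Z gerBl mulr_ge0 ?invr_ge0 ?(ltW s10)// mulr_ge0// ltW ?P_gt0 ?v0.
    rewrite [leRHS]mulrAC; apply: ler_pM.
    - exact: ltW.
    - by rewrite addr_ge0// mulr_ge0 ?powR_ge0 ?divr_ge0 ?invr_ge0// ltW.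
    - rewrite [leRHS]mulrC; apply: (@le_trans _ _ (s * A s)); first exact: Vol_le.
      apply: ler_wpM2l; [exact: ltW|exact: area_le].
    apply: lerD; apply: ler_wpM2l; rewrite ?divr_ge0 ?invr_ge0 ?(ltW pm) ?(ltW p0) ?(ltW s10)//.
      have W1M : W1 s <= M `^ q * r.
        rewrite /W1 ler_pdivrMr; last exact: A0.
        have := @P_le r r0 s; rewrite s0 sr => /(_ isT) /le_trans; apply.
        rewrite mulrAC; apply: ler_wpM2r; first exact/ltW/A0.
        by apply: ler_wpM2l => //; exact: powR_ge0.
      apply: ge0_ler_powR => //; rewrite ?nnegrE.
      - by rewrite divr_ge0 ?(ltW pm) ?(ltW p0).
      - exact/ltW/W1_gt0.
      - by rewrite mulr_ge0 ?powR_ge0// ltW.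
    have /andP[vs sM] := vM s0.
    by apply: ge0_ler_powR; rewrite ?nnegrE ?(ltW s10) ?(ltW vs) ?(ltW M0).
  rewrite lerN2; apply: (nonincreasing_gt0 dZ) => // t t0.
  rewrite mulr_ge0_le0//; first by rewrite mulr_ge0// ltW ?w_gt0 ?W1_gt0.
  rewrite subr_le0; apply: le_trans (drift_ge t0); apply: ler_wpM2r.
    exact/ltW/A0.
  exact: pohozaev_exponents.
have vr := v0 r0; have wr := w_gt0 r0; have W1r := W1_gt0 r0.
have Psr : 0 < Psi r by exact: Vol_gt0.
have Ar := A0 r0.
(* The term in v^(q+1) of Z <= 0 is dropped; division by W1 A v will leave the bound on Th w / v. *)
have ineq : Psi r * ((p - 1) / p * (w r * W1 r)) <= s1^-1 * (W1 r * A r * v r).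
  have PE : P r = W1 r * A r by rewrite /W1 -/(area n psi r) -/(A r) divfK// gt_eqF.
  have : 0 <= Psi r * (s1^-1 * v r `^ s1).
    by rewrite mulr_ge0 ?(ltW Psr)// mulr_ge0 ?invr_ge0 ?(ltW s10) ?powR_ge0.
  by move: Z0; rewrite /Z W1p// PE; lra.
have -> : Th r = Psi r / A r by [].
rewrite ler_pdivrMr// mulrAC ler_pdivrMr//.
rewrite -(ler_pM2r W1r) -(ler_pM2l (_ : 0 < (p - 1) / p)); last by rewrite divr_gt0.
have -> : (p - 1) / p * (Psi r * w r * W1 r) = Psi r * ((p - 1) / p * (w r * W1 r)) by ring.
apply: (le_trans ineq); rewrite le_eqVlt; apply/orP; left; apply/eqP.
by rewrite -/s1; field; rewrite !gt_eqF.
Qed.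

Section nonintegrable.
Hypothesis Ty : T r @[r --> +oo] --> +oo.
Hypothesis thb : Th r * b r @[r --> +oo] --> (1 : R).

(** L'Hopital's rule, with quotient of derivatives p/(p-1) (1 - Th b). *)
Lemma theta_pow_T : Th r `^ (p / (p - 1)) / T r @[r --> +oo] --> (0 : R).
Proof.
apply: (@lhopital_pinfty _ _ _
  (fun r => p / (p - 1) * Th r `^ (p / (p - 1)) * ((1 - b r * Th r) / Th r)) tp 0) => //.
- move=> r r0; apply: is_derive_powR_log; first exact: theta_gt0.
  exact: is_derive_theta.
- exact: is_derive_T.
- exact: tp_gt0.
have h : p / (p - 1) * (1 - Th r * b r) @[r --> +oo] --> p / (p - 1) * (1 - 1 : R).
  by apply: cvgMr; apply: cvgB => //; exact: cvg_cst.
rewrite subrr mulr0 in h; apply: cvg_trans h; apply: near_eq_cvg; near=> r.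
have r0 : 0 < r by near: r; apply: nbhs_pinfty_gt; exact: num_real.
have th0 : 0 < Th r by exact: theta_gt0.
have -> : Th r `^ (p / (p - 1)) = tp r * Th r.
  have -> : p / (p - 1) = (p - 1)^-1 + 1 by field.
  by rewrite powRD ?powRr1 ?(gt_eqF th0) ?implybT// ltW.
by field; rewrite pm0 !gt_eqF// tp_gt0.
Unshelve. all: by end_near. Qed.

(** The (p-1)-th power of Th w / v, as [yE] records, written through W1 = w^(p-1) because W1' = v^q
    - b W1 is explicit. *)
Let y r := (Th r / v r) `^ (p - 1) * W1 r.

Let y_ge0 r : 0 < r -> 0 <= y r.
Proof. by move=> r0; rewrite mulr_ge0 ?powR_ge0// ltW// W1_gt0. Qed.

Let is_derive_y (r : R) : 0 < r -> is_derive r (1:R) y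
  (y r / Th r * ((p - 1) * (1 - b r * Th r) + (p - 1) * (Th r * w r / v r) - b r * Th r)
   + (Th r / v r) `^ (p - 1) * v r `^ q).
Proof.
move=> r0; have th0 : 0 < Th r by exact: theta_gt0.
have vr := v0 r0.
have dth : is_derive r (1:R) Th (1 - b r * Th r) by exact: is_derive_theta.
have d1 := is_derive_div (lt0r_neq0 vr) dth (dv r0).
have d2 := @is_derive_powR_log _ (fun r => Th r / v r) r _ (p - 1) (divr_gt0 th0 vr) d1.
apply: (is_derive_cast (is_derive_mul d2 (is_derive_W1 r0))).
by rewrite /y; field; rewrite !gt_eqF.
Qed.

Let yE r : 0 < r -> Th r * w r / v r = y r `^ (p - 1)^-1.
Proof.
move=> r0; have th0 : 0 < Th r by exact: theta_gt0.
rewrite /y powRM ?powR_ge0 ?(ltW (W1_gt0 r0))// -powRrM mulfV// powRr1.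
  by rewrite -/(w r) mulrAC.
by rewrite divr_ge0 ?(ltW th0) ?(ltW (v0 r0)).
Qed.

(** Since kappa (p-1) = q + 1 - p, the left side is (Th^(p/(p-1)) v^kappa)^(p-1) / Th, and v^kappa
    <= 1/(kappa T) by [vkappa_ge]. With [theta_pow_T] the bound is o(1/Th). *)
Let forcing r : 0 < r -> (Th r / v r) `^ (p - 1) * v r `^ q <=
  (Th r `^ (p / (p - 1)) / T r / kappa) `^ (p - 1) / Th r.
Proof.
move=> r0; have th0 : 0 < Th r by exact: theta_gt0.
have vr := v0 r0; have Tr := T_gt0 r0.
have E1 : (Th r / v r) `^ (p - 1) * v r `^ q =
    (Th r `^ (p / (p - 1)) * (v r `^ (- kappa))^-1) `^ (p - 1) / Th r.
  rewrite -powRN opprK.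
  rewrite [in RHS]powRM ?powR_ge0// -!powRrM divfK// /kappa divfK//.
  rewrite powRM ?invr_ge0 ?(ltW th0) ?(ltW vr)// powR_div//.
  have -> : (v r)^-1 = v r `^ (-1) by rewrite powR_inv1// ltW.
  rewrite -powRrM.
  have -> : v r `^ (q + 1 - p) = v r `^ (-1 * (p - 1)) * v r `^ q.
    by rewrite -powRD ?(gt_eqF vr) ?implybT//; congr (_ `^ _); ring.
  by ring.
rewrite E1 ler_wpM2r ?invr_ge0 ?(ltW th0)//.
have v1 : 0 < v r `^ (- kappa) by rewrite powR_gt0.
apply: ge0_ler_powR; rewrite ?nnegrE ?(ltW pm)//.
- by rewrite mulr_ge0 ?powR_ge0 ?invr_ge0 ?(ltW v1).
- by apply: divr_ge0; [apply: divr_ge0; [exact: powR_ge0|exact: ltW]|exact: ltW].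
rewrite -mulrA; apply: ler_wpM2l; first exact: powR_ge0.
have TK : 0 < T r * kappa by exact: mulr_gt0.
rewrite -invfM lef_pV2 ?posrE//.
by rewrite mulrC; exact: vkappa_ge.
Qed.

Lemma theta_w_v : Th r * w r / v r @[r --> +oo] --> (0 : R).
Proof.
have y_to0 : y r @[r --> +oo] --> (0 : R).
  (* Half the gap left by the Pohozaev bound (p-1) Th w / v <= 1 - 2 d. The bracket in y', which is
     p (1 - Th b) - 1 + (p-1) Th w / v, is then eventually at most - d. *)
  pose d := (1 - p / (q + 1)) / 2.
  have s10 : 0 < q + 1 by rewrite ltr_wpDr// ltW.
  have d0 : 0 < d by rewrite divr_gt0// subr_gt0 ltr_pdivrMr// mul1r exponent_gt.
  apply: (decay_cvg0 d0 y_ge0 is_derive_y (is_derive_Vol n hpsi)) => //.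
  - by move=> r r0; exact: Vol_gt0.
  - exact: Vol_cvgy.
  move=> e e0.
  have f0 : (Th r `^ (p / (p - 1)) / T r / kappa) `^ (p - 1) @[r --> +oo] --> (0 : R).
    apply: cvg_powR0 => //.
      by move=> r r0; apply: divr_ge0; [apply: divr_ge0; [exact: powR_ge0|exact/ltW/T_gt0]|exact: ltW].
    have h := cvgM theta_pow_T (cvg_cst kappa^-1).
    by rewrite mul0r in h; exact: h.
  have /cvgrPdist_le /(_ _ e0) fe := f0.
  have dp : 0 < d / p by rewrite divr_gt0.
  have /cvgrPdist_le /(_ _ dp) be := thb.
  near=> r.
  have r0 : 0 < r by near: r; apply: nbhs_pinfty_gt; exact: num_real.
  have th0 : 0 < Th r by exact: theta_gt0.
  have h1 : `|1 - Th r * b r| <= d / p by near: r.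
  have h2 : `|0 - (Th r `^ (p / (p - 1)) / T r / kappa) `^ (p - 1)| <= e by near: r.
  (* The weight g/G of [decay_cvg0], for G = [Vol], is 1/Th. *)
  have -> : area n psi r / Vol n psi r = (Th r)^-1 by rewrite /Th /theta invf_div.
  have fr : (Th r / v r) `^ (p - 1) * v r `^ q <= e / Th r.
    apply: (le_trans (forcing r0)); apply: ler_wpM2r; first by rewrite invr_ge0 ltW.
    by move: h2; rewrite sub0r normrN ger0_norm ?powR_ge0.
  have hz : (p - 1) * (Th r * w r / v r) <= 1 - 2 * d.
    have -> : 1 - 2 * d = (p - 1) * (p / ((p - 1) * (q + 1))).
      by rewrite /d; field; rewrite pm0 gt_eqF.
    by rewrite ler_pM2l// pohozaev.
  have hb : p * (1 - Th r * b r) <= d.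
    by rewrite mulrC -ler_pdivlMr//; exact: le_trans (ler_norm _) h1.
  have yr := y_ge0 r0.
  have br : (p - 1) * (1 - b r * Th r) + (p - 1) * (Th r * w r / v r) - b r * Th r <= - d.
    have -> : b r * Th r = Th r * b r by rewrite mulrC.
    have E : (p - 1) * (1 - Th r * b r) = p * (1 - Th r * b r) - 1 + Th r * b r by ring.
    rewrite E; lra.
  have yth : 0 <= y r / Th r by rewrite divr_ge0// ltW.
  apply: (le_trans (lerD (ler_wpM2l yth br) fr)).
  by rewrite le_eqVlt; apply/orP; left; apply/eqP; ring.
have h : y r `^ (p - 1)^-1 @[r --> +oo] --> (0 : R).
  by apply: cvg_powR0 => //; rewrite invr_gt0.
apply: cvg_trans h; apply: near_eq_cvg; near=> r.
have r0 : 0 < r by near: r; apply: nbhs_pinfty_gt; exact: num_real.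
by rewrite yE.
Unshelve. all: by end_near. Qed.

(** L'Hopital's rule for P needs this, and v may tend to 0. As Th w / v -> 0, the function v^q
    Psi^(1/2) is eventually nondecreasing, so P >= v^q Psi is at least a multiple of Psi^(1/2). *)
Lemma P_cvgy : P r @[r --> +oo] --> +oo.
Proof.
(* Below this threshold for Th w / v, the logarithmic derivative (1/2 - q Th w / v) / Th of F is
   nonnegative. *)
have q20 : 0 < (2 * q)^-1 by rewrite invr_gt0 mulr_gt0.
have /cvgrPdist_le /(_ _ q20) [R0 [_ HR]] := theta_w_v.
pose c0 := Num.max R0 0.
have c00 r : c0 < r -> 0 < r by rewrite /c0 gt_max => /andP[].
pose F r := v r `^ q * Psi r `^ 2^-1.
have dF (r : R) : c0 < r -> is_derive r (1:R) F
    (F r / Th r * (2^-1 - q * (Th r * w r / v r))).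
  move=> /c00 r0; have Psr : 0 < Psi r by exact: Vol_gt0.
  have Ar := A0 r0; have vr := v0 r0.
  have d1 := is_derive_powR_log q vr (dv r0).
  have d2 := is_derive_powR_log 2^-1 Psr (is_derive_Vol n hpsi r0).
  apply: (is_derive_cast (is_derive_mul d1 d2)).
  rewrite /F /Th /theta -/(Psi r) -/(A r); field.
  by rewrite !gt_eqF.
have ndF : forall s t, c0 < s -> s <= t -> F s <= F t.
  apply: (nondecreasing_gt0 dF) => r c0r; have r0 := c00 r c0r.
  have Rr : R0 < r by move: c0r; rewrite /c0 gt_max => /andP[].
  have th0 : 0 < Th r by exact: theta_gt0.
  apply: mulr_ge0; first by rewrite divr_ge0 ?(ltW th0)// mulr_ge0 ?powR_ge0.
  have := HR r Rr; rewrite /= sub0r normrN => h.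
  have : q * (Th r * w r / v r) <= q * (2 * q)^-1.
    by rewrite ler_pM2l//; exact: le_trans (ler_norm _) h.
  have -> : q * (2 * q)^-1 = 2^-1 by field; rewrite gt_eqF.
  by rewrite subr_ge0.
pose c1 := c0 + 1; have c01 : c0 < c1 by rewrite ltrDl.
have Fc : 0 < F c1.
  have c10 := c00 c1 c01.
  rewrite mulr_gt0 ?powR_gt0 ?v0//; exact: Vol_gt0.
apply/cvgryPge => B.
have /cvgryPge /(_ ((`|B| / F c1) `^ 2)) Vb : Psi r @[r --> +oo] --> +oo by exact: Vol_cvgy.
near=> r.
have c1r : c1 <= r by near: r; apply: nbhs_pinfty_ge; exact: num_real.
have r0 : 0 < r by apply: c00; exact: lt_le_trans c1r.
have Psr : 0 < Psi r by exact: Vol_gt0.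
have hV : (`|B| / F c1) `^ 2 <= Psi r by near: r.
have BF : 0 <= `|B| / F c1 by rewrite divr_ge0// ltW.
have hV2 : `|B| / F c1 <= Psi r `^ 2^-1.
  have -> : `|B| / F c1 = ((`|B| / F c1) `^ 2) `^ 2^-1.
    by rewrite -powRrM mulfV// powRr1.
  by apply: ge0_ler_powR; rewrite ?nnegrE ?powR_ge0 ?invr_ge0 ?(ltW Psr).
apply: le_trans (P_ge r0); apply: (le_trans (ler_norm B)).
rewrite ler_pdivrMr// mulrC in hV2; apply: (le_trans hV2).
have -> : v r `^ q * Psi r = F r * Psi r `^ 2^-1.
  rewrite /F -mulrA -powRD ?(gt_eqF Psr) ?implybT//.
  by rewrite (_ : 2^-1 + 2^-1 = 1 :> R) ?powRr1 ?(ltW Psr)//; field.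
by apply: ler_wpM2r; [exact: powR_ge0|exact: ndF].
Unshelve. all: by end_near. Qed.

(** L'Hopital's rule for the reciprocal, whose quotient of derivatives is 1 - q Th w / v. *)
Lemma P_equiv : P r / (v r `^ q * Psi r) @[r --> +oo] --> (1 : R).
Proof.
have h : v r `^ q * Psi r / P r @[r --> +oo] --> (1 : R).
  apply: (@lhopital_pinfty _ _ _
    (fun r => q * v r `^ q * (- w r / v r) * Psi r + v r `^ q * A r)
    (fun r => v r `^ q * A r) 0) => //.
  - move=> r r0; exact: is_derive_mul (is_derive_powR_log q (v0 r0) (dv r0)) (is_derive_Vol n hpsi r0).
  - exact: is_derive_P.
  - by move=> r r0; rewrite mulr_gt0 ?powR_gt0 ?v0 ?A0.
  - exact: P_cvgy.
  have h : 1 - q * (Th r * w r / v r) @[r --> +oo] --> (1 - q * 0 : R).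
    by apply: cvgB; [exact: cvg_cst|apply: cvgMr; exact: theta_w_v].
  rewrite mulr0 subr0 in h; apply: cvg_trans h; apply: near_eq_cvg; near=> r.
  have r0 : 0 < r by near: r; apply: nbhs_pinfty_gt; exact: num_real.
  have vr := v0 r0; have Ar := A0 r0.
  rewrite /Th /theta -/(Psi r) -/(A r); field.
  by rewrite !gt_eqF// powR_gt0.
have -> : (fun r => P r / (v r `^ q * Psi r)) = (fun r => (v r `^ q * Psi r / P r)^-1).
  by apply/funext => r; rewrite invf_div.
by rewrite -[X in _ --> X]invr1; exact: (cvgV (oner_neq0 R) h).
Unshelve. all: by end_near. Qed.

(** [is_derive_vkappa] and [P_equiv] give v^-kappa / T -> kappa by l'Hopital's rule; the power
    -1/kappa is then taken. *)
Lemma profile_cvg_nonintegrable :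
  T r `^ kappa^-1 * v r @[r --> +oo] --> kappa^-1 `^ kappa^-1.
Proof.
have h : v r `^ (- kappa) / T r @[r --> +oo] --> kappa.
  apply: (@lhopital_pinfty _ _ _
    (fun r => kappa * ((P r / (v r `^ q * Psi r)) `^ (p - 1)^-1 * tp r)) tp 0) => //.
  - exact: is_derive_vkappa.
  - exact: is_derive_T.
  - exact: tp_gt0.
  have h : kappa * (P r / (v r `^ q * Psi r)) `^ (p - 1)^-1 @[r --> +oo] --> kappa * (1 `^ (p - 1)^-1).
    by apply: cvgMr; apply: cvg_powR => //; exact: P_equiv.
  rewrite powR1 mulr1 in h; apply: cvg_trans h; apply: near_eq_cvg; near=> r.
  have r0 : 0 < r by near: r; apply: nbhs_pinfty_gt; exact: num_real.
  by rewrite mulrA mulfK// gt_eqF// tp_gt0.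
have := cvg_powR (c := - kappa^-1) kappa0 h.
have -> : kappa `^ (- kappa^-1) = kappa^-1 `^ kappa^-1.
  by rewrite -(powR_inv1 (ltW kappa0)) -powRrM mulN1r.
apply: cvg_trans; apply: near_eq_cvg; near=> r.
have r0 : 0 < r by near: r; apply: nbhs_pinfty_gt; exact: num_real.
have Tr := T_gt0 r0.
rewrite powRM ?powR_ge0 ?invr_ge0 ?(ltW Tr)// -powRrM mulrNN mulfV ?gt_eqF//.
rewrite powRr1 ?(ltW (v0 r0))// -(powR_inv1 (ltW Tr)) -powRrM mulrNN mul1r.
by rewrite mulrC.
Unshelve. all: by end_near. Qed.

End nonintegrable.

Section integrable.
Variables (lambda Tinf : R).
Hypotheses (l0 : 0 < lambda) (vl : v r @[r --> +oo] --> lambda)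
  (TT : T r @[r --> +oo] --> Tinf).

(** Strict, because Tinf - T serves as a denominator. *)
Let T_lt (r : R) : 0 < r -> T r < Tinf.
Proof.
move=> r0; have nd := nondecreasing_gt0 is_derive_T (fun r r0 => ltW (tp_gt0 r0)).
have T1 : T r < T (r + 1).
  have [|||x xab E] := @MVT _ T tp r (r + 1); first by rewrite ltrDl.
  - move=> x; rewrite in_itv/= => /andP[rx _]; apply: is_derive_T; exact: lt_trans rx.
  - apply: derivable_within_continuous => x; rewrite in_itv/= => /andP[rx _].
    by have [] := is_derive_T (lt_le_trans r0 rx).
  move: xab; rewrite in_itv/= => /andP[rx _].
  rewrite -subr_gt0 E addrAC subrr add0r mulr1; apply: tp_gt0.
  exact: lt_trans rx.
apply: (lt_le_trans T1); apply: (cvgr_to_ge TT); near=> s; apply: nd.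
  by rewrite ltr_wpDr.
by near: s; apply: nbhs_pinfty_ge; exact: num_real.
Unshelve. all: by end_near. Qed.

Lemma profile_cvg_integrable :
  (v r - lambda) / (Tinf - T r) @[r --> +oo] --> lambda `^ (q / (p - 1)).
Proof.
have PPsi : P r / Psi r @[r --> +oo] --> lambda `^ q.
  apply: (@lhopital_pinfty _ _ _ (fun r => v r `^ q * A r) A 0) => //.
  - exact: is_derive_P.
  - exact: is_derive_Vol.
  - exact: Vol_cvgy.
  apply: cvg_trans (cvg_powR (c := q) l0 vl); apply: near_eq_cvg; near=> r.
  have r0 : 0 < r by near: r; apply: nbhs_pinfty_gt; exact: num_real.
  by rewrite mulfK// gt_eqF// A0.
apply: (@lhopital0_pinfty R (fun r => v r - lambda) (fun r => Tinf - T r) w tp 0).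
- by move=> r r0; apply: (is_derive_cast (is_derive_sub (dv r0) (is_derive_cst lambda r 1))); rewrite subr0.
- by move=> r r0; apply: (is_derive_cast (is_derive_sub (is_derive_cst Tinf r 1) (is_derive_T r0))); rewrite sub0r.
- exact: tp_gt0.
- by move=> r r0; rewrite subr_gt0 T_lt.
- by have := cvgB vl (cvg_cst lambda); rewrite subrr; exact.
- by have := cvgB (cvg_cst Tinf) TT; rewrite subrr; exact.
(* By [w_tp], the quotient of derivatives is (P/Psi)^(1/(p-1)). *)
have := cvg_powR (c := (p - 1)^-1) (powR_gt0 q l0) PPsi; rewrite -powRrM.
apply: cvg_trans; apply: near_eq_cvg; near=> r.
have r0 : 0 < r by near: r; apply: nbhs_pinfty_gt; exact: num_real.
by rewrite w_tp// mulfK// gt_eqF// tp_gt0.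
Unshelve. all: by end_near. Qed.

(** [vkappa_ge] in the limit; the power -1/kappa reverses the inequality. *)
Lemma profile_limit_bound : lambda <= kappa^-1 `^ kappa^-1 * Tinf `^ (- kappa^-1).
Proof.
have T0 : 0 < Tinf by apply: lt_trans (T_lt ltr01); exact: T_gt0.
have h : kappa * Tinf <= lambda `^ (- kappa).
  have cT : kappa * T r @[r --> +oo] --> kappa * Tinf by exact: cvgMr.
  apply: (ler_cvg_to cT (cvg_powR (c := - kappa) l0 vl)).
  near=> r; apply: vkappa_ge.
  by near: r; apply: nbhs_pinfty_gt; exact: num_real.
have kT : 0 < kappa * Tinf by rewrite mulr_gt0.
have -> : lambda = (lambda `^ (- kappa)) `^ (- kappa^-1).
  by rewrite -powRrM mulrNN mulfV ?gt_eqF// powRr1// ltW.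
have -> : kappa^-1 `^ kappa^-1 * Tinf `^ (- kappa^-1) = (kappa * Tinf) `^ (- kappa^-1).
  rewrite powRM ?(ltW kappa0) ?(ltW T0)//; congr (_ * _).
  by rewrite -(powR_inv1 (ltW kappa0)) -powRrM mulN1r.
rewrite [leLHS]powRN [leRHS]powRN lef_pV2 ?posrE ?powR_gt0//.
by apply: ge0_ler_powR; rewrite ?nnegrE ?invr_ge0 ?(ltW kappa0) ?(ltW kT) ?powR_ge0.
Unshelve. all: by end_near. Qed.

End integrable.

End solution_profile.

(** * Essential limits at infinity *)

Section essential_limits.
Context {R : realType}.
Local Notation mu := (@lebesgue_measure R).

Lemma ess_pinfty_cvg (F G : R -> R) (l : R) : G r @[r --> +oo] --> l ->
  {ae mu, forall r, 0 < r -> F r = G r} -> F r @[r --> ess_pinfty R] --> l.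
Proof.
move=> cG FG B /cG [M0 [_ HM]]; exists (Num.max M0 0).
move: FG; apply: ae_mono => r E; rewrite gt_max => /andP[Mr r0].
by rewrite /= E//; exact: HM.
Qed.

(** Every interval near infinity contains points where v is close to l. A given r lies between two
    of them, and monotonicity transfers the estimate to r. *)
Lemma ess_pinfty_monotone (u v : R -> R) (l : R) :
  (forall r s, 0 < r -> r <= s -> v s <= v r) ->
  {ae mu, forall r, 0 < r -> u r = v r} ->
  u r @[r --> ess_pinfty R] --> l -> v r @[r --> +oo] --> l.
Proof.
move=> nv uv ul; apply/cvgrPdist_le => /= e e0.
have Bn : nbhs l [set x | `|l - x| <= e].
  have := @cvgrPdist_le _ _ _ (nbhs l) _ id l; move=> [+ _]; apply => //.
have [M HM] := ul _ Bn.
pose m := Num.max M 0.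
have ex a b : m <= a -> a < b -> exists2 r, a < r < b & `|l - v r| <= e.
  rewrite /m ge_max => /andP[Ma a0] ab.
  have [//|H] := pselect (exists2 r, a < r < b & `|l - v r| <= e).
  exfalso; apply: (ae_open_false ab); move: HM uv; apply: ae_mono2 => r H1 H2 /andP[ar rb].
  apply: H; exists r; first by rewrite ar.
  rewrite -H2; last exact: le_lt_trans ar.
  by apply: H1; exact: le_lt_trans ar.
near=> r.
have mr : m + 1 <= r by near: r; apply: nbhs_pinfty_ge; exact: num_real.
have m0 : 0 <= m by rewrite le_max lexx orbT.
have mr' : m < r by apply: lt_le_trans mr; rewrite ltrDl.
have r0 : 0 < r := le_lt_trans m0 mr'.
have [s /andP[ms sr] hs] := ex m r (lexx m) mr'.
have [t /andP[rt _] ht] := ex r (r + 1) (ltW mr') (ltr_pwDr ltr01 (lexx r)).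
have s0 : 0 < s := le_lt_trans m0 ms.
have h1 := nv s r s0 (ltW sr); have h2 := nv r t r0 (ltW rt).
move: hs ht; rewrite !ler_distlC => /andP[a1 a2] /andP[b1 b2].
by apply/andP; split; lra.
Unshelve. all: by end_near. Qed.

End essential_limits.

(** * The two asymptotic regimes of radial solutions *)

Theorem theorem1p5 (R : realType) (n : nat) (psi : R -> R) (p q : R)
    (hn : (2 <= n)%N) (hpsi : model_function psi)
    (hp1 : 1 < p) (hpn : p < n%:R)
    (hq : n%:R * p / (n%:R - p) - 1 <= q) :
  (~ Theta_pow_L1 n psi p ->
   (exists gamma : R, 0 <= gamma /\ gamma < 1 /\
      exists ell : R, 0 < ell /\
        (r `^ gamma * derive1 psi r / psi r @[r --> +oo] --> ell)) \/
   ((derive1 psi r / psi r @[r --> +oo] --> +oo) /\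
    (psi r / derive1 psi r * derive1 (fun s => ln (derive1 psi s / psi s)) r
       @[r --> +oo] --> (0 : R))) ->
   forall u : R -> R, radial_solution n psi p q u ->
     (\int[lebesgue_measure]_(s in `]0, r]) Theta_pow n psi p s)
         `^ ((p - 1) / (q + 1 - p)) * u r
       @[r --> ess_pinfty R] -->
     ((p - 1) / (q + 1 - p)) `^ ((p - 1) / (q + 1 - p)))
  /\
  (Theta_pow_L1 n psi p ->
   forall (u : R -> R) (lambda : R), radial_solution n psi p q u ->
     u r @[r --> ess_pinfty R] --> lambda -> 0 < lambda ->
     ((\int[lebesgue_measure]_(s in `]r, +oo[) Theta_pow n psi p s)^-1
          * (u r - lambda)
        @[r --> ess_pinfty R] --> lambda `^ (q / (p - 1)))
     /\
     lambda <= ((p - 1) / (q + 1 - p)) `^ ((p - 1) / (q + 1 - p)) *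
       (\int[lebesgue_measure]_(s in `]0, +oo[) Theta_pow n psi p s)
         `^ (- ((p - 1) / (q + 1 - p)))).
Proof.
have [f [f1 [psiE df df1]]] := model_extension hpsi.
have dpsi (r : R) : 0 < r -> is_derive r (1:R) psi (f1 r).
  by move=> r0; exact: (model_is_derive psiE df r0).
have f1_ge1 (r : R) : 0 < r -> 1 <= f1 r by move=> /ltW; exact: (model_f1_ge1 hpsi psiE df).
have f1_le (r s : R) : 0 < r -> r <= s -> f1 r <= f1 s.
  by move=> /ltW; exact: (model_f1_le hpsi psiE df).
have psi_ge (r : R) : 0 < r -> r <= psi r by move=> /ltW; exact: (model_ge_id hpsi psiE df).
have psi_le (r s : R) : 0 < r -> r <= s -> psi r <= psi s.
  by move=> /ltW; exact: (model_le hpsi psiE df).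
have psi_mul (r : R) : 0 < r -> psi r <= r * f1 r.
  by move=> /ltW; exact: (model_le_mul hpsi psiE df).
have n0 : (0 < n)%N by exact: ltnW.
have q0 : 0 <= q.
  have := exponent_gt hp1 hpn hq => pq; rewrite ltW//.
  by have := lt_trans hp1 pq; rewrite ltrDr.
pose tp r := theta n psi r `^ (p - 1)^-1.
have rtp : regular0 tp by exact: (regular0_tp hn hpsi dpsi psi_ge psi_le hp1).
have tp0 (r : R) : 0 < r -> 0 <= tp r by move=> _; exact: powR_ge0.
have TpE (r : R) : 0 < r -> Theta_pow n psi p r = tp r.
  by move=> r0; rewrite /Theta_pow /tp ThetaE.
have TL1 : Theta_pow_L1 n psi p <->
    (@lebesgue_measure R).-integrable `]0, +oo[ (EFin \o tp).
  have E1 : {in `]0, +oo[%classic, (EFin \o Theta_pow n psi p) =1 (EFin \o tp)}.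
    by move=> r; rewrite inE/= in_itv/= andbT => r0; rewrite /= TpE.
  have E2 : {in `]0, +oo[%classic, (EFin \o tp) =1 (EFin \o Theta_pow n psi p)}.
    move=> r rD; exact: (esym (E1 r rD)).
  have m0 : measurable (`]0, +oo[%classic : set (measurableTypeR R)) by [].
  split; [exact: (eq_integrable m0 _ _ E1)|exact: (eq_integrable m0 _ _ E2)].
have TE (r : R) : \int[lebesgue_measure]_(s in `]0, r]) Theta_pow n psi p s = prim0 tp r.
  by apply: eq_Rintegral => s; rewrite inE/= in_itv/= => /andP[s0 _]; rewrite TpE.
have Tinf : \int[lebesgue_measure]_(s in `]0, +oo[) Theta_pow n psi p s =
    \int[lebesgue_measure]_(s in `]0, +oo[) tp s.
  by apply: eq_Rintegral => s; rewrite inE/= in_itv/= andbT => s0; rewrite TpE.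
have kE : (p - 1) / (q + 1 - p) = ((q + 1 - p) / (p - 1))^-1 by rewrite invf_div.
split.
- move=> nL1 cases u hu.
  have [v [M [M0 vM uv dv]]] := profile_ode n0 hpsi hp1 q0 hu.
  have Ty : prim0 tp r @[r --> +oo] --> +oo.
    apply: (prim0_cvgy rtp tp0) => iL; exact: (nL1 (TL1.2 iL)).
  (* For r > 0 only: at 0 a two-sided derivative of psi would see its values on negative reals. *)
  have dE (r : R) : 0 < r -> derive1 psi r = f1 r.
    by move=> r0; have [_] := dpsi r r0; rewrite derive1E.
  have thb : theta n psi r * drift n psi f1 r @[r --> +oo] --> (1 : R).
    case: cases => [[gamma [g0 [g1 [ell [l0 hl]]]]]|[_ hl]].
      apply: (drift_theta_power hn hpsi dpsi psi_ge g0 g1 l0).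
      apply: cvg_trans hl; apply: near_eq_cvg; near=> r.
      have r0 : 0 < r by near: r; apply: nbhs_pinfty_gt; exact: num_real.
      by rewrite dE.
    apply: (drift_theta_log hn hpsi dpsi f1_ge1 psi_ge (f2 := derive1 f1)).
      by move=> r _; split; [exact: df1|rewrite derive1E].
    apply: cvg_trans hl; apply: near_eq_cvg; near=> r.
    have r0 : 0 < r by near: r; apply: nbhs_pinfty_gt; exact: num_real.
    have pr : 0 < psi r by exact: lt_le_trans (psi_ge r r0).
    have fr : 0 < f1 r by exact: lt_le_trans (f1_ge1 r r0).
    have d1 : is_derive r (1:R) f1 (derive1 f1 r) by split; [exact: df1|rewrite derive1E].
    have dh := is_derive_div (lt0r_neq0 pr) d1 (dpsi r r0).
    have dl := is_derive1_comp (g := fun s => f1 s / psi s) (is_derive1_ln (divr_gt0 fr pr)) dh.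
    have dl' : is_derive r (1:R) (fun s => ln (derive1 psi s / psi s))
        ((f1 r / psi r)^-1 * ((derive1 f1 r - f1 r / psi r * f1 r) / psi r)).
      apply: (is_derive_near _ dl); near=> s.
      have s0 : 0 < s by near: s; exact: lt_nbhsr.
      by rewrite (dE s s0).
    (* The logarithmic derivative of psi'/psi, in the form that [drift_theta_log] expects. *)
    have E : derive1 (fun s => ln (derive1 psi s / psi s)) r =
        (derive1 f1 r - f1 r / psi r * f1 r) / f1 r.
      have [_ E] := dl'; rewrite derive1E E.
      by field; rewrite !gt_eqF.
    by rewrite E (dE r r0).
  (* u = v almost everywhere, so an ordinary limit for v is an essential limit for u. *)
  rewrite kE; apply: (@ess_pinfty_cvg _ _ (fun r => prim0 tp r `^ ((q + 1 - p) / (p - 1))^-1 * v r)).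
    exact: (profile_cvg_nonintegrable hn hpsi dpsi f1_ge1 f1_le psi_ge psi_le psi_mul hp1 hpn hq M0 vM dv Ty thb).
  by move: uv; apply: ae_mono => r E r0; rewrite TE E.
- move=> hL u lambda hu ul l0.
  have [v [M [M0 vM uv dv]]] := profile_ode n0 hpsi hp1 q0 hu.
  have vni (r s : R) : 0 < r -> r <= s -> v s <= v r.
    by apply: (nonincreasing_gt0 dv) => t t0; rewrite oppr_le0 powR_ge0.
  (* The essential limit of u is upgraded to an ordinary limit of its monotone representative. *)
  have vl : v r @[r --> +oo] --> lambda by exact: ess_pinfty_monotone vni uv ul.
  have iL1 := TL1.1 hL.
  have TT := prim0_cvg rtp tp0 iL1.
  split.
    apply: (@ess_pinfty_cvg _ _ (fun r => (v r - lambda) /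
      (\int[lebesgue_measure]_(s in `]0, +oo[) tp s - prim0 tp r))).
      exact: (profile_cvg_integrable hn hpsi dpsi psi_ge psi_le hp1 hpn hq vM dv l0 vl TT).
    have tailE (r : R) : 0 < r -> \int[lebesgue_measure]_(s in `]r, +oo[) Theta_pow n psi p s =
        \int[lebesgue_measure]_(s in `]0, +oo[) tp s - prim0 tp r.
      move=> r0; rewrite -(prim0_tail iL1 r0); apply: eq_Rintegral => s.
      rewrite inE/= in_itv/= andbT => rs; apply: TpE; exact: lt_trans r0 rs.
    move: uv; apply: ae_mono => r E r0; rewrite (tailE r r0) (E r0); exact: mulrC.
  rewrite Tinf kE.
  exact: (profile_limit_bound hn hpsi dpsi psi_ge psi_le hp1 hpn hq vM dv l0 vl TT).
Unshelve. all: by end_near. Qed.
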